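(* For $\alpha,\beta$ with $\alpha>\beta+1/2>0$, let $X_{\alpha,\beta}=(X_{\alpha,\beta}(t))_{t\ge 0}$ be a centered Gaussian process with $X_{\alpha,\beta}(0)=0$ and covariance function $$\mathbb{E}\, X_{\alpha,\beta}(t)X_{\alpha,\beta}(s)=\frac{2^{2\beta+1}(ts)^{\alpha}}{(t+s)^{2\beta+1}},\qquad t,s>0.$$ Then there are constants $\tilde\kappa_{\alpha,\beta}\in(0,\infty)$, depending only on $\alpha$ and $\beta$, such that for all such $\alpha,\beta$, as $\varepsilon\to0^+$, $$\kappa_{\alpha-1/2,\beta}\,|\log\varepsilon|^3\;\lesssim\;-\log\mathbb{P}\left(\sup_{t\in[0,1]}|X_{\alpha,\beta}(t)|\le\varepsilon\right)\;\lesssim\;\tilde\kappa_{\alpha,\beta}\,|\log\varepsilon|^3,$$ where $\kappa_{\alpha-1/2,\beta}=\dfrac{1}{3(\alpha-\beta-1/2)\pi^2}$. Further, $\tilde\kappa_{\alpha,\beta}\to\infty$ when $\alpha-\beta\to1/2$.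
   Context: The notation $f\lesssim g$ means $\limsup f/g\le 1$ (here as $\varepsilon\to0^+$). In general $\kappa_{\alpha,\beta}:=\frac{1}{3(\alpha-\beta)\pi^2}$. The process has the stochastic integral representation $$X_{\alpha,\beta}(t)=\sqrt{\frac{2^{2\beta+1}}{\Gamma(2\beta+1)}}\;t^{\alpha}\int_0^\infty x^{\beta}e^{-xt}\,\mathrm{d}B(x),\qquad t>0,$$ where $B$ is a standard Brownian motion. A version of the process with continuous paths on $[0,1]$ is used (it exists exactly when $\alpha>\beta+1/2$). *)

(* Defs.v *)
From HB Require Import structures.
From mathcomp Require Import all_boot all_order all_algebra.
From mathcomp Require Import all_classical all_reals all_analysis.

Set Implicit Arguments.
Unset Strict Implicit.
Unset Printing Implicit Defensive.

Import Order.TTheory GRing.Theory Num.Theory.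
Import numFieldNormedType.Exports.

Local Open Scope classical_set_scope.
Local Open Scope ring_scope.

Definition kappa (R : realType) (alpha beta : R) : R :=
  (3 * (alpha - beta) * pi ^+ 2)^-1.

Definition admissible (R : realType) (alpha beta : R) : Prop :=
  beta + 2^-1 < alpha /\ 0 < beta + 2^-1.

(* The library's [normal_prob m 0] is the uniform law on [0, 1]; a Gaussian law
   of variance 0 is the Dirac mass at its mean. *)
Definition gaussian_law (R : realType) (m s : R) : set R -> \bar R :=
  if s == 0 then \d_m else normal_prob m s.

Definition gaussian_rv d (T : measurableType d) (R : realType)
    (P : probability T R) (Y : T -> R) : Prop :=
  measurable_fun [set: T] Y /\
  exists m s : R, 0 <= s /\
    forall A : set R, measurable A -> P (Y @^-1` A) = gaussian_law m s A.

(* Joint Gaussianity of the finite-dimensional marginals, expressed by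
   their linear combinations; only times in [I] matter. *)
Definition gaussian_process d (T : measurableType d) (R : realType)
    (P : probability T R) (I : set R) (X : R -> {RV P >-> R}) : Prop :=
  forall (n : nat) (t : 'I_n -> R) (c : 'I_n -> R),
    (forall i, I (t i)) ->
    gaussian_rv P (fun w => \sum_(i < n) c i * X (t i) w).

(* The values [X t] for [t < 0] are irrelevant. Continuity of every path on
   [0, 1] makes the events [small_ball X eps] below measurable. *)
Record is_X d (T : measurableType d) (R : realType) (P : probability T R)
    (alpha beta : R) (X : R -> {RV P >-> R}) : Prop := IsX {
  X_gaussian : gaussian_process [set t | 0 <= t] X;
  X_centered : forall t : R, 0 <= t -> ('E_P[X t] = 0)%E;
  X_zero : forall w, X 0 w = 0;
  X_cov : forall t s : R, 0 < t -> 0 < s ->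
    'E_P[fun w => (X t w * X s w)%R]%E =
      (2 `^ (2 * beta + 1) * (t * s) `^ alpha
        / (t + s) `^ (2 * beta + 1))%:E;
  X_continuous : forall w,
    {within `[0 : R, 1], continuous (fun t : R => X t w : R)}
}.

Definition small_ball d (T : measurableType d) (R : realType)
    (P : probability T R) (X : R -> {RV P >-> R}) (eps : R) : set T :=
  [set w | (ereal_sup [set `|X t w|%:E | t in `[0%R, 1%R]] <= eps%:E)%E].

(* [f <~ g] as [eps -> 0+]. The quotient is that of the extended reals, where
   [x / 0 = +oo] for [0 < x] and [x / +oo = 0] for finite [x]. *)
Definition lesssim0 (R : realType) (f g : R -> \bar R) : Prop :=
  (limf_esup (fun eps => f eps / g eps) (0 : R)^'+ <= 1)%E.

(* Extended-real valued, so that a null probability gives [+oo]. *)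
Definition neg_log_small_ball d (T : measurableType d) (R : realType)
    (P : probability T R) (X : R -> {RV P >-> R}) (eps : R) : \bar R :=
  (- lne (P (small_ball X eps)))%E.

(* Main.v *)
Require Import Defs.
From HB Require Import structures.
From mathcomp Require Import all_boot all_order all_algebra.
From mathcomp Require Import all_classical all_reals all_analysis.
From mathcomp Require Import measurable_realfun.
From mathcomp Require Import ring lra zify.

Set Implicit Arguments.
Unset Strict Implicit.
Unset Printing Implicit Defensive.

Import Order.TTheory GRing.Theory Num.Theory.
Import numFieldNormedType.Exports.

Local Open Scope classical_set_scope.
Local Open Scope ring_scope.

(* Write [L = - ln eps], [gam = alpha - beta - 1/2] and [p = 2 beta + 1]. For
   Gaussian functionals [Z e] of [X], the expectation of
   [\prod_e expR (- (Z e) ^ 2 / 2)] is computed one factor at a time: weighting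
   by such a factor keeps the law Gaussian and replaces the covariance form [b]
   by [b v w - b v e * b w e / (1 + b e e)].

   Upper bound on the probability: for [Z e_k = X t_k / eps] the expectation is
   at most [\prod_k d_k ^ - 1/2], with [d_k] a lower bound for the variance of
   [Z e_k] up to combinations of the previous ones. With
   [y = (t - b) / (t + b)] the covariance becomes [(1 - y z) ^ - p], whose
   power series is compared with that of the Szego kernel [1 / (1 - y z)],
   where the conditional variance is the square of a Blaschke product. The
   choice [t_k = expR (- (L - pi * sqrt (gam * k)) / gam)], [k <= L ^ 2 / (pi ^ 2 * gam)],
   gives the constant.

   Lower bound on the probability: [P (\sum_e (Z e) ^ 2 <= 1)] is at least
   [E (expR (- mu * \sum_e (Z e) ^ 2)) - expR (- mu)], which is bounded below by
   the product of the [(1 + 2 * mu * b e e) ^ - 1/2]. With [mu = L ^ 4] this is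
   applied to a family controlling the supremum: [O(L)] interpolation nodes in
   each of [O(L)] geometric blocks, the interpolation errors at the points of a
   dyadic grid of mesh a power of [eps], and the dyadic increments below that
   mesh. *)

(** * Gaussian integrals on the line *)

(** Joint Gaussianity is given only through the laws of linear combinations. Hence neither a joint
    density nor a determinant appears: elimination needs only the expectations of the cosines of
    these combinations.

    The nodes [t_k] solve an extremal problem. At [t = expR (- (L - y) / gam)] the variable
    [X t / eps] has variance [expR (2 * y)]. If nodes are spaced by [h] on the logarithmic scale,
    the squared Blaschke factors of the smaller nodes cost at most a factor
    [expR (- pi ^ 2 / (2 * h))]. Half the logarithm of the conditional variance is then
    [y - pi ^ 2 / (4 * h)]; multiplied by the density [1 / h] it is maximal at
    [h = pi ^ 2 / (2 * y)], which is the local spacing of [y = pi * sqrt (gam * k)]. The maximum is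
    [y ^ 2 / pi ^ 2], and integrating it over [0 < y < L] and dividing by [gam] gives
    [L ^ 3 / (3 * pi ^ 2 * gam)].

    In the other direction [O(L)] blocks with [O(L)] nodes, each of cost [O(L)], give [L ^ 3]
    without a sharp constant; [mu = L ^ 4] makes [expR (- mu)] negligible against
    [expR (- K * L ^ 3)]. *)

Lemma integral_derive_eq0 (R : realType) (F f : R -> R) :
  (forall x, is_derive x (1 : R) F (f x)) -> continuous f ->
  (@lebesgue_measure R).-integrable setT (EFin \o f) ->
  F x @[x --> +oo] --> (0 : R) -> F (- x) @[x --> +oo] --> (0 : R) ->
  \int[@lebesgue_measure R]_x f x = 0.
Proof.
move=> dF cf intf Fy FNy.
pose mu := @lebesgue_measure R.
pose g n (x : R) := (f x * \1_(`[- n%:R, n%:R]%classic : set R) x)%:E.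
have mf : measurable_fun setT f by apply/measurable_EFinP; exact: measurable_int intf.
have h1 : (\int[mu]_x g n x)%E @[n --> \oo] --> (\int[mu]_x (f x)%:E)%E.
  apply: (@dominated_cvg _ (measurableTypeR R) R mu setT measurableT g (EFin \o f) (abse \o (EFin \o f))) => //.
  - move=> n; apply/measurable_EFinP/measurable_funM => //.
  - move=> x _; apply: cvg_near_cst; near=> n.
    rewrite /g indicE mem_set ?mulr1//= in_itv/= -ler_norml.
    by near: n; exact: nbhs_infty_ger.
  - exact: integrable_abse.
  - move=> n x _; rewrite /g /= lee_fin normrM ler_piMr// indicE.
    by case: (_ \in _); rewrite ?normr1 ?normr0.
have h2 : (\int[mu]_x g n x)%E @[n --> \oo] --> (0%:E : \bar R).
  have : (F n%:R - F (- n%:R))%:E @[n --> \oo] --> ((0 : R) - 0)%:E.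
    apply: cvg_EFin; first exact: nearW.
    apply: cvgB.
      by apply: (cvg_comp _ _ (@cvgr_idn R) Fy).
    by apply: (cvg_comp _ _ (@cvgr_idn R) FNy).
  rewrite subr0; apply: cvg_trans; apply: near_eq_cvg; near=> n.
  rewrite (_ : (\int[mu]_x g n x)%E = (\int[mu]_(x in `[(- n%:R)%R, n%:R]) (f x)%:E)%E); last first.
    rewrite [RHS]integral_mkcond; apply: eq_integral => x _.
    by rewrite /g patchE indicE; case: (_ \in _); rewrite ?mulr1 ?mulr0.
  rewrite EFinB; apply: esym; apply: continuous_FTC2.
  - rewrite gtrN// ltr0n; near: n; exact: nbhs_infty_gt.
  - by apply: continuous_subspaceT.
  - have cF : continuous F.
      by move=> x; apply: differentiable_continuous; apply/derivable1_diffP; case: (dF x).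
    split.
    + by move=> x _; case: (dF x).
    + by apply: cvg_at_right_filter; exact: cF.
    + by apply: cvg_at_left_filter; exact: cF.
  - by move=> x _; rewrite derive1E; apply: derive_val.
have /cvg_lim := h1 => /(_ (@ereal_hausdorff R)).
rewrite (cvg_lim (@ereal_hausdorff R) h2) /Rintegral => <-; by [].
Unshelve. all: by end_near. Qed.

Lemma integrable_dominated d (T : measurableType d) (R : realType)
    (mu : {measure set T -> \bar R}) (f g : T -> R) :
  measurable_fun setT f -> (forall x, `|f x| <= g x) ->
  mu.-integrable setT (EFin \o g) -> mu.-integrable setT (EFin \o f).
Proof.
move=> mf fg; apply: le_integrable => //; first exact/measurable_EFinP.
move=> x _ /=; rewrite lee_fin (le_trans (fg x))// ler_norm//.
Qed.

Lemma lebesgue_integrable_dominated (R : realType) (f g : R -> R) :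
  measurable_fun setT f -> (forall x, `|f x| <= g x) ->
  (@lebesgue_measure R).-integrable setT (EFin \o g) ->
  (@lebesgue_measure R).-integrable setT (EFin \o f).
Proof. exact: (@integrable_dominated _ (measurableTypeR R)). Qed.

(** Change of variables with the Radon-Nikodym derivative, which agrees almost everywhere with
    [normal_pdf] because both have the same integral over every measurable set. *)
Lemma integral_normal_prob (R : realType) (m s : R) (f : R -> R) :
  measurable_fun setT f -> (normal_prob m s).-integrable setT (EFin \o f) ->
  \int[normal_prob m s]_x f x =
  \int[@lebesgue_measure R]_x (f x * normal_pdf m s x).
Proof.
move=> mf intf; rewrite /Rintegral; congr fine.
have dom := normal_prob_dominates m s.
rewrite -(Radon_Nikodym_change_of_variables dom)//.
apply: ae_eq_integral => //.
- apply: emeasurable_funM; first exact/measurable_EFinP.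
  apply: (measurable_int (@lebesgue_measure R)).
  exact: Radon_Nikodym_integrable.
- apply/measurable_EFinP/measurable_funM => //; exact: measurable_normal_pdf.
- under [X in ae_eq _ _ _ X]eq_fun do rewrite EFinM.
  apply: ae_eqe_mul2l; rewrite Radon_NikodymE//=.
  case: cid => /= h [h1 h2 h3].
  apply: integral_ae_eq => //.
  + by apply/measurable_EFinP; exact: measurable_normal_pdf.
  + by move=> E _ mE; rewrite -h3.
Qed.

Section normal_moments.
Variables (R : realType) (m s : R).
Hypothesis s_gt0 : 0 < s.
Let mu := @lebesgue_measure R.
Let k := normal_pdf m s.
Let s0 : s != 0. Proof. by rewrite gt_eqF. Qed.

Lemma normal_pdf_expR (x : R) :
  k x = normal_peak s * expR (- (x - m) ^+ 2 / (s ^+ 2 *+ 2)).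
Proof. by rewrite /k normal_pdfE. Qed.

Lemma is_derive_normal_pdf (x : R) :
  is_derive x (1 : R) k (- (x - m) / s ^+ 2 * k x).
Proof.
rewrite (_ : k = (fun y => normal_peak s * expR (- (y - m) ^+ 2 / (s ^+ 2 *+ 2)))); last first.
  by apply/funext => y; rewrite normal_pdf_expR.
apply: is_derive_eq => /=.
rewrite /GRing.scale /= -mulr_natr; field; exact/s0.
Qed.

Let mk : measurable_fun setT k. Proof. exact: measurable_normal_pdf. Qed.
Let k_ge0 x : 0 <= k x. Proof. exact: normal_pdf_ge0. Qed.

(** Half of the Gaussian exponent absorbs the square, by [y * expR (- y) <= 1]; the other half is a
    normal density of standard deviation [sqrt 2 * s]. This is the integrable majorant for the first
    two moments. *)
Lemma sqr_normal_pdf_le (x : R) :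
  (x - m) ^+ 2 * k x <= 4 * s ^+ 2 * Num.sqrt 2 * normal_pdf m (Num.sqrt 2 * s) x.
Proof.
have sq2 : (0 : R) < Num.sqrt 2 by rewrite sqrtr_gt0.
rewrite normal_pdf_expR (@normal_pdfE _ _ (Num.sqrt 2 * s)) ?mulf_neq0 ?gt_eqF//.
rewrite /normal_fun exprMn sqr_sqrtr//.
set y := (x - m) ^+ 2 / (s ^+ 2 *+ 4).
have y0 : 0 <= y by rewrite divr_ge0 ?sqr_ge0// mulrn_wge0 ?sqr_ge0.
have e1 : - (x - m) ^+ 2 / (s ^+ 2 *+ 2) = - y - y.
  by rewrite /y; field; exact/s0.
have e2 : - (x - m) ^+ 2 / ((2 * s ^+ 2) *+ 2) = - y.
  by rewrite /y; field; exact/s0.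
have e3 : (x - m) ^+ 2 = 4 * s ^+ 2 * y by rewrite /y; field; exact/s0.
have e4 : normal_peak (Num.sqrt 2 * s) = (Num.sqrt 2)^-1 * normal_peak s.
  by rewrite /normal_peak exprMn sqr_sqrtr// -mulrA -mulrnAr sqrtrM// invfM.
rewrite e2 e4 {1}e3 e1 expRD.
have -> : 4 * s ^+ 2 * Num.sqrt 2 * ((Num.sqrt 2)^-1 * normal_peak s * expR (- y)) =
  4 * s ^+ 2 * normal_peak s * expR (- y) * 1 by field; rewrite gt_eqF.
have -> : 4 * s ^+ 2 * y * (normal_peak s * (expR (- y) * expR (- y))) =
  4 * s ^+ 2 * normal_peak s * expR (- y) * (y * expR (- y)) by ring.
apply: ler_wpM2l.
  by rewrite mulr_ge0 ?expR_ge0// mulr_ge0 ?normal_peak_ge0// mulr_ge0 ?sqr_ge0.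
rewrite expRN ler_pdivrMr ?expR_gt0// mul1r.
by apply: le_trans (expR_ge1Dx y); rewrite lerDr.
Qed.

Lemma integrable_sqr_normal_pdf :
  mu.-integrable setT (EFin \o (fun x => (x - m) ^+ 2 * k x)).
Proof.
apply: (@lebesgue_integrable_dominated _ _
  (fun x => 4 * s ^+ 2 * Num.sqrt 2 * normal_pdf m (Num.sqrt 2 * s) x)).
- apply: measurable_funM => //; apply: measurable_funX; exact: measurable_funB.
- by move=> x; rewrite ger0_norm ?sqr_normal_pdf_le// mulr_ge0 ?sqr_ge0.
- have := integrableZl measurableT (4 * s ^+ 2 * Num.sqrt 2)
    (integrable_normal_pdf m (Num.sqrt 2 * s)).
  by apply: eq_integrable.
Qed.

Lemma integrable_abs_normal_pdf :
  mu.-integrable setT (EFin \o (fun x => `|x - m| * k x)).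
Proof.
apply: (@lebesgue_integrable_dominated _ _
  (fun x => k x + (x - m) ^+ 2 * k x)).
- apply: measurable_funM => //; apply: measurableT_comp => //; exact: measurable_funB.
- move=> x; rewrite ger0_norm ?mulr_ge0// -{2}(mul1r (k x)) -mulrDl ler_wpM2r//.
  rewrite -real_normK ?num_real//; move: `|x - m| (normr_ge0 (x - m)) => a a0; nra.
- have := integrableD measurableT (integrable_normal_pdf m s) integrable_sqr_normal_pdf.
  exact: eq_integrable.
Qed.

Lemma continuous_normal : continuous k.
Proof. exact: continuous_normal_pdf. Qed.

End normal_moments.

Lemma normal_pdf_cvg0 (R : realType) (m s : R) : 0 < s ->
  normal_pdf m s x @[x --> +oo] --> (0 : R) /\
  normal_pdf m s (- x) @[x --> +oo] --> (0 : R).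
Proof.
move=> s0.
have h (u : R) : expR (- u ^+ 2 / (s ^+ 2 *+ 2)) <= expR (s ^+ 2 / 2) * expR (- u).
  rewrite -expRD ler_expR.
  have -> : - u ^+ 2 / (s ^+ 2 *+ 2) = s ^+ 2 / 2 - u - (u - s ^+ 2) ^+ 2 / (s ^+ 2 *+ 2).
    by field; rewrite gt_eqF.
  by rewrite gerBl divr_ge0 ?sqr_ge0// mulrn_wge0 ?sqr_ge0.
have p0 : 0 <= normal_peak s by exact: normal_peak_ge0.
have c (C : R) : C * expR (- x) @[x --> +oo] --> (0 : R).
  by rewrite -[X in _ --> X](mulr0 C); apply: cvgMr; exact: cvgr_expR.
split.
- apply: (squeeze_cvgr _ (cvg_cst 0) (c (normal_peak s * expR (s ^+ 2 / 2) * expR m))).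
  apply: nearW => x; rewrite normal_pdf_ge0/= normal_pdf_expR//.
  rewrite -!mulrA ler_wpM2l// (le_trans (h _))// -!expRD ler_expR; lra.
- apply: (squeeze_cvgr _ (cvg_cst 0) (c (normal_peak s * expR (s ^+ 2 / 2) * expR (- m)))).
  apply: nearW => x; rewrite normal_pdf_ge0/= normal_pdf_expR//.
  rewrite -!mulrA ler_wpM2l// (_ : (- x - m) ^+ 2 = (x + m) ^+ 2); last by ring.
  by rewrite (le_trans (h _))// -!expRD ler_expR; lra.
Qed.

Section normal_integrals.
Variables (R : realType) (m s : R).
Hypothesis s_gt0 : 0 < s.
Let mu := @lebesgue_measure R.
Let k := normal_pdf m s.
Let s0 : s != 0. Proof. by rewrite gt_eqF. Qed.
Let mk : measurable_fun setT k. Proof. exact: measurable_normal_pdf. Qed.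
Let k_ge0 x : 0 <= k x. Proof. exact: normal_pdf_ge0. Qed.
Let ck : continuous k. Proof. exact: continuous_normal. Qed.
Let intk : mu.-integrable setT (EFin \o k). Proof. exact: integrable_normal_pdf. Qed.

Lemma Rintegral_normal_pdf : \int[mu]_x k x = 1.
Proof. by rewrite /Rintegral integral_normal_pdf. Qed.

Let csub : continuous (fun x : R => x - m).
Proof. by move=> x; apply: cvgB; [exact: cvg_id|exact: cvg_cst]. Qed.

Let intxk : mu.-integrable setT (EFin \o (fun x => (x - m) * k x)).
Proof.
apply: (@lebesgue_integrable_dominated _ _ (fun x => `|x - m| * k x)).
- by apply: measurable_funM => //; exact: measurable_funB.
- by move=> x; rewrite normrM (ger0_norm (k_ge0 x)).
- exact: integrable_abs_normal_pdf.
Qed.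

(** The integrand is the derivative of [- s ^ 2 * k], which vanishes at both infinities. *)
Lemma normal_mean : \int[mu]_x ((x - m) * k x) = 0.
Proof.
have [k1 k2] := normal_pdf_cvg0 m s_gt0.
apply: (@integral_derive_eq0 R (fun x => - s ^+ 2 * k x) (fun x => (x - m) * k x)).
- move=> x; have dk := is_derive_normal_pdf m s_gt0 x.
  by apply: is_derive_eq; rewrite /GRing.scale /= /k; field.
- by move=> x; apply: cvgM; [exact: csub|exact: ck].
- exact: intxk.
- by rewrite -[X in _ --> X](mulr0 (- s ^+ 2)); apply: cvgMr; exact: k1.
- by rewrite -[X in _ --> X](mulr0 (- s ^+ 2)); apply: cvgMr; exact: k2.
Qed.

(** The derivative of [(x - m) * k x] is [k x - s ^ - 2 * (x - m) ^ 2 * k x], so this difference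
    integrates to [0]. *)
Lemma normal_variance : \int[mu]_x ((x - m) ^+ 2 * k x) = s ^+ 2.
Proof.
have sq2 : (0 : R) < Num.sqrt 2 * s by rewrite mulr_gt0// sqrtr_gt0.
have [k1 k2] := normal_pdf_cvg0 m s_gt0.
have [l1 l2] := normal_pdf_cvg0 m sq2.
pose C := 4 * s ^+ 2 * Num.sqrt 2.
have b x : `|(x - m) * k x| <= k x + C * normal_pdf m (Num.sqrt 2 * s) x.
  apply: (@le_trans _ _ (k x + (x - m) ^+ 2 * k x)); last first.
    by rewrite lerD2l; exact: sqr_normal_pdf_le.
  rewrite normrM (ger0_norm (k_ge0 x)) -{2}(mul1r (k x)) -mulrDl ler_wpM2r//.
  rewrite -real_normK ?num_real//; move: `|x - m| (normr_ge0 (x - m)) => a a0; nra.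
have int2 := integrable_sqr_normal_pdf m s_gt0.
have int2' : mu.-integrable setT (EFin \o (fun x => s ^- 2 * ((x - m) ^+ 2 * k x))).
  by have := integrableZl measurableT (s ^- 2) int2; apply: eq_integrable.
have : \int[mu]_x (k x - s ^- 2 * ((x - m) ^+ 2 * k x)) = 0.
  apply: (@integral_derive_eq0 R (fun x => (x - m) * k x)
    (fun x => k x - s ^- 2 * ((x - m) ^+ 2 * k x))).
  - move=> x; have dk := is_derive_normal_pdf m s_gt0 x.
    by apply: is_derive_eq; rewrite /GRing.scale /= /k; field.
  - move=> x; apply: cvgB; first exact: ck.
    apply: cvgM; first exact: cvg_cst.
    apply: cvgM; last exact: ck.
    by apply: cvgM; exact: csub.
  - by have := integrableB measurableT intk int2'; apply: eq_integrable.
  - apply: norm_cvg0; apply: (squeeze_cvgr _ (cvg_cst 0)); last first.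
      rewrite -[X in _ --> X](addr0 (0 : R)); apply: cvgD; first exact: k1.
      by rewrite -[X in _ --> X](mulr0 C); apply: cvgMr; exact: l1.
    by apply: nearW => x; rewrite normr_ge0/= b.
  - apply: norm_cvg0; apply: (squeeze_cvgr _ (cvg_cst 0)); last first.
      rewrite -[X in _ --> X](addr0 (0 : R)); apply: cvgD; first exact: k2.
      by rewrite -[X in _ --> X](mulr0 C); apply: cvgMr; exact: l2.
    by apply: nearW => x; rewrite normr_ge0/= b.
rewrite RintegralB// RintegralZl// Rintegral_normal_pdf => /eqP.
rewrite subr_eq0 => /eqP e; apply: (@mulfI _ (s ^- 2)); first by rewrite invr_eq0 expf_neq0.
by rewrite -e mulVf// expf_neq0.
Qed.

(** Differentiating under the integral produces a sine, and an integration by parts turns it back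
    into the cosine: as a function of [z] the integral satisfies [g' = - s ^ 2 * z * g]. The phase
    [a] is what the elimination needs, with [a] the value of another functional. *)
Lemma integral_cos_normal_pdf (a z : R) :
  \int[mu]_x (cos (a + z * (x - m)) * k x) =
  cos a * expR (- (s ^+ 2 * z ^+ 2 / 2)).
Proof.
pose f z (x : R) := cos (a + z * (x - m)) * k x.
pose g z := \int[mu]_x f z x.
have cl y : continuous (fun x : R => a + y * (x - m)).
  move=> x; apply: cvgD; first exact: cvg_cst.
  by apply: cvgM; [exact: cvg_cst|exact: csub].
have ccos y : continuous (fun x : R => cos (a + y * (x - m))).
  by move=> x; apply: continuous_comp; [exact: cl|exact: continuous_cos].
have csin y : continuous (fun x : R => sin (a + y * (x - m))).
  by move=> x; apply: continuous_comp; [exact: cl|exact: continuous_sin].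
have intf y : mu.-integrable setT (EFin \o f y).
  apply: (@lebesgue_integrable_dominated _ _ k) => //.
  - by apply: measurable_funM => //; apply: continuous_measurable_fun.
  - by move=> x; rewrite /f normrM (ger0_norm (k_ge0 x)) ler_piMl// ler_norml cos_geN1 cos_le1.
have intg y : mu.-integrable setT (EFin \o (fun x => sin (a + y * (x - m)) * ((x - m) * k x))).
  apply: (@lebesgue_integrable_dominated _ _ (fun x => `|x - m| * k x)).
  - apply: measurable_funM; first exact: continuous_measurable_fun.
    by apply: measurable_funM => //; exact: measurable_funB.
  - move=> x; rewrite !normrM (ger0_norm (k_ge0 x)) ler_piMl//.
      by rewrite mulr_ge0.
    by rewrite ler_norml sin_geN1 sin_le1.
  - exact: integrable_abs_normal_pdf.
have df y x : is_derive y (1 : R) (f^~ x) (- (sin (a + y * (x - m)) * ((x - m) * k x))).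
  rewrite /f.
  have dc : is_derive y (1 : R) (fun z => cos (a + z * (x - m))) (- sin (a + y * (x - m)) * (x - m)).
    apply: (@is_derive1_comp _ cos (fun z => a + z * (x - m))).
    by apply: is_derive_eq; rewrite /GRing.scale /=; ring.
  by apply: is_derive_eq; rewrite /GRing.scale /=; ring.
have ibp y : \int[mu]_x (sin (a + y * (x - m)) * ((x - m) * k x)) = s ^+ 2 * y * g y.
  have [k1 k2] := normal_pdf_cvg0 m s_gt0.
  have i1 : mu.-integrable setT (EFin \o (fun x => s ^+ 2 * y * f y x)).
    by have := integrableZl measurableT (s ^+ 2 * y) (intf y); apply: eq_integrable.
  have : \int[mu]_x (sin (a + y * (x - m)) * ((x - m) * k x) - s ^+ 2 * y * f y x) = 0.
    have bd x : `|- s ^+ 2 * (sin (a + y * (x - m)) * k x)| <= s ^+ 2 * k x.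
      rewrite normrM normrN (ger0_norm (sqr_ge0 s)) ler_wpM2l ?sqr_ge0//.
      by rewrite normrM (ger0_norm (k_ge0 x)) ler_piMl// ler_norml sin_geN1 sin_le1.
    apply: (@integral_derive_eq0 R (fun x => - s ^+ 2 * (sin (a + y * (x - m)) * k x))
      (fun x => sin (a + y * (x - m)) * ((x - m) * k x) - s ^+ 2 * y * f y x)).
    - move=> x; have dk := is_derive_normal_pdf m s_gt0 x.
      have ds : is_derive x (1 : R) (fun x => sin (a + y * (x - m))) (cos (a + y * (x - m)) * y).
        apply: (@is_derive1_comp _ sin (fun x => a + y * (x - m))).
        by apply: is_derive_eq; rewrite /GRing.scale /=; ring.
      by apply: is_derive_eq; rewrite /GRing.scale /= /f /k; field.
    - move=> x; apply: cvgB.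
        by apply: cvgM; [exact: csin|apply: cvgM; [exact: csub|exact: ck]].
      apply: cvgM; first exact: cvg_cst.
      by apply: cvgM; [exact: ccos|exact: ck].
    - by have := integrableB measurableT (intg y) i1; apply: eq_integrable.
    - apply: norm_cvg0; apply: (squeeze_cvgr _ (cvg_cst 0)); last first.
        by rewrite -[X in _ --> X](mulr0 (s ^+ 2)); apply: cvgMr; exact: k1.
      by apply: nearW => x; rewrite normr_ge0/= bd.
    - apply: norm_cvg0; apply: (squeeze_cvgr _ (cvg_cst 0)); last first.
        by rewrite -[X in _ --> X](mulr0 (s ^+ 2)); apply: cvgMr; exact: k2.
      by apply: nearW => x; rewrite normr_ge0/= bd.
  rewrite RintegralB// RintegralZl// => /eqP.
  by rewrite subr_eq0 => /eqP.
have dg y : is_derive y (1 : R) g (- (s ^+ 2 * y * g y)).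
  have Iy : `]y - 1, y + 1[%classic y by rewrite /= in_itv/=; apply/andP; split; lra.
  have d1E x t : partial1of2 f x t = - (sin (a + x * (t - m)) * ((t - m) * k t)).
    by rewrite partial1of2E; apply: derive_val.
  have ub x t : `]y - 1, y + 1[%classic x -> setT t -> `|partial1of2 f x t| <= `|t - m| * k t.
    move=> _ _; rewrite d1E normrN !normrM (ger0_norm (k_ge0 t)) ler_piMl//.
      by rewrite mulr_ge0.
    by rewrite ler_norml sin_geN1 sin_le1.
  have G0 t : 0 <= `|t - m| * k t by rewrite mulr_ge0.
  have db x t : `]y - 1, y + 1[%classic x -> setT t -> derivable (f^~ t) x 1.
    by move=> _ _; case: (df x t).
  have iG := integrable_abs_normal_pdf m s_gt0.
  have dd := derivable_under_integral measurableT Iy (fun x _ => intf x) db G0 iG ub.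
  have de := differentiation_under_integral measurableT Iy (fun x _ => intf x) db G0 iG ub.
  apply: DeriveDef; first exact: dd.
  rewrite -derive1E de -ibp.
  under eq_Rintegral do rewrite d1E.
  rewrite -[RHS]mulN1r -RintegralZl//.
  by apply: eq_Rintegral => x _; rewrite mulN1r.
have cst : g z * expR (s ^+ 2 * z ^+ 2 / 2) = g 0 * expR (s ^+ 2 * 0 ^+ 2 / 2).
  apply: (@is_derive_0_is_cst _ (fun z => g z * expR (s ^+ 2 * z ^+ 2 / 2))) => x.
  have de : is_derive x (1 : R) (fun z => expR (s ^+ 2 * z ^+ 2 / 2)) (expR (s ^+ 2 * x ^+ 2 / 2) * (s ^+ 2 * x)).
    apply: (@is_derive1_comp _ expR (fun z => s ^+ 2 * z ^+ 2 / 2)).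
    by apply: is_derive_eq; rewrite /GRing.scale /=; field.
  by apply: is_derive_eq; rewrite /GRing.scale /=; ring.
have g0 : g 0 = cos a.
  rewrite /g /f -[RHS]mulr1 -Rintegral_normal_pdf -RintegralZl//.
  by apply: eq_Rintegral => x _; rewrite mul0r addr0.
rewrite expr0n /= mulr0 mul0r expR0 mulr1 g0 in cst.
by rewrite -cst -/(g z) expRN mulfK// gt_eqF// expR_gt0.
Qed.

End normal_integrals.

(** [integral_normal_prob] already assumes integrability for the normal law, so it is applied to the
    bounded truncations of the absolute value of [f], and monotone convergence concludes. *)
Lemma integrable_normal_prob (R : realType) (m s : R) (f : R -> R) :
  measurable_fun setT f ->
  (@lebesgue_measure R).-integrable setT (EFin \o (fun x => f x * normal_pdf m s x)) ->
  (normal_prob m s).-integrable setT (EFin \o f).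
Proof.
move=> mf intf; apply/integrableP; split; first exact/measurable_EFinP.
pose h (x : R) : R := `|f x|.
have mh : measurable_fun setT h by exact: measurableT_comp.
pose g n (x : R) : R := Num.min (h x) n%:R.
have mg n : measurable_fun setT (g n) by exact: measurable_minr.
have g0 n x : 0 <= g n x by rewrite le_min normr_ge0 ler0n.
have intg n : (normal_prob m s).-integrable setT (EFin \o g n).
  apply: (@integrable_dominated _ (measurableTypeR R) R (normal_prob m s) (g n) (cst n%:R)).
  - exact: mg.
  - by move=> x; rewrite ger0_norm// /g ge_min lexx orbT.
  - exact: finite_measure_integrable_cst.
have ub n : ((\int[normal_prob m s]_x (g n x)%:E) <=
    \int[@lebesgue_measure R]_x `|f x * normal_pdf m s x|%:E)%E.
  have intgk : (@lebesgue_measure R).-integrable setT (EFin \o (fun x => g n x * normal_pdf m s x)).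
    apply: (@lebesgue_integrable_dominated _ _ (fun x => `|f x * normal_pdf m s x|)).
    - by apply: measurable_funM => //; exact: measurable_normal_pdf.
    - move=> x; rewrite !normrM (ger0_norm (g0 _ _)) ler_wpM2r//.
      by rewrite /g ge_min lexx.
    - exact: integrable_norm intf.
  rewrite -(fineK (integrable_fin_num measurableT (intg n))).
  have := integral_normal_prob (mg n) (intg n); rewrite /Rintegral => ->.
  rewrite fineK; last exact: (integrable_fin_num measurableT intgk).
  apply: ge0_le_integral => //.
  - by move=> x _; rewrite lee_fin mulr_ge0// normal_pdf_ge0.
  - exact: measurable_int intgk.
  - exact: measurable_int (integrable_norm intf).
  - move=> x _; rewrite lee_fin normrM (ger0_norm (normal_pdf_ge0 _ _ _)) ler_wpM2r ?normal_pdf_ge0//.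
    by rewrite /g ge_min lexx.
have nd x : setT x -> {homo (fun n => (g n x)%:E) : n p / (n <= p)%N >-> (n <= p)%E}.
  move=> _ n p np; rewrite lee_fin /g le_min !ge_min lexx/=.
  by rewrite ler_nat np orbT.
have cv := @cvg_monotone_convergence _ (measurableTypeR R) R (normal_prob m s) setT measurableT
   (fun n x => (g n x)%:E) (fun n => iffRL (measurable_EFinP _ _) (mg n)) (fun n x _ => g0 n x) nd.
have -> : (\int[normal_prob m s]_x `|(EFin \o f) x|)%E =
    (\int[normal_prob m s]_x limn (fun n => (g n x)%:E))%E.
  apply: eq_integral => x _; apply/esym/cvg_lim => //.
  apply: cvg_near_cst; near=> n; rewrite /g /h /=; congr EFin; apply/min_idPl.
  by near: n; exact: nbhs_infty_ger.
rewrite -(cvg_lim (@ereal_hausdorff R) cv).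
apply: (@le_lt_trans _ _ (\int[@lebesgue_measure R]_x `|f x * normal_pdf m s x|%:E)%E).
  apply: lime_le; first by apply: (cvgP _ cv).
  by apply: nearW => n; exact: ub.
by have /integrableP[_] := intf.
Unshelve. all: by end_near. Qed.

Lemma Rintegral_gaussian_law d (T : measurableType d) (R : realType)
    (P : probability T R) (Y : T -> R) (m s : R) (h : R -> R) :
  measurable_fun setT Y -> 0 <= s ->
  (forall A : set R, measurable A -> P (Y @^-1` A) = gaussian_law m s A) ->
  measurable_fun setT h ->
  (0 < s -> (@lebesgue_measure R).-integrable setT
     (EFin \o (fun x => h x * normal_pdf m s x))) ->
  P.-integrable setT (EFin \o (h \o Y)) /\
  \int[P]_w h (Y w) = if s == 0 then h m else
    \int[@lebesgue_measure R]_x (h x * normal_pdf m s x).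
Proof.
move=> mY s0 law mh hint.
have mY' : @measurable_fun _ _ T (measurableTypeR R) setT Y := mY.
(* The law of [Y] is replaced by a genuine measure [nu]: a Dirac mass when [s = 0], a normal law
   otherwise. *)
have key (nu : {measure set (measurableTypeR R) -> \bar R}) : (forall A, measurable A -> gaussian_law m s A = nu A) ->
    nu.-integrable setT (EFin \o h) ->
    P.-integrable setT (EFin \o (h \o Y)) /\ \int[P]_w h (Y w) = \int[nu]_x h x.
  move=> lawE /integrableP[_ fin].
  have intP : P.-integrable setT (EFin \o (h \o Y)).
    apply/integrableP; split; first by apply/measurable_EFinP; exact: measurableT_comp.
    have mh' : measurable_fun (setT : set (measurableTypeR R)) (fun x => `|h x|%:E).
      by apply/measurable_EFinP; exact: measurableT_comp.
    have := ge0_integral_pushforward mY' P measurableT mh' (fun x _ => normr_ge0 (h x)).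
    rewrite preimage_setT /= => <-.
    by rewrite (eq_measure_integral nu)// => A mA _; rewrite -lawE// -law.
  split => //; rewrite /Rintegral; congr fine.
  have := @integral_pushforward _ _ _ _ _ _ mY' P setT (EFin \o h).
  rewrite preimage_setT => /(_ _ intP measurableT) <-; last exact/measurable_EFinP.
  by apply: eq_measure_integral => A mA _; rewrite -lawE// -law.
have [s00|sn0] := eqVneq s 0.
  have [||h1 h2] := key (dirac (m : measurableTypeR R)).
  + by move=> A _; rewrite /gaussian_law s00 eqxx.
  + apply/integrableP; split; first exact/measurable_EFinP.
    rewrite integral_dirac//; last by apply: measurableT_comp => //; exact/measurable_EFinP.
    by rewrite diracT mul1e ltry.
  split => //; rewrite h2 /Rintegral integral_dirac//; last exact/measurable_EFinP.
  by rewrite diracT mul1e.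
have sgt0 : 0 < s by rewrite lt_def sn0 s0.
have int1 := integrable_normal_prob mh (hint sgt0).
have [||h1 h2] := key (normal_prob m s).
- by move=> A _; rewrite /gaussian_law (negbTE sn0).
- exact: int1.
by split => //; rewrite h2 integral_normal_prob.
Qed.

Lemma gaussian_rv_integrable d (T : measurableType d) (R : realType)
    (P : probability T R) (Y : T -> R) : gaussian_rv P Y ->
  P.-integrable setT (EFin \o Y) /\ P.-integrable setT (EFin \o (fun w => Y w ^+ 2)).
Proof.
move=> [mY [m [s [s0 law]]]].
have [i1 _] := @Rintegral_gaussian_law _ _ _ _ _ _ _ (fun x => `|x - m|) mY s0 law
  (measurableT_comp (@normr_measurable _ _) (measurable_funB (@measurable_id _ _ _) (measurable_cst _)))
  (fun h => integrable_abs_normal_pdf m h).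
have [i2 _] := @Rintegral_gaussian_law _ _ _ _ _ _ _ (fun x => (x - m) ^+ 2) mY s0 law
  (measurable_funX _ (measurable_funB (@measurable_id _ _ _) (measurable_cst _)))
  (fun h => integrable_sqr_normal_pdf m h).
split.
- apply: (integrable_dominated mY (g := fun w => `|Y w - m| + `|m|)).
    by move=> w; rewrite -{1}[Y w](subrK m) ler_normD.
  have := integrableD measurableT i1 (finite_measure_integrable_cst P `|m| measurableT).
  exact: eq_integrable.
- apply: (integrable_dominated (measurable_funX _ mY) (g := fun w => 2 * (Y w - m) ^+ 2 + 2 * m ^+ 2)).
    move=> w; rewrite ger0_norm ?sqr_ge0//; have := sqr_ge0 (Y w - 2 * m); nra.
  have := integrableD measurableT (integrableZl measurableT 2 i2)
     (finite_measure_integrable_cst P (2 * m ^+ 2) measurableT).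
  exact: eq_integrable.
Qed.

Lemma gaussian_rv_cos d (T : measurableType d) (R : realType)
    (P : probability T R) (Y : T -> R) (v : R) : gaussian_rv P Y ->
  \int[P]_w Y w = 0 -> \int[P]_w (Y w ^+ 2) = v ->
  \int[P]_w cos (Y w) = expR (- v / 2).
Proof.
move=> gY EY EY2; have [iY iY2] := gaussian_rv_integrable gY.
case: gY => mY [m [s [s0 law]]].
have P1 (c : R) : \int[P]_w c = c.
  by rewrite Rintegral_cst//= probability_setT mulr1.
have icst (c : R) : P.-integrable setT (EFin \o (fun=> c)).
  exact: finite_measure_integrable_cst.
have [|i1 e1] := @Rintegral_gaussian_law _ _ _ _ _ _ _ (fun x => x - m) mY s0 law
  (measurable_funB (@measurable_id _ _ _) (measurable_cst _)).
  move=> h; apply: (lebesgue_integrable_dominated _ _ (integrable_abs_normal_pdf m h)).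
    by apply: measurable_funM; [exact: measurable_funB|exact: measurable_normal_pdf].
  by move=> x; rewrite normrM (ger0_norm (normal_pdf_ge0 m s x)).
(* The parameters of the law are existential in [gaussian_rv]; the first two moments identify
   them. *)
have m0 : m = 0.
  have : \int[P]_w (Y w - m) = 0.
    rewrite e1; case: eqVneq => [_|sn0]; first by rewrite subrr.
    by apply: normal_mean; rewrite lt_def sn0.
  by rewrite RintegralB// EY P1 sub0r => /eqP; rewrite oppr_eq0 => /eqP.
subst m.
have [i2 e2] := @Rintegral_gaussian_law _ _ _ _ _ _ _ (fun x => (x - 0) ^+ 2) mY s0 law
  (measurable_funX _ (measurable_funB (@measurable_id _ _ _) (measurable_cst _)))
  (fun h => integrable_sqr_normal_pdf 0 h).
have s2 : s ^+ 2 = v.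
  rewrite -EY2; transitivity (\int[P]_w (Y w - 0) ^+ 2); last first.
    by apply: eq_Rintegral => w _; rewrite subr0.
  rewrite e2; case: eqVneq => [->|sn0]; first by rewrite subr0.
  by rewrite normal_variance// lt_def sn0.
have mcos : measurable_fun setT (@cos R).
  by apply: continuous_measurable_fun; exact: continuous_cos.
have [|_ ->] := @Rintegral_gaussian_law _ _ _ _ _ _ _ (@cos R) mY s0 law mcos.
  move=> h; apply: (@lebesgue_integrable_dominated _ _ (normal_pdf 0 s)).
  - by apply: measurable_funM => //; exact: measurable_normal_pdf.
  - move=> x; rewrite normrM (ger0_norm (normal_pdf_ge0 _ _ _)) ler_piMl ?normal_pdf_ge0//.
    by rewrite ler_norml cos_geN1 cos_le1.
  - exact: integrable_normal_pdf.
rewrite -s2; case: eqVneq => [->|sn0].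
  by rewrite cos0 expr0n/= oppr0 mul0r expR0.
have := @integral_cos_normal_pdf _ 0 s _ 0 1; rewrite cos0 mul1r expr1n mulr1 mulNr => <-; last first.
  by rewrite lt_def sn0.
by apply: eq_Rintegral => x _; rewrite add0r mul1r subr0.
Qed.

(** * Gaussian elimination *)

Lemma bounded_integrable d (T : measurableType d) (R : realType)
    (P : probability T R) (f : T -> R) (C : R) :
  measurable_fun setT f -> (forall x, `|f x| <= C) -> P.-integrable setT (EFin \o f).
Proof.
move=> mf fC; apply: (integrable_dominated mf fC).
exact: finite_measure_integrable_cst.
Qed.

Lemma Rintegral_Fubini_bounded d d' (T : measurableType d) (U : measurableType d')
    (R : realType) (P : probability T R) (Q : probability U R) (f : T * U -> R) (C : R) :
  measurable_fun setT f -> (forall x, `|f x| <= C) ->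
  \int[P]_x \int[Q]_y f (x, y) = \int[Q]_y \int[P]_x f (x, y).
Proof.
move=> mf fC.
have i1 x : Q.-integrable setT (EFin \o (fun y => f (x, y))).
  by apply: (@bounded_integrable _ _ _ _ _ C) => //; exact: measurableT_comp.
have i2 y : P.-integrable setT (EFin \o (fun x => f (x, y))).
  by apply: (@bounded_integrable _ _ _ _ _ C) => //; exact: measurableT_comp.
have intf : (P \x Q)%E.-integrable setT (EFin \o f).
  apply: (integrable_dominated mf fC); apply/integrableP; split.
    exact/measurable_EFinP/measurable_cst.
  rewrite integral_cst//= -setXTT product_measure1E//.
  rewrite [X in (_ * (X * _))%E](probability_setT P) [X in (_ * (_ * X))%E](probability_setT Q).
  by rewrite !mule1 ltry.
rewrite {1 3}/Rintegral; congr fine.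
have := Fubini intf => /= e.
transitivity (\int[P]_x \int[Q]_y (f (x, y))%:E)%E.
  by apply: eq_integral => x _; rewrite fineK//; exact: integrable_fin_num (i1 x).
rewrite e; apply: eq_integral => y _.
by rewrite fineK//; exact: integrable_fin_num (i2 y).
Qed.

(** Completing the square gives the normal density of mean [- c / (1 + q)] and variance
    [1 / (1 + q)]. In the elimination [c] is [b v e] and [q] is [b e e], which produces
    [cond_form]. *)
Lemma gaussian_complete_square (R : realType) (c q : R) : 0 <= q ->
  \int[@lebesgue_measure R]_u (expR (- (2 * u * c + u ^+ 2 * q) / 2) * normal_pdf 0 1 u) =
  (Num.sqrt (1 + q))^-1 * expR (c ^+ 2 / (1 + q) / 2).
Proof.
move=> q0; have q1 : 0 < 1 + q by lra.
pose s := (Num.sqrt (1 + q))^-1.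
have s0 : 0 < s by rewrite invr_gt0 sqrtr_gt0.
have s2 : s ^+ 2 = (1 + q)^-1 by rewrite /s exprVn sqr_sqrtr// ltW.
pose m := - c / (1 + q).
rewrite -/s; transitivity (s * expR (c ^+ 2 / (1 + q) / 2) * \int[@lebesgue_measure R]_x normal_pdf m s x).
  rewrite -RintegralZl; [|by []|exact: integrable_normal_pdf].
  apply: eq_Rintegral => u _.
  have s1 : normal_peak s = s^-1 * normal_peak 1.
    by rewrite /normal_peak s2 expr1n mul1r -mulrnAr sqrtrM ?invr_ge0 1?ltW// sqrtrV 1?ltW// -/s invfM.
  rewrite !normal_pdf_expR// s1 s2.
  rewrite [LHS]mulrCA [in RHS]mulrA.
  have -> : s * expR (c ^+ 2 / (1 + q) / 2) * (s^-1 * normal_peak 1) =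
    normal_peak 1 * expR (c ^+ 2 / (1 + q) / 2) by field; rewrite gt_eqF.
  rewrite -!mulrA -!expRD; congr (_ * expR _); rewrite /m.
  by field; rewrite gt_eqF.
by rewrite Rintegral_normal_pdf// mulr1.
Qed.

Section gaussian_elimination.
Context d (T : measurableType d) (R : realType) (P : probability T R).
Variables (V : Type) (comb : V -> R -> V -> V) (Z : V -> T -> R).
Hypothesis mZ : forall v, measurable_fun setT (Z v).
Hypothesis Zcomb : forall v u e w, Z (comb v u e) w = Z v w + u * Z e w.

(** Linearity is required along [comb] only, so that [V] may consist of formal combinations and need
    not be a vector space. *)
Definition form_like (b : V -> V -> R) :=
  [/\ forall v u e w, b (comb v u e) w = b v w + u * b e w,
      forall v w, b v w = b w v & forall v, 0 <= b v v].

(* Under the weight [W], of total mass [D], every [Z v] is a centered Gaussian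
   variable of variance [b v v]. *)
Definition weighted_charfun (W : T -> R) (D : R) (b : V -> V -> R) :=
  [/\ measurable_fun setT W, forall w, 0 <= W w <= 1 &
      forall v, \int[P]_w (W w * cos (Z v w)) = D * expR (- b v v / 2)].

(* Gaussian conditioning on a noisy observation of [Z e], with noise of variance [1]. *)
Definition cond_form (b : V -> V -> R) (e v w : V) :=
  b v w - b v e * b w e / (1 + b e e).

Lemma form_comb b v u e : form_like b ->
  b (comb v u e) (comb v u e) = b v v + 2 * u * b v e + u ^+ 2 * b e e.
Proof.
move=> [bl bs _].
by rewrite bl (bs v) (bs e) !bl (bs e v); ring.
Qed.

Lemma cond_form_le b e v : form_like b -> cond_form b e v v <= b v v.
Proof.
move=> [_ _ b0]; rewrite /cond_form gerBl mulr_ge0 -?expr2 ?sqr_ge0//.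
by rewrite invr_ge0 addr_ge0.
Qed.

(** With [u] the regression coefficient of [v] on the noisy observation of [e], the conditional
    variance is the variance of [v + u e] plus the contribution [u ^ 2] of the noise. *)
Lemma cond_form_ge b e v : form_like b ->
  exists u, b (comb v u e) (comb v u e) <= cond_form b e v v.
Proof.
move=> fb; have [bl bs b0] := fb.
have h : 0 < 1 + b e e by rewrite ltr_wpDr.
exists (- b v e / (1 + b e e)); rewrite form_comb// /cond_form.
have -> : b v v - b v e * b v e / (1 + b e e) =
  b v v + 2 * (- b v e / (1 + b e e)) * b v e +
  (- b v e / (1 + b e e)) ^+ 2 * b e e + (b v e / (1 + b e e)) ^+ 2.
  by field; rewrite gt_eqF.
by rewrite lerDl sqr_ge0.
Qed.

Lemma cond_form_like b e : form_like b -> form_like (cond_form b e).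
Proof.
move=> fb; have [bl bs b0] := fb; split.
- by move=> v u f w; rewrite /cond_form !bl; ring.
- by move=> v w; rewrite /cond_form (bs v w) (mulrC (b v e)).
- by move=> v; have [u] := cond_form_ge e v fb; apply: le_trans.
Qed.

(* [expR (- z ^ 2 / 2)] is the characteristic function of an independent normal
   variable [u] at [z], so that multiplying by it replaces [Z v] by [Z v + u * Z e]
   inside the cosine. *)
Lemma weighted_charfun_cond W D b e : form_like b -> weighted_charfun W D b ->
  weighted_charfun (fun w => W w * expR (- (Z e w) ^+ 2 / 2))
    (D / Num.sqrt (1 + b e e)) (cond_form b e).
Proof.
move=> fb [mW W01 hW]; have [bl bs b0] := fb.
have mcos : measurable_fun setT (@cos R).
  by apply: continuous_measurable_fun; exact: continuous_cos.
have nW w : `|W w| <= 1 by rewrite ger0_norm; case/andP: (W01 w).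
split.
- apply: measurable_funM => //; apply: measurableT_comp => //.
  by apply: measurable_funM => //; apply: measurableT_comp => //; exact: measurable_funX.
- move=> w; case/andP: (W01 w) => w0 w1; rewrite mulr_ge0 ?expR_ge0//=.
  rewrite mulr_ile1 ?expR_ge0//.
  by rewrite -expR0 ler_expR mulNr oppr_le0 divr_ge0// sqr_ge0.
move=> v.
pose Q := normal_prob (0 : R) 1.
pose f (x : T * measurableTypeR R) : R := W x.1 * cos (Z v x.1 + x.2 * Z e x.1).
have mf : measurable_fun setT f.
  apply: measurable_funM; first exact: measurableT_comp.
  apply: measurableT_comp => //; apply: measurable_funD.
    by apply: (measurableT_comp (mZ v)).
  by apply: measurable_funM => //; apply: (measurableT_comp (mZ e)).
have ub x : `|f x| <= 1.
  rewrite normrM mulr_ile1//; last by rewrite ler_norml cos_geN1 cos_le1.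
have E1 w : W w * expR (- Z e w ^+ 2 / 2) * cos (Z v w) = \int[Q]_u f (w, u).
  have ic : Q.-integrable setT (EFin \o (fun u : measurableTypeR R => cos (Z v w + u * Z e w))).
    apply: (@bounded_integrable _ _ _ _ _ 1).
      apply: measurableT_comp => //; apply: measurable_funD => //; exact: measurable_funM.
    by move=> x; rewrite ler_norml cos_geN1 cos_le1.
  rewrite /f /= RintegralZl// integral_normal_prob; last 2 first.
  - by have /integrableP[/measurable_EFinP] := ic.
  - exact: ic.
  have := @integral_cos_normal_pdf _ 0 1 ltr01 (Z v w) (Z e w).
  under eq_Rintegral do rewrite subr0 (mulrC (Z e w)).
  by rewrite expr1n mul1r => ->; rewrite -mulrA (mulrC (expR _)) mulNr.
rewrite (eq_Rintegral _ (fun w _ => E1 w)) (Rintegral_Fubini_bounded _ _ mf ub).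
have E2 u : \int[P]_w f (w, u) = D * expR (- b v v / 2) * expR (- (2 * u * b v e + u ^+ 2 * b e e) / 2).
  rewrite /f /=; under eq_Rintegral do rewrite -Zcomb.
  rewrite hW form_comb// -[RHS]mulrA -expRD; congr (_ * expR _); by field.
rewrite (eq_Rintegral _ (fun u _ => E2 u)).
have me : measurable_fun setT (fun u : R => expR (- (2 * u * b v e + u ^+ 2 * b e e) / 2)).
  apply: measurableT_comp => //; apply: measurable_funM => //; apply: measurableT_comp => //.
  apply: measurable_funD; first by apply: measurable_funM => //; exact: measurable_funM.
  by apply: measurable_funM => //; exact: measurable_funX.
(* The exponent is bounded above because [b] is nonnegative at [comb v u e]. *)
have iQ : Q.-integrable setT (EFin \o (fun u : R => expR (- (2 * u * b v e + u ^+ 2 * b e e) / 2))).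
  apply: (@bounded_integrable _ _ _ Q _ (expR (b v v / 2))) => // u.
  rewrite ger0_norm ?expR_ge0// ler_expR.
  by have := b0 (comb v u e); rewrite form_comb//; lra.
rewrite RintegralZl// integral_normal_prob// gaussian_complete_square//.
rewrite /cond_form mulrACA -expRD; congr (_ * expR _).
by field; rewrite gt_eqF// ltr_wpDr.
Qed.

(* [o] only witnesses that [V] is not empty. *)
Lemma weighted_charfun_total (o : V) W D b : form_like b -> weighted_charfun W D b ->
  \int[P]_w W w = D.
Proof.
move=> [bl bs _] [_ _ hW]; pose z := comb o (- 1) o.
have bz w : b z w = 0 by rewrite bl mulN1r subrr.
have := hW z; rewrite bz oppr0 mul0r expR0 mulr1 => <-.
by apply: eq_Rintegral => w _; rewrite Zcomb mulN1r subrr cos0 mulr1.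
Qed.

(** The exact value is a product over successively conditioned forms. Conditioning only decreases
    variances, so each factor may be replaced by the one of the initial form. *)
Lemma weighted_gaussian_ge (o : V) (es : seq V) W D b : form_like b ->
  weighted_charfun W D b -> 0 <= D ->
  D * \prod_(e <- es) (Num.sqrt (1 + b e e))^-1 <=
  \int[P]_w (W w * \prod_(e <- es) expR (- (Z e w) ^+ 2 / 2)).
Proof.
elim: es W D b => [|e es IH] W D b fb cW D0.
  rewrite big_nil mulr1 -(weighted_charfun_total o fb cW).
  by under [leRHS]eq_Rintegral do rewrite big_nil mulr1.
have [bl bs b0] := fb.
have sp (v : R) : 0 <= v -> 0 < Num.sqrt (1 + v) by move=> v0; rewrite sqrtr_gt0 ltr_wpDr.
have := IH _ _ _ (cond_form_like e fb) (weighted_charfun_cond e fb cW).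
rewrite divr_ge0 ?sqrtr_ge0// => /(_ isT) h.
under eq_Rintegral do rewrite big_cons mulrA.
apply: le_trans h; rewrite big_cons mulrA.
apply: ler_wpM2l; first by rewrite divr_ge0 ?sqrtr_ge0.
apply: ler_prod => f _; rewrite invr_ge0 sqrtr_ge0/= lef_pV2 ?posrE ?sp//.
  by rewrite ler_wsqrtr// lerD2l; exact: cond_form_le.
by have [_ _] := cond_form_like e fb; apply.
Qed.

(** The affine set of [e] plus combinations of [l], built in the order in which [cond_form_ge]
    produces them during elimination. *)
Fixpoint in_span (e : V) (l : seq V) (v : V) : Prop :=
  if l is e1 :: l' then exists v' u, in_span e l' v' /\ v = comb v' u e1 else v = e.

(** By [cond_form_ge] a conditional variance dominates the variance of some [v + u e], so lower
    bounds over the spans of all the earlier functionals pass to the form conditioned on the first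
    one. *)
Lemma weighted_gaussian_le (o : V) (es : seq V) (dl : nat -> R) W D b : form_like b ->
  weighted_charfun W D b -> 0 <= D ->
  (forall k, (k < size es)%N -> 0 < dl k) ->
  (forall k v, (k < size es)%N -> in_span (nth o es k) (take k es) v -> dl k <= b v v) ->
  \int[P]_w (W w * \prod_(e <- es) expR (- (Z e w) ^+ 2 / 2)) <=
  D * \prod_(k < size es) (Num.sqrt (dl k))^-1.
Proof.
elim: es dl W D b => [|e es IH] dl W D b fb cW D0 d0 hd.
  rewrite big_ord0 mulr1 -(weighted_charfun_total o fb cW).
  by under [leLHS]eq_Rintegral do rewrite big_nil mulr1.
have [bl bs b0] := fb.
have := IH (dl \o S) _ _ _ (cond_form_like e fb) (weighted_charfun_cond e fb cW).
rewrite divr_ge0 ?sqrtr_ge0// => /(_ isT) h.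
under eq_Rintegral do rewrite big_cons mulrA.
apply: (le_trans (h _ _)).
- by move=> k ks; exact: d0.
- move=> k v ks hv; have [u hu] := cond_form_ge e v fb; apply: le_trans hu.
  by apply: hd => //=; exists v, u.
rewrite /= big_ord_recl /= mulrA.
apply: ler_wpM2r; first by apply: prodr_ge0 => i _; rewrite invr_ge0 sqrtr_ge0.
apply: ler_wpM2l => //; rewrite lef_pV2 ?posrE ?sqrtr_gt0 ?d0 ?ltr_wpDr//.
rewrite ler_wsqrtr// (@le_trans _ _ (b e e)) ?lerDr//.
exact: (hd 0%N).
Qed.

End gaussian_elimination.

(** * Linear combinations of the process *)

Lemma Rintegral_sum_seq d (T : measurableType d) (R : realType) (P : probability T R)
    (I : Type) (s : seq I) (f : I -> T -> R) :
  (forall i, P.-integrable setT (EFin \o f i)) ->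
  P.-integrable setT (EFin \o (fun w => \sum_(i <- s) f i w)) /\
  \int[P]_w (\sum_(i <- s) f i w) = \sum_(i <- s) \int[P]_w f i w.
Proof.
move=> intf; elim: s => [|i s [IH1 IH2]].
  split.
    under [X in EFin \o X]eq_fun do rewrite big_nil.
    exact: finite_measure_integrable_cst.
  under eq_Rintegral do rewrite big_nil.
  by rewrite big_nil Rintegral_cst//= mul0r.
split.
  under [X in EFin \o X]eq_fun do rewrite big_cons.
  by have := integrableD measurableT (intf i) IH1; apply: eq_integrable.
under eq_Rintegral do rewrite big_cons.
by rewrite RintegralD// IH2 big_cons.
Qed.

Section covariance_form.
Context d (T : measurableType d) (R : realType) (P : probability T R).
Variables (alpha beta : R) (X : R -> {RV P >-> R}).
Hypothesis adm : admissible alpha beta.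
Hypothesis isX : is_X alpha beta X.

Let alpha_gt0 : 0 < alpha.
Proof. by case: adm => h1 h2; lra. Qed.

Definition cov (t s : R) : R :=
  2 `^ (2 * beta + 1) * (t * s) `^ alpha / (t + s) `^ (2 * beta + 1).

Lemma cov0 t s : (t == 0) || (s == 0) -> cov t s = 0.
Proof.
move=> h; rewrite /cov (_ : t * s = 0) ?powR0 ?gt_eqF ?mulr0 ?mul0r//.
by case/orP: h => /eqP ->; rewrite ?mul0r ?mulr0.
Qed.

Lemma covC t s : cov t s = cov s t.
Proof. by rewrite /cov mulrC (mulrC t) (addrC t) mulrC. Qed.

(* Vectors are lists of pairs (coefficient, time). Taking the absolute value of the
   times makes every statement total, [X] being relevant only at times [>= 0]. *)
Definition lincomb (s : seq (R * R)) (w : T) : R := \sum_(x <- s) x.1 * X `|x.2| w.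
Definition lincomb_add (v : seq (R * R)) (u : R) (e : seq (R * R)) :=
  v ++ [seq (u * x.1, x.2) | x <- e].
Definition covform (v u : seq (R * R)) : R :=
  \sum_(x <- v) \sum_(y <- u) x.1 * y.1 * cov `|x.2| `|y.2|.

Lemma lincombE v u e w : lincomb (lincomb_add v u e) w = lincomb v w + u * lincomb e w.
Proof.
rewrite /lincomb /lincomb_add big_cat big_map/= mulr_sumr; congr (_ + _).
by apply: eq_bigr => x _; rewrite mulrA.
Qed.

Lemma measurable_lincomb v : measurable_fun setT (lincomb v).
Proof.
apply: measurable_sum => x; apply: measurable_funM => //.
Qed.

Lemma lincomb_gaussian s : gaussian_rv P (lincomb s).
Proof.
have := @X_gaussian _ _ _ _ _ _ _ isX (size s) (fun i => `|(tnth (in_tuple s) i).2|)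
  (fun i => (tnth (in_tuple s) i).1) (fun i => normr_ge0 _).
by under eq_fun do rewrite -(big_tnth _ _ _ xpredT (fun x => x.1 * X `|x.2| _)).
Qed.

Let intX (t : R) : P.-integrable setT (EFin \o X `|t|).
Proof.
have [+ _] := gaussian_rv_integrable (lincomb_gaussian [:: (1, t)]).
by apply: eq_integrable => // w _; rewrite /= /lincomb big_seq1 mul1r.
Qed.

Let intX2 (t : R) : P.-integrable setT (EFin \o (fun w => X `|t| w ^+ 2)).
Proof.
have [_ +] := gaussian_rv_integrable (lincomb_gaussian [:: (1, t)]).
by apply: eq_integrable => // w _; rewrite /= /lincomb big_seq1 mul1r.
Qed.

Let intXX (t s : R) : P.-integrable setT (EFin \o (fun w => X `|t| w * X `|s| w)).
Proof.
apply: (@integrable_dominated _ _ _ _ _ (fun w => X `|t| w ^+ 2 + X `|s| w ^+ 2)).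
- by apply: measurable_funM.
- move=> w; rewrite ler_norml; apply/andP; split;
  have := sqr_ge0 (X `|t| w + X `|s| w); have := sqr_ge0 (X `|t| w - X `|s| w);
  have := sqr_ge0 (X `|t| w); have := sqr_ge0 (X `|s| w); nra.
- by have := integrableD measurableT (intX2 t) (intX2 s); apply: eq_integrable.
Qed.

Lemma Rintegral_XX (t s : R) : \int[P]_w (X `|t| w * X `|s| w) = cov `|t| `|s|.
Proof.
(* [X_cov] speaks of positive times only; at time [0] both sides vanish. *)
have [h|] := boolP ((`|t| == 0) || (`|s| == 0)).
  rewrite cov0// -[RHS](_ : \int[P]_w 0 = 0); last by rewrite Rintegral_cst//= mul0r.
  by apply: eq_Rintegral => w _; case/orP: h => /eqP ->; rewrite (X_zero isX) ?mul0r ?mulr0.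
rewrite negb_or => /andP[t0 s0].
have := @X_cov _ _ _ _ _ _ _ isX `|t| `|s|; rewrite !lt_def t0 s0 !normr_ge0.
by rewrite unlock => /(_ isT isT) e; rewrite /Rintegral e.
Qed.

Lemma Rintegral_lincomb s : \int[P]_w lincomb s w = 0.
Proof.
have i (x : R * R) : P.-integrable setT (EFin \o (fun w => x.1 * X `|x.2| w)).
  by have := integrableZl measurableT x.1 (intX x.2); apply: eq_integrable.
rewrite (Rintegral_sum_seq s i).2 big1// => x _; rewrite RintegralZl//.
have := @X_centered _ _ _ _ _ _ _ isX `|x.2| (normr_ge0 _).
by rewrite unlock /Rintegral => ->; rewrite mulr0.
Qed.

Lemma Rintegral_lincombM v u : \int[P]_w (lincomb v w * lincomb u w) = covform v u.
Proof.
have i (x y : R * R) : P.-integrable setT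
    (EFin \o (fun w => x.1 * y.1 * (X `|x.2| w * X `|y.2| w))).
  by have := integrableZl measurableT (x.1 * y.1) (intXX x.2 y.2); apply: eq_integrable.
transitivity (\int[P]_w \sum_(x <- v) \sum_(y <- u) x.1 * y.1 * (X `|x.2| w * X `|y.2| w)).
  apply: eq_Rintegral => w _; rewrite /lincomb big_distrlr/=.
  by apply: eq_bigr => x _; apply: eq_bigr => y _; ring.
rewrite (Rintegral_sum_seq v (fun x => (Rintegral_sum_seq u (i x)).1)).2.
apply: eq_bigr => x _; rewrite (Rintegral_sum_seq u (i x)).2.
by apply: eq_bigr => y _; rewrite RintegralZl// Rintegral_XX.
Qed.

Lemma covform_like : form_like lincomb_add covform.
Proof.
split.
- move=> v u e w; rewrite /covform /lincomb_add big_cat big_map/= mulr_sumr; congr (_ + _).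
  by apply: eq_bigr => x _; rewrite mulr_sumr; apply: eq_bigr => y _; rewrite !mulrA.
- move=> v w; rewrite /covform exchange_big/=.
  by apply: eq_bigr => x _; apply: eq_bigr => y _; rewrite covC (mulrC y.1).
- move=> v; rewrite -Rintegral_lincombM.
  by apply: Rintegral_ge0 => w _; rewrite -expr2 sqr_ge0.
Qed.

Lemma lincomb_charfun : weighted_charfun P lincomb (cst 1) 1 covform.
Proof.
split => [//|w|v]; first by rewrite ler01 lexx.
rewrite mul1r -(gaussian_rv_cos (lincomb_gaussian v) (Rintegral_lincomb v) (v := covform v v)).
  by apply: eq_Rintegral => w _; rewrite mul1r.
by rewrite -Rintegral_lincombM; apply: eq_Rintegral.
Qed.

End covariance_form.

(** * The binomial series and Pick forms *)

Lemma powR_le1 (R : realType) (a p : R) : 0 <= a <= 1 -> 0 <= p -> a `^ p <= 1.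
Proof.
move=> /andP[a0 a1] p0; have := ge0_ler_powR p0 a0 (ler01 : 1 \in Num.nneg) a1.
by rewrite powR1.
Qed.

Section binomial_series.
Variable R : realType.
Implicit Types p x y : R.

(** The coefficient of [x ^ l] in [(1 - x) ^ - p]: the rising factorial of [p] over [l!]. *)
Definition bincoef p (l : nat) : R := \prod_(j < l) ((p + j%:R) / j.+1%:R).

Lemma bincoefS p l : bincoef p l.+1 = bincoef p l * ((p + l%:R) / l.+1%:R).
Proof. by rewrite /bincoef big_ord_recr. Qed.

Lemma bincoef0 p : bincoef p 0 = 1.
Proof. by rewrite /bincoef big_ord0. Qed.

Lemma bincoef_ge0 p l : 0 < p -> 0 <= bincoef p l.
Proof.
by move=> p0; apply: prodr_ge0 => j _; rewrite divr_ge0// addr_ge0// ltW.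
Qed.

(** Coefficientwise form of the derivative of [(1 - x) ^ - p]. *)
Lemma bincoef_mulS p l : l.+1%:R * bincoef p l.+1 = p * bincoef (p + 1) l.
Proof.
rewrite /bincoef big_ord_recl /= addr0 divr1.
elim: l => [|l IH]; first by rewrite !big_ord0 !mulr1 mul1r.
rewrite !big_ord_recr /= !mulrA.
have -> : l.+2%:R * p * \prod_(i < l) ((p + (bump 0 i)%:R) / (bump 0 i).+1%:R) * (p + (bump 0 l)%:R) / (bump 0 l).+1%:R =
   (l.+1%:R * (p * \prod_(i < l) ((p + (bump 0 i)%:R) / (bump 0 i).+1%:R))) * ((p + 1 + l%:R) / l.+1%:R).
  rewrite /bump /= add1n.
  have -> : p + l.+1%:R = p + 1 + l%:R by rewrite -natr1; ring.
  by field; rewrite !gt_eqF// ltr_wpDr.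
by rewrite IH !mulrA.
Qed.

Lemma bincoef1 l : bincoef 1 l = 1.
Proof.
by rewrite /bincoef big1// => j _; rewrite addrC natr1 divff// pnatr_eq0.
Qed.

Definition binsum p N x : R := \sum_(l < N) bincoef p l * x ^+ l.

Lemma is_derive_binsum p N x :
  is_derive x (1 : R) (binsum p N.+1) (\sum_(l < N) bincoef p l.+1 * (l.+1%:R * x ^+ l)).
Proof.
elim: N => [|N IH].
  rewrite big_ord0 (_ : binsum p 1 = cst (bincoef p 0)); first exact: is_derive_cst.
  by apply/funext => y; rewrite /binsum big_ord1 expr0 mulr1.
rewrite (_ : binsum p N.+2 = (fun y => binsum p N.+1 y + bincoef p N.+1 * y ^+ N.+1)); last first.
  by apply/funext => y; rewrite /binsum big_ord_recr.
have h : is_derive x (1 : R) (fun y => bincoef p N.+1 * y ^+ N.+1) (bincoef p N.+1 * (N.+1%:R * x ^+ N)).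
  have := is_deriveZ (bincoef p N.+1) (is_deriveX N.+1 (is_derive_id x (1 : R))).
  by rewrite exprfctE /GRing.scale /= mulr1.
by rewrite big_ord_recr; exact: is_deriveD.
Qed.

(* The partial sums satisfy the differential equation [(1 - x) y' = p y] of
   [(1 - x) ^ - p] up to a single term. *)
Lemma binsum_ode p N x :
  (1 - x) * (\sum_(l < N) bincoef p l.+1 * (l.+1%:R * x ^+ l)) - p * binsum p N.+1 x =
  - (N.+1%:R * bincoef p N.+1) * x ^+ N.
Proof.
elim: N => [|N IH].
  rewrite big_ord0 /binsum big_ord1 bincoef0 bincoefS bincoef0 !expr0.
  by field.
have -> : binsum p N.+2 x = binsum p N.+1 x + bincoef p N.+1 * x ^+ N.+1.
  by rewrite /binsum big_ord_recr.
rewrite big_ord_recr /= !mulrDr.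
have -> : forall a b c e : R, a + b - (c + e) = (a - c) + b - e by move=> *; ring.
rewrite IH [in RHS]bincoefS exprS -(natr1 N.+1).
by field; rewrite !gt_eqF// ltr_wpDr.
Qed.

Lemma binsum0 p N : binsum p N.+1 0 = 1.
Proof.
rewrite /binsum big_ord_recl bincoef0 expr0 mulr1 big1 ?addr0// => i _.
by rewrite expr0n/= mulr0.
Qed.

Lemma powR1m p x : x < 1 -> (1 - x) `^ p = expR (p * ln (1 - x)).
Proof. by move=> x1; rewrite /powR gt_eqF// subr_gt0. Qed.

Lemma binsum_mvt p N x : 0 < x < 1 -> exists2 c, 0 < c < x &
  binsum p N.+1 x * (1 - x) `^ p =
  1 - N.+1%:R * bincoef p N.+1 * c ^+ N * (1 - c) `^ p / (1 - c) * x.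
Proof.
move=> /andP[x0 x1].
pose h y := binsum p N.+1 y * expR (p * ln (1 - y)).
pose h' y := - (N.+1%:R * bincoef p N.+1) * y ^+ N * expR (p * ln (1 - y)) / (1 - y).
have dh y : y < 1 -> is_derive y (1 : R) h (h' y).
  move=> y1; have y1' : 0 < 1 - y by rewrite subr_gt0.
  have dl : is_derive y (1 : R) (fun y => ln (1 - y)) ((1 - y)^-1 * (- 1)).
    apply: (@is_derive1_comp _ (@ln R) (fun y => 1 - y)).
      exact: is_derive1_ln.
    by apply: is_derive_eq; rewrite /GRing.scale /=; ring.
  have de : is_derive y (1 : R) (fun y => expR (p * ln (1 - y))) (expR (p * ln (1 - y)) * (- (p / (1 - y)))).
    apply: (@is_derive1_comp _ expR (fun y => p * ln (1 - y))).
    by apply: is_derive_eq; rewrite /GRing.scale /=; ring.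
  have db := is_derive_binsum p N y.
  apply: is_derive_eq; rewrite /GRing.scale /= /h' -binsum_ode.
  by field; rewrite gt_eqF.
have [||c cx e] := @MVT _ h h' 0 x x0.
- by move=> y; rewrite in_itv/= => /andP[_ yx]; apply: dh; exact: lt_trans yx x1.
- apply: derivable_within_continuous => y; rewrite in_itv/= => /andP[_ yx].
  by have [] := dh y (le_lt_trans yx x1).
move: cx; rewrite in_itv/= => /andP[c0 cx]; exists c; first by rewrite c0.
move: e; rewrite /h subr0 ln1 mulr0 expR0 binsum0 mulr1.
rewrite !powR1m//; last exact: lt_trans cx x1.
move=> /eqP; rewrite subr_eq => /eqP ->; rewrite /h'; ring.
Qed.

Lemma binsum_le p N x : 0 < p -> 0 <= x < 1 -> binsum p N x <= (1 - x) `^ (- p).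
Proof.
move=> p0 /andP[x0 x1]; have x1' : 0 < 1 - x by rewrite subr_gt0.
have pp : 0 < (1 - x) `^ p by rewrite powR_gt0.
case: N => [|N]; first by rewrite /binsum big_ord0 powR_ge0.
rewrite powRN -[leRHS]mul1r ler_pdivlMr//.
move: x0; rewrite le_eqVlt => /predU1P[<-|x0].
  by rewrite binsum0 subr0 powR1 mulr1.
have [|c /andP[c0 cx] ->] := @binsum_mvt p N x; first by rewrite x0.
rewrite gerBl; have c1 : 0 < 1 - c by rewrite subr_gt0 (lt_trans cx).
apply: mulr_ge0; last exact: ltW.
rewrite divr_ge0 ?(ltW c1)// mulr_ge0 ?powR_ge0// mulr_ge0 ?exprn_ge0 ?(ltW c0)//.
by rewrite mulr_ge0// bincoef_ge0.
Qed.

Lemma binsum_cvg p x : 0 < p -> 0 <= x < 1 ->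
  binsum p N x @[N --> \oo] --> (1 - x) `^ (- p).
Proof.
move=> p0 /andP[x0 x1]; have x1' : 0 < 1 - x by rewrite subr_gt0.
have pp : 0 < (1 - x) `^ p by rewrite powR_gt0.
rewrite -(cvg_shiftS (fun N => binsum p N x)) /=.
move: x0; rewrite le_eqVlt => /predU1P[<-|x0].
  under eq_fun do rewrite binsum0.
  by rewrite subr0 powR1; exact: cvg_cst.
(* [binsum_le] at a point [z > x] bounds [bincoef (p + 1) N] by a constant times [z ^ - N]. Since
   the intermediate point of [binsum_mvt] is below [x], the remainder decays like [(x / z) ^ N]. *)
pose z := (1 + x) / 2; have z1 : z < 1 by rewrite /z; lra.
have xz : x < z by rewrite /z; lra.
have z0 : 0 < z by exact: lt_trans xz.
pose r := x / z.
pose B := (1 - x) `^ (- p) * (p * (1 - z) `^ (- (p + 1)) / (1 - x) * x).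
have bd N : `|binsum p N.+1 x - (1 - x) `^ (- p)| <= B * r ^+ N.
  have [|c /andP[c0 cx] e] := @binsum_mvt p N x; first by rewrite x0.
  have c1 : 0 < 1 - c by rewrite subr_gt0 (lt_trans cx).
  have -> : binsum p N.+1 x = (1 - x) `^ (- p) *
     (1 - N.+1%:R * bincoef p N.+1 * c ^+ N * (1 - c) `^ p / (1 - c) * x).
    by rewrite -e powRN mulrCA mulVf ?gt_eqF// mulr1.
  rewrite -[X in _ - X]mulr1 -mulrBr normrM (ger0_norm (powR_ge0 _ _)) /B -[leRHS]mulrA.
  rewrite ler_wpM2l ?powR_ge0// [X in `|X|](_ : _ = - (N.+1%:R * bincoef p N.+1 * c ^+ N * (1 - c) `^ p / (1 - c) * x)); last by ring.
  rewrite normrN ger0_norm; last first.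
    rewrite mulr_ge0 ?(ltW x0)// divr_ge0 ?(ltW c1)// mulr_ge0 ?powR_ge0// mulr_ge0 ?exprn_ge0 ?(ltW c0)//.
    by rewrite mulr_ge0// bincoef_ge0.
  rewrite [leRHS]mulrAC ler_wpM2r ?(ltW x0)// bincoef_mulS.
  have h1 : (1 - c) `^ p / (1 - c) <= (1 - x)^-1.
    rewrite -[leRHS]mul1r; apply: ler_pM; rewrite ?powR_ge0 ?invr_ge0 ?(ltW c1)//.
      by rewrite powR_le1 ?(ltW p0)// (ltW c1) gerBl (ltW c0).
    by rewrite lef_pV2 ?posrE// lerD2l lerN2 ltW.
  rewrite [leLHS](_ : _ = p * ((bincoef (p + 1) N * c ^+ N) * ((1 - c) `^ p / (1 - c)))); last by ring.
  rewrite [leRHS](_ : _ = p * (((1 - z) `^ (- (p + 1)) * r ^+ N) * (1 - x)^-1)); last by ring.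
  rewrite ler_wpM2l ?(ltW p0)//.
  have h2 : bincoef (p + 1) N * c ^+ N <= (1 - z) `^ (- (p + 1)) * r ^+ N.
    have -> : (1 - z) `^ (- (p + 1)) * r ^+ N = ((1 - z) `^ (- (p + 1)) / z ^+ N) * x ^+ N.
      by rewrite /r expr_div_n; ring.
    have p1 : 0 < p + 1 by rewrite addr_gt0.
    apply: ler_pM; rewrite ?bincoef_ge0 ?exprn_ge0 ?(ltW c0)//; last first.
      by rewrite lerXn2r ?nnegrE ?(ltW c0) ?(ltW x0)// ltW.
    rewrite ler_pdivlMr ?exprn_gt0//.
    apply: le_trans (@binsum_le (p + 1) N.+1 z p1 _); last by rewrite (ltW z0).
    rewrite /binsum big_ord_recr /= lerDr; apply: sumr_ge0 => i _.
    by rewrite mulr_ge0 ?bincoef_ge0// exprn_ge0// ltW.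
  apply: ler_pM => //.
    by rewrite mulr_ge0 ?bincoef_ge0 ?addr_gt0// exprn_ge0// ltW.
  by rewrite divr_ge0 ?powR_ge0// ltW.
apply/cvgrPdist_le => /= e e0.
have rc : B * r ^+ N @[N --> \oo] --> (0 : R).
  rewrite -[X in _ --> X](mulr0 B); apply: cvgMr; apply: cvg_expr.
  have r0 : 0 <= r by exact: divr_ge0 (ltW x0) (ltW z0).
  by rewrite (ger0_norm r0) /r ltr_pdivrMr// mul1r.
have /cvgrPdist_lt /(_ _ e0) rc' := rc.
near=> N; rewrite distrC (le_trans (bd N))// (le_trans (ler_norm _))//.
rewrite -normrN -sub0r ltW//; near: N; exact: rc'.
Unshelve. all: by end_near. Qed.

End binomial_series.

Section kernel_forms.
Variable R : realType.
Implicit Types (p : R) (s : seq (R * R)).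

Definition powerform p s : R :=
  \sum_(x <- s) \sum_(y <- s) x.1 * y.1 * (1 - x.2 * y.2) `^ (- p).

Definition moment (l : nat) s : R := \sum_(x <- s) x.1 * x.2 ^+ l.

Definition in_disc s := all (fun x : R * R => 0 <= x.2 < 1) s.

Lemma in_disc_prod s x y : in_disc s -> x \in s -> y \in s -> 0 <= x.2 * y.2 < 1.
Proof.
move=> /allP h /h /andP[x0 x1] /h /andP[y0 y1]; rewrite mulr_ge0//=.
by rewrite mulr_ilt1.
Qed.

Lemma sum_bincoef_moment p s N :
  \sum_(l < N) bincoef p l * moment l s ^+ 2 =
  \sum_(x <- s) \sum_(y <- s) x.1 * y.1 * binsum p N (x.2 * y.2).
Proof.
transitivity (\sum_(l < N) \sum_(x <- s) \sum_(y <- s)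
    x.1 * y.1 * (bincoef p l * (x.2 * y.2) ^+ l)).
  apply: eq_bigr => l _; rewrite expr2 /moment big_distrlr/= mulr_sumr.
  apply: eq_bigr => x _; rewrite mulr_sumr; apply: eq_bigr => y _.
  by rewrite exprMn; ring.
rewrite exchange_big/=; apply: eq_bigr => x _; rewrite exchange_big/=.
by apply: eq_bigr => y _; rewrite -mulr_sumr.
Qed.

Lemma cvg_sum_seq (I : eqType) (r : seq I) (u : I -> nat -> R) (l : I -> R) :
  (forall i, i \in r -> u i N @[N --> \oo] --> l i) ->
  (\sum_(i <- r) u i N) @[N --> \oo] --> \sum_(i <- r) l i.
Proof.
elim: r => [|i r IH] h.
  by under eq_fun do rewrite big_nil; rewrite big_nil; exact: cvg_cst.
under eq_fun do rewrite big_cons; rewrite big_cons; apply: cvgD.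
  by apply: h; rewrite mem_head.
by apply: IH => j jr; apply: h; rewrite inE jr orbT.
Qed.

Lemma powerform_cvg p s : 0 < p -> in_disc s ->
  (\sum_(l < N) bincoef p l * moment l s ^+ 2) @[N --> \oo] --> powerform p s.
Proof.
move=> p0 hs; under eq_fun do rewrite sum_bincoef_moment.
apply: cvg_sum_seq => x xs; apply: cvg_sum_seq => y ys.
by apply: cvgMr; apply: binsum_cvg => //; exact: in_disc_prod hs _ _.
Qed.

(** Termwise comparison of the two moment expansions: as moments are squared, multiplying the nodes
    by [sqrt q] accounts for [q ^ l]. *)
Lemma powerform_scale p (c q : R) s : 0 < p -> 0 <= q <= 1 -> in_disc s ->
  (forall l, c * q ^+ l <= bincoef p l) ->
  c * powerform 1 [seq (x.1, Num.sqrt q * x.2) | x <- s] <= powerform p s.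
Proof.
move=> p0 /andP[q0 q1] hs hc.
have hs' : in_disc [seq (x.1, Num.sqrt q * x.2) | x <- s].
  rewrite /in_disc all_map; apply: sub_all hs => x /= /andP[x0 x1].
  rewrite mulr_ge0 ?sqrtr_ge0//= (le_lt_trans _ x1)// ler_piMl//.
  by rewrite -sqrtr1 ler_wsqrtr.
set s' := [seq _ | x <- s] in hs' *.
have h1 : c * (\sum_(l < N) bincoef 1 l * moment l s' ^+ 2) @[N --> \oo] --> c * powerform 1 s'.
  by apply: cvgMr; exact: powerform_cvg.
apply: (ler_cvg_to h1 (powerform_cvg p0 hs)).
apply: nearW => N; rewrite mulr_sumr; apply: ler_sum => l _.
rewrite bincoef1 mul1r.
have -> : moment l s' = Num.sqrt q ^+ l * moment l s.
  by rewrite /moment big_map mulr_sumr; apply: eq_bigr => x _ /=; rewrite exprMn; ring.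
rewrite exprMn -exprM mulnC exprM sqr_sqrtr// mulrA.
by rewrite ler_wpM2r ?sqr_ge0.
Qed.

Definition pickform s : R := \sum_(x <- s) \sum_(y <- s) x.1 * y.1 * (1 - x.2 * y.2)^-1.

Lemma powerform1 s : in_disc s -> powerform 1 s = pickform s.
Proof.
move=> hs; apply: eq_big_seq => x xs; apply: eq_big_seq => y ys.
by rewrite powR_inv1// subr_ge0 ltW//; case/andP: (in_disc_prod hs xs ys).
Qed.

(* The Schur complement of the Pick matrix [1 / (1 - x_i x_j)] with respect to
   one node [y] is the Pick matrix of the other nodes, with weights the values of
   the Blaschke factor at [y]. *)
Lemma pickform_eliminate c y s : in_disc ((c, y) :: s) ->
  pickform [seq (x.1 * ((x.2 - y) / (1 - x.2 * y)), x.2) | x <- s] <= pickform ((c, y) :: s).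
Proof.
move=> hs; pose F (x : R * R) := x.1 * (1 - x.2 * y)^-1.
have y1 : 0 < 1 - y * y.
  by rewrite subr_gt0; case/andP: (in_disc_prod hs (mem_head _ _) (mem_head _ _)).
have xy x : x \in s -> 0 < 1 - x.2 * y.
  move=> xs; rewrite subr_gt0.
  have xs' : x \in (c, y) :: s by rewrite inE xs orbT.
  by case/andP: (in_disc_prod hs xs' (mem_head _ _)).
have e1 : \sum_(x <- s) \sum_(z <- s) x.1 * z.1 * (1 - x.2 * z.2)^-1 =
    pickform [seq (x.1 * ((x.2 - y) / (1 - x.2 * y)), x.2) | x <- s] +
    (1 - y * y) * (\sum_(x <- s) F x) ^+ 2.
  rewrite /pickform big_map expr2 big_distrlr/= mulr_sumr -big_split/=.
  apply: eq_big_seq => x xs; rewrite big_map mulr_sumr -big_split/=.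
  apply: eq_big_seq => z zs; rewrite /F.
  have h : 0 < 1 - x.2 * z.2.
    have xs' : x \in (c, y) :: s by rewrite inE xs orbT.
    have zs' : z \in (c, y) :: s by rewrite inE zs orbT.
    by rewrite subr_gt0; case/andP: (in_disc_prod hs xs' zs').
  by field; rewrite !gt_eqF// xy.
rewrite {2}/pickform big_cons/= big_cons/=.
under [X in _ <= _ + X]eq_bigr do rewrite big_cons.
rewrite big_split/= e1.
have -> : \sum_(j <- s) c * j.1 * (1 - y * j.2)^-1 = c * \sum_(x <- s) F x.
  by rewrite mulr_sumr; apply: eq_bigr => x _; rewrite /F (mulrC y) mulrA.
have -> : \sum_(j <- s) j.1 * c * (1 - j.2 * y)^-1 = c * \sum_(x <- s) F x.
  by rewrite mulr_sumr; apply: eq_bigr => x _; rewrite /F; ring.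
set S := \sum_(x <- s) F x; set Q := pickform _.
have -> : c * c * (1 - y * y)^-1 + c * S + (c * S + (Q + (1 - y * y) * S ^+ 2)) =
   Q + (1 - y * y)^-1 * (c + (1 - y * y) * S) ^+ 2.
  by field; rewrite gt_eqF.
by rewrite lerDl mulr_ge0 ?sqr_ge0// invr_ge0 ltW.
Qed.

(** Eliminating the nodes of [s] one by one leaves the node [0], at which the Blaschke factor of a
    node [y] takes the value [- y]. *)
Lemma pickform_ge (c0 : R) s : in_disc s ->
  c0 ^+ 2 * \prod_(x <- s) x.2 ^+ 2 <= pickform (s ++ [:: (c0, 0)]).
Proof.
have [n] := ubnP (size s); elim: n c0 s => [//|n IH] c0 [|[c y] s] /= hn hs.
  by rewrite big_nil /pickform big_seq1 big_seq1 /= mul0r subr0 invr1 !mulr1 expr2.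
case/andP: hs => hy hs.
have hd : in_disc ((c, y) :: s ++ [:: (c0, 0)]).
  by rewrite /in_disc /= hy/= all_cat -/(in_disc s) hs/= lexx ltr01.
apply: le_trans (pickform_eliminate hd); rewrite map_cat /=.
apply: le_trans (IH _ _ _ _).
- rewrite big_cons/= big_map/= mulrA mul0r !subr0 sub0r divr1.
  by rewrite exprMn sqrrN.
- by rewrite size_map.
- by rewrite /in_disc all_map.
Qed.

(** For [l >= 1] the coefficient is at least [p / l], while Bernoulli's inequality gives
    [(n / (n + 1)) ^ l <= n / l]. Later [n] is the number of nodes: the factor [n / (n + 1)] lost at
    fewer than [n] nodes then costs at most a factor [expR 1] altogether. *)
Lemma bincoef_ge p (n l : nat) : 0 < p -> (0 < n)%N ->
  Num.min 1 p / n%:R * (n%:R / n.+1%:R) ^+ l <= bincoef p l.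
Proof.
move=> p0 n0; have nr : (0 : R) < n%:R by rewrite ltr0n.
have m0 : 0 <= Num.min 1 p by rewrite le_min ler01 ltW.
case: l => [|l].
  rewrite expr0 mulr1 bincoef0 ler_pdivrMr// mul1r (@le_trans _ _ 1)//.
    by rewrite ge_min lexx.
  by rewrite ler1n.
have h1 : p / l.+1%:R <= bincoef p l.+1.
  rewrite ler_pdivrMr// mulrC bincoef_mulS ler_peMr ?(ltW p0)//.
  rewrite /bincoef; elim/big_ind : _ => [//|x y x1 y1|i _]; first by rewrite mulr_ege1.
  rewrite ler_pdivlMr// mul1r -natr1; lra.
have h2 : (n%:R / n.+1%:R) ^+ l.+1 <= n%:R / l.+1%:R :> R.
  have b (k : nat) : k%:R / n%:R <= (n.+1%:R / n%:R) ^+ k - 1 :> R.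
    elim: k => [|k IHk]; first by rewrite mul0r expr0 subrr.
    have : 1 <= (n.+1%:R / n%:R : R) ^+ k.
      by apply: exprn_ege1; rewrite ler_pdivlMr// mul1r ler_nat.
    rewrite exprS; set z : R := _ ^+ k in IHk * => z1.
    have -> : n.+1%:R / n%:R = 1 + n%:R^-1 :> R by rewrite -natr1; field; rewrite gt_eqF.
    rewrite -natr1 mulrDl mul1r mulrDl mul1r.
    have : n%:R^-1 <= n%:R^-1 * z by rewrite ler_peMr// invr_ge0 ltW.
    lra.
  rewrite -[leLHS]invrK -[leRHS]invrK lef_pV2 ?posrE ?invr_gt0 ?exprn_gt0 ?divr_gt0//.
  rewrite -exprVn !invf_div; have := b l.+1; lra.
apply: le_trans h1.
apply: (@le_trans _ _ (Num.min 1 p / n%:R * (n%:R / l.+1%:R))).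
  by rewrite ler_wpM2l// divr_ge0// ltW.
rewrite mulrA divfK ?gt_eqF// ler_wpM2r ?invr_ge0//.
by rewrite ge_min lexx orbT.
Qed.

End kernel_forms.

(** * Lower bounds for conditional variances *)

Section covariance_bounds.
Variables (R : realType) (alpha beta : R).
Hypothesis adm : admissible alpha beta.
Let p := 2 * beta + 1.
Let p_gt0 : 0 < p. Proof. by case: adm => h1 h2; rewrite /p; lra. Qed.

Lemma gt0_powRE (a x : R) : 0 < a -> a `^ x = expR (x * ln a).
Proof. by move=> a0; rewrite /powR gt_eqF. Qed.

Definition covfactor (b t : R) : R := (4 * b) `^ (p / 2) * t `^ alpha * (t + b) `^ (- p).

(* The Cayley-type substitution [y = (t - b) / (t + b)] turns the kernel
   [(t + s) ^ - p] into [(1 - y z) ^ - p], up to factors. *)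
Lemma cov_cayley (b e t s : R) : 0 < b -> 0 < t -> 0 < s -> e * e = 1 ->
  cov alpha beta t s = covfactor b t * covfactor b s *
    (1 - e * ((t - b) / (t + b)) * (e * ((s - b) / (s + b)))) `^ (- p).
Proof.
move=> b0 t0 s0 ee.
have tb : 0 < t + b by rewrite addr_gt0.
have sb : 0 < s + b by rewrite addr_gt0.
have ts : 0 < t + s by rewrite addr_gt0.
have b4 : 0 < 4 * b by rewrite mulr_gt0.
have -> : 1 - e * ((t - b) / (t + b)) * (e * ((s - b) / (s + b))) =
   2 * b * (t + s) * ((t + b) * (s + b))^-1.
  rewrite mulrACA ee mul1r; field; rewrite !gt_eqF//.
have k0 : 0 < 2 * b * (t + s) * ((t + b) * (s + b))^-1.
  by rewrite divr_gt0 ?mulr_gt0.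
have l4 : ln (4 * b) = 2 * ln 2 + ln b.
  by rewrite (_ : 4 * b = 2 * (2 * b)) ?lnM ?posrE ?mulr_gt0//; ring.
have lk : ln (2 * b * (t + s) * ((t + b) * (s + b))^-1) =
   ln 2 + ln b + ln (t + s) - ln (t + b) - ln (s + b).
  rewrite lnM ?posrE ?invr_gt0 ?mulr_gt0// lnV ?posrE ?mulr_gt0//.
  by rewrite !lnM ?posrE ?mulr_gt0//; ring.
rewrite /cov /covfactor -powRN -/p.
rewrite (gt0_powRE _ b4) (gt0_powRE _ k0) !gt0_powRE ?mulr_gt0// l4 lk.
by rewrite lnM ?posrE// -!expRD; congr expR; rewrite /p; field.
Qed.

Lemma covfactor_diag b : 0 < b -> covfactor b b ^+ 2 = b `^ (2 * alpha - p).
Proof.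
move=> b0; have l4 : ln (4 * b) = 2 * ln 2 + ln b.
  by rewrite (_ : 4 * b = 2 * (2 * b)) ?lnM ?posrE ?mulr_gt0//; ring.
have l2 : ln (b + b) = ln 2 + ln b by rewrite -lnM ?posrE//; congr ln; ring.
have b4 : 0 < 4 * b by rewrite mulr_gt0.
rewrite /covfactor (gt0_powRE _ b4) !gt0_powRE ?addr_gt0// l4 l2 -!expRD expr2 -expRD.
by congr expR; field.
Qed.

(** The sign [e] serves to put the nodes in [[0, 1)]: it is [- 1] when [b] is the largest time and
    [1] when [b] is the smallest. *)
Lemma covform_powerform (b e : R) (s : seq (R * R)) : 0 < b -> e * e = 1 ->
  (forall x, x \in s -> 0 < x.2) ->
  covform alpha beta s s =
  powerform p [seq (x.1 * covfactor b x.2, e * ((x.2 - b) / (x.2 + b))) | x <- s].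
Proof.
move=> b0 ee hs; rewrite /covform /powerform big_map.
apply: eq_big_seq => x xs; rewrite big_map; apply: eq_big_seq => y ys /=.
by rewrite !gtr0_norm ?hs// (cov_cayley b0 _ _ ee) ?hs//; ring.
Qed.

Lemma pickform_perm (s s' : seq (R * R)) : perm_eq s s' -> pickform s = pickform s'.
Proof.
move=> ss'; rewrite /pickform (perm_big _ ss')/=; apply: eq_bigr => x _.
exact: perm_big.
Qed.

(** Based at [b], the Cayley substitution sends [b] to the node [0] of [pickform_ge]. The bound does
    not involve the coefficients in [r], so it is uniform over the combinations of the earlier
    functionals. *)
Lemma covform_ge (a b : R) (r : seq (R * R)) (n : nat) : 0 < b -> (0 < n)%N ->
  (forall x, x \in r -> 0 < x.2 < b) ->
  a ^+ 2 * (Num.min 1 p / n%:R) * b `^ (2 * alpha - p) *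
    \prod_(x <- r) (n%:R / n.+1%:R * ((b - x.2) / (b + x.2)) ^+ 2) <=
  covform alpha beta ((a, b) :: r) ((a, b) :: r).
Proof.
move=> b0 n0 hr; have nr : (0 : R) < n%:R by rewrite ltr0n.
set q := n%:R / n.+1%:R; set c := Num.min 1 p / n%:R.
have c0 : 0 <= c by rewrite divr_ge0// le_min ler01 ltW.
have q0 : 0 <= q by rewrite divr_ge0.
have q1 : q <= 1 by rewrite ler_pdivrMr// mul1r ler_nat.
rewrite (@covform_powerform b (-1))// ?mulrNN ?mulr1//; last first.
  by move=> x; rewrite inE => /predU1P[->//|/hr /andP[]].
set s' := [seq _ | _ <- _].
have yE x : x \in r -> 0 < (b - x.2) / (b + x.2) < 1.
  move=> /hr /andP[x0 xb]; rewrite divr_gt0 ?subr_gt0 ?addr_gt0//=.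
  by rewrite ltr_pdivrMr ?addr_gt0// mul1r; lra.
have yN (x : R) : -1 * ((x - b) / (x + b)) = (b - x) / (b + x).
  by rewrite mulN1r -mulNr opprB [x + b]addrC.
have hs' : in_disc s'.
  rewrite /in_disc /s' /= subrr mul0r mulr0 lexx ltr01/= all_map.
  apply/allP => x /yE /andP[y0 y1] /=.
  by rewrite yN (ltW y0).
apply: le_trans (@powerform_scale _ p c q _ p_gt0 _ hs' (fun l => bincoef_ge l p_gt0 n0)); last first.
  by rewrite q0.
have hs2 : in_disc [seq (x.1, Num.sqrt q * x.2) | x <- s'].
  rewrite /in_disc all_map; apply: sub_all hs' => x /= /andP[x0 x1].
  rewrite mulr_ge0 ?sqrtr_ge0//= (le_lt_trans _ x1)// ler_piMl//.
  by rewrite -sqrtr1 ler_wsqrtr.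
rewrite powerform1//; set Pi := \prod_(x <- r) _.
rewrite [leLHS](_ : _ = c * (a ^+ 2 * b `^ (2 * alpha - p) * Pi)); last by ring.
rewrite ler_wpM2l//.
(* [pickform_ge] keeps the last node, hence the pair coming from [(a, b)] is moved to the end. *)
rewrite (pickform_perm (s' :=
  [seq (x.1 * covfactor b x.2, Num.sqrt q * (-1 * ((x.2 - b) / (x.2 + b)))) | x <- r]
    ++ [:: (a * covfactor b b, 0)])); last first.
  rewrite /s' /= subrr mul0r !mulr0 perm_sym -map_comp cats1 perm_rcons.
  by rewrite perm_cons.
apply: le_trans (pickform_ge _ _); last first.
  move: hs2; rewrite /in_disc /s' /= => /andP[_]; rewrite -map_comp; exact.
rewrite big_map exprMn covfactor_diag// ler_wpM2l//; first by rewrite mulr_ge0 ?powR_ge0 ?sqr_ge0.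
rewrite le_eqVlt; apply/orP; left; apply/eqP; apply: eq_bigr => x _ /=.
by rewrite yN [in RHS]exprMn sqr_sqrtr.
Qed.

End covariance_bounds.

(** * Sums of logarithms of Blaschke factors *)

Section log_coth_sum.
Variable R : realType.

Lemma sin_lex (x : R) : 0 <= x -> sin x <= x.
Proof.
rewrite le_eqVlt => /predU1P[<-|x0]; first by rewrite sin0.
have [c _ e] := MVT x0 (fun y _ => is_derive_sin y) (continuous_subspaceT (@continuous_sin R)).
move: e; rewrite sin0 !subr0 => ->.
by rewrite ler_piMl ?(ltW x0)// cos_le1.
Qed.

Lemma inv_sin_sqr_half (y : R) : sin y != 0 ->
  (sin y ^+ 2)^-1 = ((sin (y / 2) ^+ 2)^-1 + (sin ((y + pi) / 2) ^+ 2)^-1) / 4.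
Proof.
have -> : sin ((y + pi) / 2) = cos (y / 2) by rewrite mulrDl sinDpihalf.
have {1 2}-> : y = (y / 2) *+ 2 by rewrite -mulr_natr divfK.
rewrite sin_mulr2n => h.
have [s0 c0] : sin (y / 2) != 0 /\ cos (y / 2) != 0.
  by split; apply: contraNneq h => ->; rewrite ?mulr0 ?mul0r mul0rn.
have s2 : (sin (y / 2) ^+ 2)^-1 + (cos (y / 2) ^+ 2)^-1 = (sin (y / 2) ^+ 2 * cos (y / 2) ^+ 2)^-1.
  have -> : (sin (y / 2) ^+ 2)^-1 + (cos (y / 2) ^+ 2)^-1 =
    (cos (y / 2) ^+ 2 + sin (y / 2) ^+ 2) / (sin (y / 2) ^+ 2 * cos (y / 2) ^+ 2).
    by field; rewrite s0 c0.
  by rewrite cos2Dsin2 mul1r.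
by rewrite s2; field; rewrite s0 c0.
Qed.

(** Each doubling splits a term by [inv_sin_sqr_half] into those of angles [y / 2] and
    [(y + pi) / 2], which have the indices [k] and [2 ^ n + k] at the next level. *)
Lemma sum_inv_sin_sqr (n : nat) (x : R) : (0 < x < pi) ->
  \sum_(k < 2 ^ n) (sin ((x + k%:R * pi) / (2 ^ n)%:R) ^+ 2)^-1 = 4 ^+ n * (sin x ^+ 2)^-1.
Proof.
move=> /andP[x0 xpi]; elim: n => [|n IH].
  by rewrite expr0 mul1r big_ord1 /= mul0r addr0 [(2 ^ 0)%:R](_ : _ = 1)// divr1.
rewrite exprS -mulrA -IH expnS mul2n -addnn big_split_ord/= -big_split/= mulr_sumr.
apply: eq_bigr => k _; pose y := (x + k%:R * pi) / (2 ^ n)%:R.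
have n0 : (0 : R) < (2 ^ n)%:R by rewrite ltr0n expn_gt0.
have y0 : 0 < y < pi.
  apply/andP; split.
    by rewrite divr_gt0// ltr_wpDr// mulr_ge0// pi_ge0.
  rewrite ltr_pdivrMr// (@lt_le_trans _ _ (pi + k%:R * pi))//; first by rewrite ltrD2r.
  rewrite -{1}[pi]mul1r -mulrDl mulrC ler_wpM2l ?pi_ge0//.
  by rewrite nat1r ler_nat ltn_ord.
have e1 : (x + k%:R * pi) / (2 ^ n + 2 ^ n)%:R = y / 2.
  by rewrite /y natrD; move: (2 ^ n)%:R n0 => a a0;
    rewrite (_ : a + a = 2 * a); [field; rewrite gt_eqF|ring].
have e2 : (x + (2 ^ n + k)%:R * pi) / (2 ^ n + 2 ^ n)%:R = (y + pi) / 2.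
  by rewrite /y !natrD; move: (2 ^ n)%:R n0 => a a0;
    rewrite (_ : a + a = 2 * a); [field; rewrite gt_eqF|ring].
rewrite e1 e2 (@inv_sin_sqr_half y) ?gt_eqF ?sin_gt0_pi//; field.
have h1 : 0 < sin (y / 2).
  by case/andP: y0 => ? ?; rewrite sin_gt0_pi//; apply/andP; split; lra.
have h2 : 0 < sin ((y + pi) / 2).
  by case/andP: y0 => ? ?; rewrite sin_gt0_pi//; apply/andP; split; lra.
by rewrite !gt_eqF.
Qed.

(* Taking [x = pi / 2] in [sum_inv_sin_sqr] and bounding [sin u] by [u]. *)
Lemma sum_inv_odd_sqr (M : nat) : \sum_(m < M) ((2 * m + 1)%:R ^+ 2 : R)^-1 <= pi ^+ 2 / 8.
Proof.
have pi0 := pi_gt0 R.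
pose N := (2 ^ M)%N.
have MN : (M <= N)%N by rewrite ltnW// ltn_expl.
have n0 : (0 : R) < N%:R by rewrite ltr0n expn_gt0.
apply: (@le_trans _ _ (\sum_(m < N) ((2 * m + 1)%:R ^+ 2 : R)^-1)).
  rewrite (big_ord_widen N (fun m => ((2 * m + 1)%:R ^+ 2 : R)^-1))//.
  rewrite [leRHS](bigID (fun i : 'I_N => (i < M)%N))/= lerDl.
  by apply: sumr_ge0 => i _; rewrite invr_ge0 sqr_ge0.
pose F k := (sin ((pi / 2 + k%:R * pi) / (2 ^ M.+1)%:R) ^+ 2)^-1 : R.
have sF : \sum_(k < 2 ^ M.+1) F k = 4 ^+ M.+1.
  rewrite /F sum_inv_sin_sqr ?sin_pihalf ?expr1n ?invr1 ?mulr1//.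
  by apply/andP; split; lra.
(* The reflection of the angle in [pi / 2] exchanges the two halves of the sum, so the first half,
   with the small angles, carries exactly half of it. *)
have sF2 : \sum_(k < 2 ^ M.+1) F k = 2 * \sum_(k < N) F k.
  rewrite expnS mul2n -addnn big_split_ord/= -/N [in X in _ + X](reindex_inj rev_ord_inj)/=.
  rewrite mulr_natl mulr2n; congr (_ + _); apply: eq_bigr => k _; rewrite /F.
  congr (_ ^+ 2)^-1.
  have -> : (N + (N - k.+1))%:R = 2 * N%:R - 1 - k%:R :> R.
    by rewrite natrD natrB ?ltn_ord// -natr1; ring.
  have -> : (pi / 2 + (2 * N%:R - 1 - k%:R) * pi) / (2 ^ M.+1)%:R =
      pi - (pi / 2 + k%:R * pi) / (2 ^ M.+1)%:R :> R.
    have -> : (2 ^ M.+1)%:R = 2 * N%:R :> R by rewrite expnS natrM.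
    by move: N%:R n0 => a a0; field; rewrite gt_eqF.
  by rewrite sinB sinpi cospi mul0r sub0r mulN1r opprK.
have bF (k : 'I_N) : (2 * N%:R) ^+ 2 * 4 / pi ^+ 2 * ((2 * k + 1)%:R ^+ 2)^-1 <= F k.
  pose z : R := (pi / 2 + k%:R * pi) / (2 ^ M.+1)%:R.
  have zE : z = pi * (2 * k + 1)%:R / (2 * (2 * N%:R)).
    rewrite /z expnS natrM -/N natrD natrM.
    by move: N%:R n0 => a a0; field; rewrite gt_eqF.
  have k1 : 0 < (2 * k + 1)%:R :> R by rewrite ltr0n addn1.
  have z0 : 0 < z by rewrite zE divr_gt0 ?mulr_gt0.
  have zpi : z < pi.
    rewrite zE ltr_pdivrMr ?mulr_gt0// ltr_pM2l// -!natrM ltr_nat.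
    have := ltn_ord k; lia.
  have s0 : 0 < sin z by rewrite sin_gt0_pi// z0.
  rewrite /F -/z [leLHS](_ : _ = (z ^+ 2)^-1); last first.
    rewrite zE; move: N%:R (2 * k + 1)%:R pi n0 k1 pi0 => a b c a0 b0 c0.
    by field; rewrite !gt_eqF.
  rewrite lef_pV2 ?posrE ?exprn_gt0// lerXn2r ?nnegrE ?(ltW s0) ?(ltW z0)//.
  by rewrite sin_lex// ltW.
have : 2 * \sum_(k < N) ((2 * N%:R) ^+ 2 * 4 / pi ^+ 2 * ((2 * k + 1)%:R ^+ 2)^-1) <= (2 * N%:R) ^+ 2 :> R.
  rewrite (@le_trans _ _ (2 * \sum_(k < N) F k))//.
    by rewrite ler_wpM2l//; apply: ler_sum => k _; exact: bF.
  rewrite -sF2 sF -natrM -expnS natrX -exprM mulnC exprM expr2.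
  by rewrite -[X in _ <= (X * X) ^+ _]/(2 : R) -natrM.
rewrite -mulr_sumr mulrA => h.
have -> : pi ^+ 2 / 8 = (2 * ((2 * N%:R) ^+ 2 * 4 / pi ^+ 2))^-1 * (2 * N%:R) ^+ 2 :> R.
  by move: N%:R pi n0 pi0 => a c a0 c0; field; rewrite !gt_eqF.
rewrite ler_pdivlMl// !mulr_gt0// ?invr_gt0 ?exprn_gt0 ?mulr_gt0//.
Qed.

(** For [q = expR (- u)] this is [ln (coth (u / 2))]: minus the logarithm of the Blaschke factor
    [(t - t') / (t + t')] of two times with [t' / t = q]. *)
Definition logcoth (q : R) : R := ln ((1 + q) / (1 - q)).

(** A truncation of the power series. The derivative of the remainder at [x] is
    [2 * x ^ (2 * M) / (1 - x ^ 2)], at most its value [C] at [q], so the difference of both sides,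
    with [C * x] as last term, is nondecreasing on [[0, q]]. *)
Lemma logcoth_le (M : nat) (q : R) : 0 < q < 1 ->
  logcoth q <= 2 * (\sum_(m < M) q ^+ (2 * m + 1) / (2 * m + 1)%:R) +
     2 * q ^+ (2 * M + 1) / (1 - q ^+ 2).
Proof.
move=> /andP[q0 q1].
have qq : q ^+ 2 < 1 by rewrite exprn_ilt1// ltW.
pose C := 2 * q ^+ (2 * M) / (1 - q ^+ 2).
pose S (x : R) : R := \sum_(m < M) x ^+ (2 * m + 1) / (2 * m + 1)%:R.
pose S' (x : R) : R := \sum_(m < M) x ^+ (2 * m).
have dS x : is_derive x (1 : R) S (S' x).
  have -> : S = \sum_(m < M) (fun y : R => y ^+ (2 * m + 1) / (2 * m + 1)%:R).
    by apply/funext => y; rewrite fct_sumE.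
  apply: is_derive_sum => m.
  have := is_deriveZ (2 * m + 1)%:R^-1 (is_deriveX (2 * m + 1) (is_derive_id x (1 : R))).
  rewrite exprfctE /GRing.scale /= mulr1 addn1/= mulKf ?pnatr_eq0//.
  rewrite (_ : (fun y : R => y ^+ (2 * m).+1 / _) =
    ((2 * m).+1%:R^-1 \*: (GRing.exp (R:=R))^~ (2 * m).+1)) //.
  by apply/funext => y; rewrite /= mulrC.
pose g x := 2 * S x + C * x - (ln (1 + x) - ln (1 - x)).
pose g' x := 2 * S' x + C - ((1 + x)^-1 + (1 - x)^-1).
have dg (x : R) : 0 <= x < 1 -> is_derive x (1 : R) g (g' x).
  move=> /andP[x0 x1].
  have x1' : 0 < 1 - x by rewrite subr_gt0.
  have x1p : 0 < 1 + x by rewrite ltr_wpDr.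
  have d1 : is_derive x (1 : R) (fun y => ln (1 + y)) ((1 + x)^-1).
    rewrite -[X in is_derive _ _ _ X]mulr1.
    apply: (@is_derive1_comp _ (@ln R) (fun y => 1 + y)); first exact: is_derive1_ln.
    by apply: is_derive_eq; rewrite /GRing.scale /=; ring.
  have d2 : is_derive x (1 : R) (fun y => ln (1 - y)) ((1 - x)^-1 * (- 1)).
    apply: (@is_derive1_comp _ (@ln R) (fun y => 1 - y)); first exact: is_derive1_ln.
    by apply: is_derive_eq; rewrite /GRing.scale /=; ring.
  have d3 := dS x.
  by apply: is_derive_eq; rewrite /GRing.scale /= /g'; ring.
have S'E (x : R) : 0 <= x < 1 -> S' x = (1 - x ^+ (2 * M)) / (1 - x ^+ 2).
  move=> /andP[x0 x1]; have x2 : 0 < 1 - x ^+ 2 by rewrite subr_gt0 exprn_ilt1.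
  have x2n : 1 - x ^+ 2 != 0 by rewrite gt_eqF.
  have := subrXX 1 (x ^+ 2) M; rewrite expr1n => e.
  rewrite exprM e mulrAC mulfV// mul1r.
  by apply: eq_bigr => m _; rewrite expr1n mul1r exprM.
have g'0 (x : R) : 0 < x < q -> 0 <= g' x.
  move=> /andP[x0 xq]; have x1 := lt_trans xq q1.
  have x2 : 0 < 1 - x ^+ 2 by rewrite subr_gt0 exprn_ilt1// ltW.
  have -> : g' x = C - 2 * x ^+ (2 * M) / (1 - x ^+ 2).
    rewrite /g' S'E ?(ltW x0)//.
    have x1' : 0 < 1 - x by rewrite subr_gt0.
    have x1p : 0 < 1 + x by rewrite ltr_wpDr// ltW.
    by field; rewrite !gt_eqF//.
  rewrite subr_ge0 /C -!mulrA ler_wpM2l//; apply: ler_pM.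
  - by rewrite exprn_ge0// ltW.
  - by rewrite invr_ge0 ltW.
  - by rewrite lerXn2r ?nnegrE ?(ltW x0) ?(ltW q0)// ltW.
  - rewrite lef_pV2 ?posrE ?subr_gt0//; last by rewrite -subr_gt0.
    by rewrite lerD2l lerN2 lerXn2r ?nnegrE ?(ltW x0) ?(ltW q0)// ltW.
have [||c] := @MVT _ g g' 0 q q0.
- move=> y; rewrite in_itv/= => /andP[y0 yq]; apply: dg.
  by rewrite (ltW y0) (lt_trans yq).
- apply: derivable_within_continuous => y; rewrite in_itv/= => /andP[y0 yq].
  by have [] := dg y; rewrite ?y0 ?(le_lt_trans yq).
rewrite in_itv/= => /g'0 c0 e.
have g0 : g 0 = 0.
  rewrite /g /S big1 ?mulr0 ?addr0 ?subr0 ?subrr// => m _.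
  by rewrite expr0n addn1/= mul0r.
have : 0 <= g q by move: e; rewrite g0 !subr0 => ->; rewrite mulr_ge0// ltW.
have q1' : 0 < 1 - q by rewrite subr_gt0.
have q1p : 0 < 1 + q by rewrite ltr_wpDr// ltW.
rewrite /g /logcoth ln_div ?posrE// subr_ge0.
have -> : C * q = 2 * q ^+ (2 * M + 1) / (1 - q ^+ 2) by rewrite /C addn1 [in RHS]exprSr; ring.
by [].
Qed.

Lemma sum_geometric_le (h : R) (k : nat) : 0 < h ->
  \sum_(j < k) expR (- (j.+1%:R * h)) <= h^-1.
Proof.
move=> h0; set r := expR (- h).
have r1 : r < 1 by rewrite -expR0 ltr_expR oppr_lt0.
have r0 : 0 < r by exact: expR_gt0.
have -> : \sum_(j < k) expR (- (j.+1%:R * h)) = r * \sum_(j < k) r ^+ j.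
  rewrite mulr_sumr; apply: eq_bigr => j _.
  by rewrite -exprS /r -expRM_natl mulrN.
have hk : (1 - r) * (\sum_(j < k) r ^+ j) <= 1.
  rewrite -[X in _ <= X](subr0 (1 : R)); have := subrXX 1 r k.
  rewrite expr1n => e; rewrite [leLHS](_ : _ = 1 - r ^+ k).
    by rewrite lerD2l lerN2 exprn_ge0// ltW.
  by rewrite e; congr (_ * _); apply: eq_bigr => i _; rewrite expr1n mul1r.
have hr : r * h <= 1 - r.
  have := expR_ge1Dx h; rewrite -[h in X in _ <= X]opprK expRN -/r.
  by rewrite -[X in _ <= X]mul1r ler_pdivlMr//; lra.
rewrite -[leRHS]mul1r ler_pdivlMr// mulrAC (le_trans _ hk)//.
by rewrite ler_wpM2r// sumr_ge0// => i _; rewrite exprn_ge0// ltW.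
Qed.

(** Summing the series first over [j], the geometric sum of step [(2 * m + 1) * h] brings a second
    factor [1 / (2 * m + 1)]; the sum over odd squares then gives [2 / h * (pi ^ 2 / 8)]. The
    truncation error [E M] tends to [0] for fixed [k]. *)
Lemma sum_logcoth_le (h : R) (k : nat) : 0 < h ->
  \sum_(j < k) logcoth (expR (- (j.+1%:R * h))) <= pi ^+ 2 / (4 * h).
Proof.
move=> h0; set q := fun j : nat => expR (- (j.+1%:R * h)).
have q1 j : 0 < q j < 1.
  by rewrite expR_gt0/= -expR0 ltr_expR oppr_lt0 mulr_gt0.
set r := expR (- h).
have r1 : r < 1 by rewrite -expR0 ltr_expR oppr_lt0.
have r0 : 0 < r by exact: expR_gt0.
have rr : r ^+ 2 < 1 by rewrite exprn_ilt1// ltW.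
have qr j : q j <= r by rewrite ler_expR lerN2 ler_peMl ?(ltW h0)// ler1n.
pose E (M : nat) : R := k%:R * (2 / (1 - r ^+ 2) * r) * (r ^+ 2) ^+ M.
have bd M : \sum_(j < k) logcoth (q j) <= pi ^+ 2 / (4 * h) + E M.
  apply: (@le_trans _ _ (\sum_(j < k) (2 * (\sum_(m < M) q j ^+ (2 * m + 1) / (2 * m + 1)%:R) +
     (2 / (1 - r ^+ 2) * r) * (r ^+ 2) ^+ M))).
    apply: ler_sum => j _; apply: (le_trans (logcoth_le M (q1 j))); rewrite lerD2l.
    have [q0 q1'] := andP (q1 j).
    rewrite [leRHS](_ : _ = 2 * r ^+ (2 * M + 1) / (1 - r ^+ 2)); last first.
      by rewrite addn1 [in RHS]exprS exprM; ring.
    rewrite -!mulrA ler_wpM2l//; apply: ler_pM.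
    - by rewrite exprn_ge0// ltW.
    - by rewrite invr_ge0 subr_ge0 exprn_ile1// ltW.
    - by rewrite lerXn2r ?nnegrE ?(ltW r0) ?(ltW q0).
    - rewrite lef_pV2 ?posrE ?subr_gt0 ?exprn_ilt1 ?(ltW q0) ?(ltW r0)//.
      by rewrite lerD2l lerN2 lerXn2r ?nnegrE ?(ltW r0) ?(ltW q0).
  have -> : E M = \sum_(j < k) (2 / (1 - r ^+ 2) * r * (r ^+ 2) ^+ M).
    by rewrite sumr_const card_ord -mulr_natl /E; ring.
  rewrite big_split/= lerD2r.
  rewrite -mulr_sumr exchange_big/=.
  apply: (@le_trans _ _ (2 * \sum_(m < M) (h^-1 * ((2 * m + 1)%:R ^+ 2)^-1))).
    rewrite ler_wpM2l//; apply: ler_sum => m _; rewrite -mulr_suml.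
    have m0 : 0 < (2 * m + 1)%:R :> R by rewrite ltr0n addn1.
    rewrite expr2 invfM mulrA ler_wpM2r ?invr_ge0 ?(ltW m0)//.
    have := @sum_geometric_le ((2 * m + 1)%:R * h) k (mulr_gt0 m0 h0).
    have -> : h^-1 / (2 * m + 1)%:R = ((2 * m + 1)%:R * h)^-1 by rewrite invfM mulrC.
    apply: le_trans; rewrite le_eqVlt; apply/orP; left; apply/eqP.
    apply: eq_bigr => j _; rewrite /q -expRM_natl; congr expR; ring.
  rewrite -mulr_sumr mulrA [leRHS](_ : _ = 2 * h^-1 * (pi ^+ 2 / 8)); last by field; rewrite gt_eqF.
  by rewrite ler_wpM2l ?sum_inv_odd_sqr// mulr_ge0// invr_ge0 ltW.
have cE : pi ^+ 2 / (4 * h) + E M @[M --> \oo] --> pi ^+ 2 / (4 * h) + (0 : R).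
  apply: cvgD; first exact: cvg_cst.
  rewrite -[X in _ --> X](mulr0 (k%:R * (2 / (1 - r ^+ 2) * r))); apply: cvgMr.
  by apply: cvg_expr; rewrite ger0_norm ?sqr_ge0.
rewrite -[leRHS]addr0 -(cvg_lim (@Rhausdorff R) cE).
by apply: limr_ge; [exact: cvgP cE|exact: nearW].
Qed.

End log_coth_sum.

(** * Small-ball events and the upper bound on their probability *)

Section small_ball_events.
Context d (T : measurableType d) (R : realType) (P : probability T R).
Variables (alpha beta : R) (X : R -> {RV P >-> R}).
Hypothesis isX : is_X alpha beta X.

Definition dyadic_ball (eps : R) (N : nat) : set T :=
  [set w | forall i, (i <= 2 ^ N)%N -> `|X (i%:R / (2 ^ N)%:R) w| <= eps].

Lemma measurable_abs_le (Y : {RV P >-> R}) (eps : R) :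
  measurable [set w | `|Y w| <= eps].
Proof.
rewrite (_ : [set w | _] = (fun w => `|Y w|) @^-1` `]-oo, eps]).
  by rewrite -[X in measurable X]setTI; apply: (measurableT_comp (@normr_measurable R setT)) => //; exact: measurable_itv.
by apply/seteqP; split => w /=; rewrite in_itv.
Qed.

Lemma measurable_dyadic_ball eps N : measurable (dyadic_ball eps N).
Proof.
rewrite (_ : dyadic_ball eps N = \bigcap_i (if (i <= 2 ^ N)%N then
    [set w | `|X (i%:R / (2 ^ N)%:R) w| <= eps] else setT)).
  by apply: bigcapT_measurable => i; case: ifP => // _; exact: measurable_abs_le.
apply/seteqP; split => w /= h i => [_|iN]; first by case: ifP => // iN; exact: h.
by have := h i I; rewrite iN.
Qed.

Lemma small_ballP eps w : small_ball X eps w <->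
  (forall t, 0 <= t <= 1 -> `|X t w| <= eps).
Proof.
rewrite /small_ball /=; split => [h t t01|h].
  rewrite -lee_fin; apply: le_trans h; apply: ereal_sup_ubound.
  by exists t => //=; rewrite in_itv.
by apply: ge_ereal_sup => _ [t /= + <-]; rewrite in_itv/= lee_fin; exact: h.
Qed.

(** By continuity of the path, the value at [t] is the limit of the values at the dyadic points
    [u N] just below [t]. *)
Lemma small_ballE eps : small_ball X eps = \bigcap_N dyadic_ball eps N.
Proof.
apply/seteqP; split => w.
  move=> /small_ballP h N _ i iN; apply: h.
  rewrite divr_ge0//= ler_pdivrMr ?ltr0n ?expn_gt0// mul1r ler_nat//.
move=> h; apply/small_ballP => t t01.
have [t0 t1] := andP t01.
have p2 N : (0 : R) < (2 ^ N)%:R by rewrite ltr0n expn_gt0.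
pose i N := Num.truncn (t * (2 ^ N)%:R).
pose u N : R := (i N)%:R / (2 ^ N)%:R.
have iP N : (i N)%:R <= t * (2 ^ N)%:R < (i N).+1%:R.
  by apply: truncn_itv; rewrite mulr_ge0// ltW.
have ut N : u N <= t by rewrite ler_pdivrMr//; case/andP: (iP N).
have u0 N : 0 <= u N by rewrite divr_ge0.
have uc : u N @[N --> \oo] --> t.
  apply: (@squeeze_cvgr _ _ _ _ (fun N => t - 2^-1 ^+ N) (fun=> t)).
  - apply: nearW => N; rewrite ut andbT lerBlDr.
    rewrite (_ : u N + _ = (i N).+1%:R / (2 ^ N)%:R).
      by rewrite ler_pdivlMr//; case/andP: (iP N) => _ /ltW.
    by rewrite /u -(natr1 (i N)) mulrDl mul1r exprVn natrX.
  - rewrite -[X in _ --> X]subr0; apply: cvgB; first exact: cvg_cst.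
    by apply: cvg_expr; rewrite ger0_norm ?invr_ge0// invf_lt1// ltr1n.
  - exact: cvg_cst.
have cX := @X_continuous _ _ _ _ _ _ _ isX w.
have /subspace_continuousP/(_ t) := cX; rewrite /= in_itv/= => /(_ t01) cXt.
(* Paths are continuous only within [[0, 1]], so the convergence of [u] must be stated within that
   interval. *)
have ucw : u N @[N --> \oo] --> within `[0, 1] (nbhs t).
  move=> A /= hA; apply: (@filterS _ \oo _ (fun N => `[0, 1]%classic (u N) -> A (u N))); last exact: uc hA.
  move=> N; apply.
  by rewrite /= in_itv/= u0/= (le_trans (ut N)).
have := cvg_comp _ _ ucw cXt => cXu.
have cn : `|X (u N) w| @[N --> \oo] --> `|X t w| by apply: cvg_norm.
rewrite -(cvg_lim (@Rhausdorff R) cn); apply: limr_le; first exact: cvgP cn.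
apply: nearW => N; apply: (h N I).
rewrite -(ler_nat R); have /andP[+ _] := iP N => /le_trans; apply.
by rewrite ler_piMl// ltW.
Qed.

Lemma measurable_small_ball eps : measurable (small_ball X eps).
Proof. by rewrite small_ballE; apply: bigcapT_measurable => N; exact: measurable_dyadic_ball. Qed.

Lemma dyadic_ball_decr eps : {homo dyadic_ball eps : n m / (n <= m)%N >-> (m <= n)%O}.
Proof.
move=> n m nm; apply/subsetPset => w /= h i iN.
have e : (2 ^ m = 2 ^ n * 2 ^ (m - n))%N by rewrite -expnD subnKC.
have := h (i * 2 ^ (m - n))%N; rewrite e leq_mul2r iN orbT => /(_ isT).
rewrite (_ : _ / _ = i%:R / (2 ^ n)%:R)//.
by rewrite !natrM invfM mulrACA mulfV ?mulr1.
Qed.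

Lemma small_ball_prob_ge eps (c : R) :
  (\forall N \near \oo, (c%:E <= P (dyadic_ball eps N))%E) -> (c%:E <= P (small_ball X eps))%E.
Proof.
move=> h; rewrite small_ballE.
have cv := @nonincreasing_cvg_mu _ _ _ P (dyadic_ball eps).
have {}cv : (P \o dyadic_ball eps) N @[N --> \oo] --> P (\bigcap_N dyadic_ball eps N).
  apply: cv.
  - by rewrite (le_lt_trans (probability_le1 _ _))// ?ltry//; exact: measurable_dyadic_ball.
  - by move=> i; exact: measurable_dyadic_ball.
  - by apply: bigcapT_measurable => N; exact: measurable_dyadic_ball.
  - exact: dyadic_ball_decr.
rewrite -(cvg_lim (@ereal_hausdorff R) cv).
by apply: lime_ge; [exact: cvgP cv|exact: h].
Qed.

Lemma Rintegral_prob_le (A : set T) (f : T -> R) : measurable A ->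
  P.-integrable setT (EFin \o f) -> (forall w, 0 <= f w) -> (forall w, A w -> 1 <= f w) ->
  (P A <= (\int[P]_w f w)%:E)%E.
Proof.
move=> mA intf f0 f1.
rewrite fineK; last exact: integrable_fin_num intf.
rewrite -[A]setIT -integral_indic//; apply: ge0_le_integral => //.
- by apply/measurable_EFinP; exact: measurable_indic.
- exact: measurable_int intf.
- move=> w _; rewrite lee_fin indicE; case: (boolP (w \in A)) => //.
  by rewrite inE => /f1.
Qed.

(** Integration of the pointwise bound of [f] by the indicator of [A] plus [c]. *)
Lemma Rintegral_prob_ge (A : set T) (f : T -> R) (c : R) : measurable A ->
  P.-integrable setT (EFin \o f) -> (forall w, f w <= 1) -> (forall w, ~ A w -> f w <= c) ->
  0 <= c -> ((\int[P]_w f w - c)%:E <= P A)%E.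
Proof.
move=> mA intf f1 fc c0.
rewrite EFinB leeBlDr// fineK; last exact: integrable_fin_num intf.
rewrite -[A]setIT -integral_indic//.
have -> : c%:E = (\int[P]_w c%:E)%E by rewrite integral_cst//= probability_setT mule1.
rewrite -ge0_integralD//; last first.
  by apply/measurable_EFinP; exact: measurable_indic.
apply: le_integral => //.
- apply: (@bounded_integrable _ _ _ _ _ (1 + c)).
    by apply: measurable_funD => //; exact: measurable_indic.
  move=> w; rewrite ger0_norm ?addr_ge0// lerD2r indicE; case: (_ \in _) => //=.
- move=> w _; rewrite -EFinD lee_fin indicE; case: (boolP (w \in A)) => /=.
    by move=> _; rewrite (le_trans (f1 w))// lerDl.
  by rewrite notin_setE add0r; exact: fc.
Qed.

End small_ball_events.

Lemma lesssim0_le (R : realType) (f g : R -> \bar R) :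
  (forall e : R, 0 < e -> \forall x \near (0 : R)^'+, (f x / g x <= (1 + e)%:E)%E) ->
  lesssim0 f g.
Proof.
move=> h; rewrite /lesssim0 limf_esupE; apply/lee_addgt0Pr => e e0.
apply: (@le_trans _ _ (ereal_sup [set (f x / g x)%E | x in [set x | (f x / g x <= (1 + e)%:E)%E]])).
  by apply: ereal_inf_lbound; exists [set x | (f x / g x <= (1 + e)%:E)%E] => //; exact: h.
by apply: ge_ereal_sup => _ [x /= hx <-].
Qed.

Lemma sum_const_seq (R : pzRingType) (I : Type) (s : seq I) (c : R) :
  \sum_(i <- s) c = (size s)%:R * c.
Proof. by elim: s => [|i s IH]; rewrite ?big_nil ?mul0r// big_cons IH -natr1 addrC mulrDl mul1r. Qed.

Lemma sqrt_expR (R : realType) (x : R) : Num.sqrt (expR x) = expR (x / 2).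
Proof.
rewrite (_ : expR x = expR (x / 2) ^+ 2); first by rewrite sqrtr_sqr gtr0_norm ?expR_gt0.
by rewrite expr2 -expRD; congr expR; field.
Qed.

Lemma prod_expR (R : realType) (I : Type) (s : seq I) (f : I -> R) :
  \prod_(i <- s) expR (f i) = expR (\sum_(i <- s) f i).
Proof. by rewrite (big_morph (@expR R) (@expRD R) (@expR0 R)). Qed.

Lemma sum_sqrt_ge (R : realType) (n : nat) :
  2 / 3 * (n%:R * Num.sqrt n%:R) <= \sum_(k < n) Num.sqrt k.+1%:R :> R.
Proof.
elim: n => [|n IH]; first by rewrite big_ord0 mul0r mulr0.
rewrite big_ord_recr /= -lerBlDr; apply: le_trans IH.
have : (Num.sqrt n.+1%:R : R) ^+ 2 = Num.sqrt n%:R ^+ 2 + 1 by rewrite !sqr_sqrtr ?natr1.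
have -> : n%:R * Num.sqrt n%:R = Num.sqrt n%:R ^+ 3 :> R by rewrite exprSr sqr_sqrtr.
have -> : n.+1%:R * Num.sqrt n.+1%:R = Num.sqrt n.+1%:R ^+ 3 :> R by rewrite exprSr sqr_sqrtr.
have a0 : 0 <= Num.sqrt n%:R :> R by exact: sqrtr_ge0.
have b0 : 0 <= Num.sqrt n.+1%:R :> R by exact: sqrtr_ge0.
move: (Num.sqrt n%:R) (Num.sqrt n.+1%:R) a0 b0 => a b a0 b0 ab.
(* With [b ^ 2 = a ^ 2 + 1], the induction step [2 / 3 * (b ^ 3 - a ^ 3) <= b] is equivalent to
   [0 <= (b - a) ^ 2 * (b + 2 * a)]. *)
have := mulr_ge0 (sqr_ge0 (b - a)) (addr_ge0 b0 (addr_ge0 a0 a0)).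
have -> : (b - a) ^+ 2 * (b + (a + a)) = b ^+ 3 - 3 * b * a ^+ 2 + 2 * a ^+ 3 by ring.
have -> : a ^+ 2 = b ^+ 2 - 1 by rewrite ab addrK.
have -> : b ^+ 3 - 3 * b * (b ^+ 2 - 1) + 2 * a ^+ 3 = - 2 * b ^+ 3 + 3 * b + 2 * a ^+ 3 by ring.
lra.
Qed.

Lemma in_span_singletons (R : realType) (a a' b : R) (tm : nat -> R) (s : seq nat) v :
  in_span (@lincomb_add R) [:: (a, b)] [seq [:: (a', tm i)] | i <- s] v ->
  exists2 r, v = (a, b) :: r & [seq x.2 | x <- r] = rev [seq tm i | i <- s].
Proof.
elim: s v => [|i s IH] v /=; first by move=> ->; exists [::].
move=> [v' [u [/IH [r -> rE] ->]]]; exists (r ++ [:: (u * a', tm i)]) => //.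
by rewrite map_cat rE rev_cons cats1.
Qed.

Section small_ball_upper.
Context d (T : measurableType d) (R : realType) (P : probability T R).
Variables (alpha beta : R) (X : R -> {RV P >-> R}).
Hypothesis adm : admissible alpha beta.
Hypothesis isX : is_X alpha beta X.
Let p := 2 * beta + 1.
Let gam := alpha - beta - 2^-1.
Let gam_gt0 : 0 < gam. Proof. by case: adm => h1 h2; rewrite /gam; lra. Qed.
Let p_gt0 : 0 < p. Proof. by case: adm => h1 h2; rewrite /p; lra. Qed.

Lemma logcoth_mono (q q' : R) : 0 < q -> q <= q' -> q' < 1 -> logcoth q <= logcoth q'.
Proof.
move=> q0 qq q1; rewrite /logcoth ler_ln ?posrE ?divr_gt0; [|lra..].
rewrite ler_pdivrMr; last lra.
rewrite mulrAC ler_pdivlMr; last lra.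
nra.
Qed.

Section points.
Variables (L : R) (n : nat).
Hypothesis n_gt0 : (0 < n)%N.
(** Half the logarithm of the variance of [expR L * X (tm k)], where [expR L] stands for
    [eps^-1]. *)
Let y (k : nat) : R := pi * Num.sqrt gam * Num.sqrt k.+1%:R.
Let tm (k : nat) : R := expR (- (L - y k) / gam).

Let y_lt i k : (i < k)%N -> y i < y k.
Proof.
move=> ik; rewrite /y ltr_pM2l ?mulr_gt0 ?pi_gt0 ?sqrtr_gt0//.
by rewrite ltr_sqrt ?ltr0n// ltr_nat.
Qed.

(** Concavity of the square root, as [b - a >= (b ^ 2 - a ^ 2) / (2 * b)]. *)
Let y_gap i k : (i < k)%N ->
  (k - i)%:R * (pi / (2 * Num.sqrt gam * Num.sqrt k.+1%:R)) <= (y k - y i) / gam.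
Proof.
move=> ik; have pi0 := pi_gt0 R.
have g0 : 0 < Num.sqrt gam by rewrite sqrtr_gt0.
have b0 : 0 < Num.sqrt k.+1%:R :> R by rewrite sqrtr_gt0 ltr0n.
have a0 : 0 <= Num.sqrt i.+1%:R :> R by exact: sqrtr_ge0.
have -> : gam = Num.sqrt gam ^+ 2 by rewrite sqr_sqrtr// ltW.
rewrite (sqrtr_sqr _) ger0_norm ?(ltW g0)// /y.
have : (k - i)%:R = Num.sqrt k.+1%:R ^+ 2 - Num.sqrt i.+1%:R ^+ 2 :> R.
  by rewrite !sqr_sqrtr// -natrB ?ltnS 1?ltnW// subSS.
move=> ->; move: (Num.sqrt gam) (Num.sqrt k.+1%:R) (Num.sqrt i.+1%:R) pi g0 b0 a0 pi0.
move=> g b a c g0 b0 a0 c0.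
have -> : (b ^+ 2 - a ^+ 2) * (c / (2 * g * b)) = c / g / (2 * b) * (b ^+ 2 - a ^+ 2).
  by field; rewrite !gt_eqF.
have -> : (c * g * b - c * g * a) / g ^+ 2 = c / g / (2 * b) * (2 * b * (b - a)).
  by field; rewrite !gt_eqF.
apply: ler_wpM2l; first by rewrite !divr_ge0 ?mulr_ge0// ltW.
have := sqr_ge0 (b - a); nra.
Qed.

(* The gaps [(y k - y i) / gam] are at least [(k - i) * h], with [h] such that the
   bound [pi ^ 2 / (4 * h)] of [sum_logcoth_le] is [y k / 2]. *)
Let sum_logcoth_points k :
  \sum_(i < k) logcoth (expR (- ((y k - y i) / gam))) <= y k / 2.
Proof.
have pi0 := pi_gt0 R.
have g0 : 0 < Num.sqrt gam by rewrite sqrtr_gt0.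
have b0 : 0 < Num.sqrt k.+1%:R :> R by rewrite sqrtr_gt0 ltr0n.
pose h : R := pi / (2 * Num.sqrt gam * Num.sqrt k.+1%:R).
have h0 : 0 < h by rewrite divr_gt0 ?mulr_gt0.
apply: (@le_trans _ _ (\sum_(j < k) logcoth (expR (- (j.+1%:R * h))))).
  rewrite [leRHS](reindex_inj rev_ord_inj)/=; apply: ler_sum => i _.
  apply: logcoth_mono; first exact: expR_gt0.
    rewrite ler_expR lerN2; apply: le_trans (y_gap (ltn_ord i)).
    by rewrite subnSK ?ltn_ord.
  by rewrite -expR0 ltr_expR oppr_lt0 mulr_gt0// ltr0n.
apply: (le_trans (sum_logcoth_le k h0)); rewrite /h /y.
move: (Num.sqrt gam) (Num.sqrt k.+1%:R) pi g0 b0 pi0 => g b c g0 b0 c0.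
by rewrite le_eqVlt; apply/orP; left; apply/eqP; field; rewrite !gt_eqF.
Qed.

(** The exponent collects [2 * y k] from the variance, [- y k] from twice the sum of the [logcoth],
    at least [- 1] from the factors [n / (n + 1)], and the logarithm of the constant of
    [bincoef_ge]. *)
Lemma covform_points_ge k r : (k < n)%N ->
  [seq x.2 | x <- r] = rev [seq tm i | i <- iota 0 k] ->
  expR (y k + ln (Num.min 1 p / n%:R) - 1) <=
  covform alpha beta ((expR L, tm k) :: r) ((expR L, tm k) :: r).
Proof.
move=> kn rE; have nr : (0 : R) < n%:R by rewrite ltr0n.
have tm_lt i : (i < k)%N -> tm i < tm k.
  by move=> ik; rewrite ltr_expR ltr_pM2r ?invr_gt0// ltrN2 ltrD2l ltrN2 y_lt.
have := @covform_ge _ _ _ adm (expR L) (tm k) r n (expR_gt0 _) n_gt0.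
have rin x : x \in r -> 0 < x.2 < tm k.
  move=> xr; have : x.2 \in [seq x.2 | x <- r] by exact: map_f.
  rewrite rE mem_rev => /mapP[i]; rewrite mem_iota add0n => /andP[_ ik] ->.
  by rewrite expR_gt0 tm_lt.
move=> /(_ rin); apply: le_trans.
rewrite -(big_map snd xpredT (fun t => n%:R / n.+1%:R * ((tm k - t) / (tm k + t)) ^+ 2)) rE.
rewrite (perm_big _ (permEl (perm_rev _))) big_map -/p.
have c0 : 0 < Num.min 1 p / n%:R by rewrite divr_gt0// lt_min ltr01.
have F i : i \in iota 0 k -> expR (- n%:R^-1) * expR (- (2 * logcoth (expR (- ((y k - y i) / gam))))) <=
    n%:R / n.+1%:R * ((tm k - tm i) / (tm k + tm i)) ^+ 2.
  rewrite mem_iota add0n => /andP[_ ik].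
  have r1 : expR (- ((y k - y i) / gam)) < 1.
    by rewrite -expR0 ltr_expR oppr_lt0 divr_gt0// subr_gt0 y_lt.
  have ti : tm i = tm k * expR (- ((y k - y i) / gam)).
    by rewrite /tm -expRD; congr expR; field; rewrite gt_eqF.
  apply: ler_pM; rewrite ?expR_ge0//.
    rewrite expRN -[n%:R / _]invrK lef_pV2 ?posrE ?expR_gt0 ?invr_gt0 ?divr_gt0// invf_div.
    by apply: le_trans (expR_ge1Dx _); rewrite -natr1 mulrDl mulfV ?gt_eqF// mul1r.
  rewrite ti; set e := expR (- ((y k - y i) / gam)) in r1 *.
  have e0 : 0 < e by exact: expR_gt0.
  have -> : (tm k - tm k * e) / (tm k + tm k * e) = ((1 + e) / (1 - e))^-1.
    by field; rewrite !gt_eqF ?subr_gt0// ?addr_gt0 ?mulr_gt0 ?expR_gt0.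
  rewrite (_ : - (2 * _) = - logcoth e + - logcoth e); last by ring.
  rewrite expRD -expr2 /logcoth expRN lnK//.
  by rewrite posrE divr_gt0 ?subr_gt0 ?addr_gt0.
apply: (@le_trans _ _ (expR L ^+ 2 * (Num.min 1 p / n%:R) * tm k `^ (2 * alpha - p) *
   \prod_(i <- iota 0 k) (expR (- n%:R^-1) * expR (- (2 * logcoth (expR (- ((y k - y i) / gam)))))))); last first.
  rewrite ler_wpM2l//; last first.
    rewrite big_seq_cond [leRHS]big_seq_cond; apply: ler_prod => i /andP[ik _].
    by rewrite mulr_ge0 ?expR_ge0//= F.
  by rewrite (mulr_ge0 _ (powR_ge0 _ _))// mulr_ge0 ?sqr_ge0// ltW.
rewrite big_split/= !prod_expR.
have -> : \sum_(i <- iota 0 k) - (2 * logcoth (expR (- ((y k - y i) / gam)))) =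
    - (2 * \sum_(i <- iota 0 k) logcoth (expR (- ((y k - y i) / gam)))).
  by rewrite sumrN -mulr_sumr.
set lm := ln (Num.min 1 p / n%:R); have -> : Num.min 1 p / n%:R = expR lm by rewrite lnK.
rewrite gt0_powRE ?expR_gt0// expRK expr2 -!expRD ler_expR.
have -> : \sum_(i <- iota 0 k) - n%:R^-1 = - (k%:R / n%:R) :> R.
  by rewrite sum_const_seq size_iota mulrN.
have kn1 : k%:R / n%:R <= 1 :> R by rewrite ler_pdivrMr// mul1r ler_nat ltnW.
have := sum_logcoth_points k; rewrite -(big_mkord xpredT (fun i => logcoth (expR (- ((y k - y i) / gam))))) /index_iota subn0.
have -> : (2 * alpha - p) * (- (L - y k) / gam) = - (2 * L) + 2 * y k.
  rewrite (_ : 2 * alpha - p = 2 * gam); last by rewrite /p /gam; field.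
  by field; rewrite gt_eqF.
set S := \sum_(i <- _) _.
lra.
Qed.

End points.

Lemma small_ball_prob_le (eps : R) (n : nat) : 0 < eps -> (0 < n)%N ->
  pi * Num.sqrt gam * Num.sqrt n%:R <= - ln eps ->
  (P (small_ball X eps) <=
   (expR (- (pi * Num.sqrt gam / 3 * (n%:R * Num.sqrt n%:R)) +
      n%:R / 2 * (2 + ln n%:R - ln (Num.min 1 p))))%:E)%E.
Proof.
move=> eps0 n0 nL; set L := - ln eps in nL.
have nr : (0 : R) < n%:R by rewrite ltr0n.
have eL : eps^-1 = expR L by rewrite /L expRN lnK.
pose y (k : nat) : R := pi * Num.sqrt gam * Num.sqrt k.+1%:R.
pose tm (k : nat) : R := expR (- (L - y k) / gam).
pose es := [seq [:: (expR L, tm i)] | i <- iota 0 n].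
have ses : size es = n by rewrite size_map size_iota.
(* The hypothesis [nL] says that [y k <= L] up to the last node, so that all times lie in
   [[0, 1]]. *)
have tm1 k : (k < n)%N -> 0 <= tm k <= 1.
  move=> kn; rewrite expR_ge0/= -expR0 ler_expR mulNr oppr_le0 divr_ge0 ?(ltW gam_gt0)//.
  rewrite subr_ge0 (le_trans _ nL)// ler_wpM2l ?mulr_ge0 ?pi_ge0 ?sqrtr_ge0//.
  by rewrite ler_wsqrtr// ler_nat.
pose W w : R := \prod_(e <- es) expR (- (lincomb X e w) ^+ 2 / 2).
have mW : measurable_fun setT W.
  apply: measurable_prod => e _; apply: measurableT_comp => //.
  apply: measurable_funM => //; apply: measurableT_comp => //; apply: measurable_funX.
  exact: measurable_lincomb.
have W0 w : 0 <= W w by apply: prodr_ge0 => e _; rewrite expR_ge0.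
have W1 w : W w <= 1.
  have <- : \prod_(e <- es) (1 : R) = 1 by rewrite big1_eq.
  apply: ler_prod => e _.
  by rewrite expR_ge0/= -expR0 ler_expR mulNr oppr_le0 divr_ge0 ?sqr_ge0.
have iW : P.-integrable setT (EFin \o W).
  by apply: (@bounded_integrable _ _ _ _ _ 1) => // w; rewrite ger0_norm.
(* Exponential Markov inequality: on the small ball each of the [n] functionals is at most [1] in
   absolute value, so each [expR (1 / 2)] compensates its factor of [W]. *)
have step1 : (P (small_ball X eps) <= (\int[P]_w (expR (n%:R / 2) * W w))%:E)%E.
  apply: Rintegral_prob_le.
  - exact: (measurable_small_ball isX).
  - by have := integrableZl measurableT (expR (n%:R / 2)) iW; apply: eq_integrable.
  - by move=> w; rewrite mulr_ge0// expR_ge0.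
  - move=> w /small_ballP hw.
    have -> : expR (n%:R / 2) * W w = \prod_(e <- es) (expR (2^-1) * expR (- (lincomb X e w) ^+ 2 / 2)).
      rewrite /W big_split/=; congr (_ * _); rewrite prod_expR; congr expR.
      by rewrite sum_const_seq ses.
    rewrite /es big_map big_seq; elim/big_rec: _ => // k x; rewrite mem_iota add0n => /andP[_ kn] x1.
    apply: mulr_ege1 x1; rewrite /lincomb big_seq1/= -expRD; apply: (le_trans _ (expR_ge1Dx _)); rewrite lerDl.
    rewrite [`|tm k|]ger0_norm ?expR_ge0// -eL.
    have := hw (tm k) (tm1 _ kn) => hX.
    have : (eps^-1 * X (tm k) w) ^+ 2 <= 1.
      rewrite -[leLHS]real_normK ?num_real// normrM gtr0_norm ?invr_gt0//.
      by rewrite expr_le1// ?mulr_ge0 ?invr_ge0 ?(ltW eps0)// mulrC ler_pdivrMr// mul1r.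
    lra.
apply: (le_trans step1); rewrite lee_fin RintegralZl//.
have step2 : \int[P]_w W w <= \prod_(k < n) (Num.sqrt (expR (y k + ln (Num.min 1 p / n%:R) - 1)))^-1.
  have := @weighted_gaussian_le _ _ _ P _ (@lincomb_add R) (lincomb X) (measurable_lincomb X) (lincombE X)
    [::] es (fun k => expR (y k + ln (Num.min 1 p / n%:R) - 1)) (cst 1) 1 (covform alpha beta)
    (covform_like adm isX) (lincomb_charfun adm isX) ler01.
  rewrite ses mul1r => h; apply: le_trans (h _ _).
  - by under [leRHS]eq_Rintegral do rewrite mul1r.
  - by move=> k _; exact: expR_gt0.
  - move=> k v kn; rewrite (nth_map 0%N) ?size_iota// nth_iota// add0n -map_take take_iota.
    rewrite (minn_idPl (ltnW kn)) => /in_span_singletons[r -> rE].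
    exact: covform_points_ge.
apply: (@le_trans _ _ (expR (n%:R / 2) * \prod_(k < n) expR (- (y k / 2) + (1 + ln n%:R - ln (Num.min 1 p)) / 2))).
  rewrite ler_wpM2l ?expR_ge0//; apply: (le_trans step2).
  rewrite le_eqVlt; apply/orP; left; apply/eqP; apply: eq_bigr => k _.
  rewrite sqrt_expR -expRN; congr expR.
  by rewrite ln_div ?posrE ?lt_min ?ltr01//; field.
rewrite prod_expR -expRD ler_expR big_split/= sumr_const card_ord sumrN -mulr_suml -(mulr_natl ((1 + _ - _) / 2)).
have := @sum_sqrt_ge R n; rewrite /y -mulr_sumr.
have c0 : 0 <= pi * Num.sqrt gam by rewrite mulr_ge0 ?pi_ge0 ?sqrtr_ge0.
move=> /(ler_wpM2l c0); set S := \sum_(k < n) _.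
move: (pi * Num.sqrt gam) (n%:R * Num.sqrt n%:R) c0 => c N c0; lra.
Qed.

End small_ball_upper.

(** * From probability bounds to the asymptotic relation *)

Lemma near_lnN_ge (R : realType) (L0 : R) :
  \forall x \near (0 : R)^'+, 0 < x /\ L0 <= - ln x.
Proof.
near=> x.
have x0 : 0 < x by near: x; exact: nbhs_right_gt.
split => //; rewrite lerNr -ler_expR lnK// ltW//.
by near: x; apply: nbhs_right_lt; exact: expR_gt0.
Unshelve. all: by end_near. Qed.

Lemma ereal_div_le (R : realType) (a b : R) (y : \bar R) : 0 <= a -> 0 < b ->
  (b%:E <= y)%E -> (a%:E / y <= (a / b)%:E)%E.
Proof.
move=> a0 b0; case: y => [r||]//.
- rewrite lee_fin => br; have r0 := lt_le_trans b0 br.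
  by rewrite inver gt_eqF// -EFinM lee_fin ler_wpM2l// lef_pV2.
- by rewrite invey mule0 lee_fin divr_ge0// ltW.
Qed.

Lemma neg_log_ge (R : realType) (p : \bar R) (b : R) : (0 <= p)%E ->
  (p <= (expR (- b))%:E)%E -> (b%:E <= - lne p)%E.
Proof.
case: p => [r||]//; rewrite !lee_fin => r0 rb; last first.
rewrite leeNr -EFinN; have [->|] := eqVneq r 0; first by rewrite le0_lneNy// leNye.
move=> rn; have {}r0 : 0 < r by rewrite lt_neqAle eq_sym rn.
by rewrite lne_EFin// lee_fin -ler_expR lnK.
Qed.

(* With [s ^+ 4] nodes, the error terms are of order [s ^+ 5]. *)
Lemma main_term_dominates (R : realType) (G C e s : R) : 0 < G -> 0 < e -> 0 <= C -> 1 <= s ->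
  7 * G / 3 + (1 + e) * (C / 2 + 2) <= e * G / 3 * s ->
  G / 3 * (s ^+ 2 + 1) ^+ 3 <= (1 + e) * (G / 3 * s ^+ 6 - s ^+ 4 / 2 * (C + 4 * s)).
Proof.
move=> G0 e0 C0 s1 h.
have s0 : 0 < s by lra.
have := ler_wpM2r (exprn_ge0 5 (ltW s0)) h.
have s4 : s ^+ 4 <= s ^+ 5 by rewrite [leRHS]exprS ler_peMl ?exprn_ge0 ?(ltW s0).
have s2 : s ^+ 2 <= s ^+ 5 by rewrite -[leLHS]mulr1 (exprD s 2 3) ler_wpM2l ?exprn_ge0 ?(ltW s0)//; apply: exprn_ege1.
have s05 : 1 <= s ^+ 5 by exact: exprn_ege1.
have e1 := ler_wpM2l C0 s4.
have e2 := ler_wpM2l (mulr_ge0 (ltW e0) C0) s4.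
have e3 := ler_wpM2l (ltW G0) s4.
have e4 := ler_wpM2l (ltW G0) s2.
have e5 := ler_wpM2l (ltW G0) s05.
move: e1 e2 e3 e4 e5.
have -> : (s ^+ 2 + 1) ^+ 3 = s ^+ 6 + 3 * s ^+ 4 + 3 * s ^+ 2 + 1 by ring.
have -> : s ^+ 4 / 2 * (C + 4 * s) = C * s ^+ 4 / 2 + 2 * s ^+ 5 by field.
have -> : e * G / 3 * s * s ^+ 5 = e * G * s ^+ 6 / 3 by field.
move: (s ^+ 6) (s ^+ 5) (s ^+ 4) (s ^+ 2) => x6 x5 x4 x2; lra.
Qed.

(** With [G = pi * sqrt gam], the largest number of nodes allowed by [small_ball_prob_le] is about
    [L ^ 2 / G ^ 2], and the main term [G / 3 * n ^ (3 / 2)] is then about [L ^ 3 / (3 * G ^ 2)],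
    where [1 / (3 * G ^ 2)] is the value of [kappa]. *)
Lemma small_ball_first_bound (R : realType) (alpha beta : R)
    d (T : measurableType d) (P : probability T R) (X : R -> {RV P >-> R}) :
  admissible alpha beta -> is_X alpha beta X ->
  lesssim0 (fun eps => (kappa (alpha - 2^-1) beta * `|ln eps| ^+ 3)%:E) (neg_log_small_ball X).
Proof.
move=> adm isX; apply: lesssim0_le => e e0.
set gam := alpha - beta - 2^-1; set p := 2 * beta + 1.
have gam0 : 0 < gam by case: adm => h1 h2; rewrite /gam; lra.
have p0 : 0 < p by case: adm => h1 h2; rewrite /p; lra.
have pi0 := pi_gt0 R.
move GE : (pi * Num.sqrt gam) => G.
have G0 : 0 < G by rewrite -GE mulr_gt0// sqrtr_gt0.
have G2 : G ^+ 2 = gam * pi ^+ 2 by rewrite -GE exprMn sqr_sqrtr ?(ltW gam0)// mulrC.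
pose c := ln (Num.min 1 p).
have c0 : c <= 0 by rewrite ln_le0 ?ge_min ?lexx.
pose C := 2 - c; have C0 : 0 <= C by rewrite /C; lra.
(* The threshold for [s = n ^ (1 / 4)] in [main_term_dominates]. *)
pose S0 := Num.max 1 ((7 * G / 3 + (1 + e) * (C / 2 + 2)) / (e * G / 3)).
have S01 : 1 <= S0 by rewrite le_max lexx.
(* The added [1] makes up for the truncation in [n], so that [S0 ^ 4 <= n] still follows. *)
pose L0 := G * (S0 ^+ 4 + 1).
have := near_lnN_ge L0; apply: filterS => x [x0 xL].
set L := - ln x in xL.
have L0_gt0 : 0 < L0 by rewrite mulr_gt0// addr_gt0// exprn_gt0// (lt_le_trans ltr01).
have Lgt0 : 0 < L by exact: lt_le_trans xL.
pose n := Num.truncn (L ^+ 2 / G ^+ 2).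
have /andP[nL Ln] : n%:R <= L ^+ 2 / G ^+ 2 < n.+1%:R.
  by apply: truncn_itv; rewrite divr_ge0 ?sqr_ge0.
have nS : S0 ^+ 4 <= n%:R.
  have h1 : S0 ^+ 4 + 1 <= L / G by rewrite ler_pdivlMr// mulrC.
  have h2 : 1 <= S0 ^+ 4 by apply: exprn_ege1.
  have h3 : S0 ^+ 4 + 1 <= (L / G) ^+ 2.
    by apply: (le_trans h1); rewrite expr2 ler_peMl// ?divr_ge0 ?(ltW G0) ?(ltW Lgt0)//; lra.
  move: Ln; rewrite -natr1 -exprVn -exprMn; lra.
have n_gt0 : (0 < n)%N.
  by rewrite -(ltr_nat R) (lt_le_trans _ nS)// exprn_gt0// (lt_le_trans ltr01).
pose M := Num.sqrt n%:R : R; pose s := Num.sqrt M.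
have M2 : M ^+ 2 = n%:R by rewrite sqr_sqrtr.
have M0 : 0 < M by rewrite sqrtr_gt0 ltr0n.
have s2 : s ^+ 2 = M by rewrite sqr_sqrtr// ltW.
have s0 : 0 < s by rewrite sqrtr_gt0.
have s4 : s ^+ 4 = n%:R by rewrite -M2 -s2 -exprM.
have sS : S0 <= s by rewrite -(@ler_pXn2r _ 4)// ?nnegrE ?(ltW s0) ?s4// (le_trans ler01).
have LM : L <= G * (M + 1).
  rewrite -(@ler_pXn2r _ 2)// ?nnegrE ?(ltW Lgt0) ?mulr_ge0 ?addr_ge0 ?(ltW G0) ?(ltW M0)//.
  rewrite exprMn mulrC -ler_pdivrMr ?exprn_gt0// (le_trans (ltW Ln))// -natr1 -M2.
  by rewrite sqrrD1 lerD2r lerDl pmulrn_lge0// ltW.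
have GL : G * M <= L.
  rewrite -(@ler_pXn2r _ 2)// ?nnegrE ?(ltW Lgt0) ?mulr_ge0 ?(ltW G0) ?(ltW M0)//.
  by rewrite exprMn M2 mulrC -ler_pdivlMr ?exprn_gt0.
have lnn : ln n%:R <= 4 * s.
  rewrite -s4 lnXn// -[ln s *+ 4]mulr_natl ler_wpM2l//.
  by rewrite -ler_expR lnK// (le_trans _ (expR_ge1Dx s))// lerDr.
have := small_ball_prob_le adm isX x0 n_gt0; rewrite -/gam GE => /(_ GL).
rewrite -/p -/M.
set B := _ - _; set E := (X in expR X).
have main : G / 3 * (s ^+ 2 + 1) ^+ 3 <= (1 + e) * (G / 3 * s ^+ 6 - s ^+ 4 / 2 * (C + 4 * s)).
  apply: main_term_dominates => //; first exact: le_trans sS.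
  rewrite [leRHS]mulrC -ler_pdivrMr ?divr_gt0 ?mulr_gt0//.
  by apply: le_trans sS; rewrite le_max lexx orbT.
have Elow : G / 3 * s ^+ 6 - s ^+ 4 / 2 * (C + 4 * s) <= - E.
  rewrite /E (_ : s ^+ 6 = n%:R * M); last by rewrite -s4 -s2 -exprD.
  rewrite s4 opprD opprK lerD2l lerN2 ler_wpM2l ?divr_ge0//.
  rewrite /B /C -/c; lra.
have kE : kappa (alpha - 2^-1) beta * `|ln x| ^+ 3 <= G / 3 * (s ^+ 2 + 1) ^+ 3.
  rewrite -normrN -/L gtr0_norm// s2 /kappa.
  rewrite (_ : 3 * _ * _ = 3 * G ^+ 2); last by rewrite G2 /gam; ring.
  apply: (@le_trans _ _ ((3 * G ^+ 2)^-1 * (G * (M + 1)) ^+ 3)).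
    rewrite ler_wpM2l ?invr_ge0 ?mulr_ge0 ?sqr_ge0 ?(ltW G0)//.
    by rewrite ler_pXn2r// ?nnegrE ?(ltW Lgt0)// mulr_ge0 ?addr_ge0 ?(ltW G0) ?(ltW M0).
  by rewrite le_eqVlt; apply/orP; left; apply/eqP; field; rewrite gt_eqF.
have k0 : 0 < kappa (alpha - 2^-1) beta * `|ln x| ^+ 3.
  rewrite mulr_gt0//; last by rewrite exprn_gt0// -normrN gtr0_norm.
  rewrite invr_gt0 !mulr_gt0 ?exprn_gt0// (_ : _ - _ = gam) ?gam0// /gam; ring.
have E0 : 0 < - E.
  have : 0 < (1 + e) * - E.
    apply: (lt_le_trans k0); apply: (le_trans kE); apply: (le_trans main).
    by rewrite ler_wpM2l//; lra.
  by rewrite pmulr_rgt0//; lra.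
move=> PE.
apply: (@le_trans _ _ ((kappa (alpha - 2^-1) beta * `|ln x| ^+ 3) / (- E))%:E).
  apply: ereal_div_le => //; first exact: ltW.
  by apply: neg_log_ge => //; rewrite opprK.
rewrite lee_fin ler_pdivrMr//; apply: (le_trans kE); apply: (le_trans main).
by rewrite ler_wpM2l//; lra.
Qed.

(** * Families of functionals controlling the process *)

(* Greedy pivoting: each elimination step at most doubles the sum of the
   absolute values of the interpolation coefficients. *)
Lemma bounded_interpolation (R : realType) (I : eqType) (s : seq I) (m : nat) (g : nat -> I -> R) :
  exists J : seq I, [/\ (size J <= m)%N, {subset J <= s} &
    forall x, x \in s -> exists l : seq (R * I),
      [/\ forall z, z \in l -> z.2 \in J, \sum_(z <- l) `|z.1| + 1 <= 2 ^+ m &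
          forall k, (k < m)%N -> \sum_(z <- l) z.1 * g k z.2 = g k x]].
Proof.
elim: m g => [|m IH] g.
  by exists [::]; split => // x _; exists [::]; split => //; rewrite big_nil add0r expr0.
have [[x0 x0s [gx0 x0max]]|g0] : (exists2 x0, x0 \in s & g m x0 != 0 /\
    forall x, x \in s -> `|g m x| <= `|g m x0|) \/ forall x, x \in s -> g m x = 0.
  elim: s {IH} => [|x s IHs]; first by right.
  have [[x0 x0s [gx0 h]]|h] := IHs.
    have [xx0|xx0] := leP `|g m x| `|g m x0|.
      left; exists x0; first by rewrite inE x0s orbT.
      by split => // y; rewrite inE => /predU1P[->//|]; exact: h.
    left; exists x; first exact: mem_head.
    split; first by rewrite -normr_gt0 (le_lt_trans _ xx0).
    by move=> y; rewrite inE => /predU1P[->//|/h/le_trans]; apply; exact: ltW.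
  have [gx|gx] := eqVneq (g m x) 0.
    by right => y; rewrite inE => /predU1P[->//|]; exact: h.
  left; exists x; first exact: mem_head.
  by split => // y; rewrite inE => /predU1P[->//|/h ->]; rewrite normr0.
- pose la x := g m x / g m x0.
  have la1 x : x \in s -> `|la x| <= 1.
    by move=> xs; rewrite normf_div ler_pdivrMr ?normr_gt0// mul1r; exact: x0max.
  have [J [sJ Js HJ]] := IH (fun k x => g k x - la x * g k x0).
  exists (x0 :: J); split => //.
    by move=> y; rewrite inE => /predU1P[->//|]; exact: Js.
  move=> x xs; have [l [lJ lS lE]] := HJ x xs.
  (* This coefficient of the pivot makes function [m] exact; for [k < m] it turns interpolation of
     the reduced function [g k - la * g k x0] into interpolation of [g k]. *)
  exists ((la x - \sum_(z <- l) z.1 * la z.2, x0) :: l); split.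
  + by move=> z; rewrite !in_cons => /predU1P[->|/lJ ->]; rewrite ?eqxx ?orbT.
  + rewrite big_cons/= exprS.
    have h1 : `|la x - \sum_(z <- l) z.1 * la z.2| <= 1 + \sum_(z <- l) `|z.1|.
      apply: (le_trans (ler_normB _ _)); apply: lerD; first exact: la1.
      apply: (le_trans (ler_norm_sum _ _ _)); rewrite big_seq [leRHS]big_seq.
      apply: ler_sum => z zl; rewrite normrM ler_piMr// la1//.
      by apply: Js; exact: lJ.
    lra.
  + move=> k; rewrite ltnS leq_eqVlt big_cons/= mulrBl => /predU1P[->|km].
      rewrite /la [X in _ - X + _](_ : _ = \sum_(z <- l) z.1 * g m z.2); last first.
        by rewrite mulr_suml; apply: eq_bigr => z _; rewrite -mulrA divfK.
      by rewrite divfK// subrK.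
    have := lE k km; rewrite (_ : \sum_(z <- l) z.1 * (_ - _) =
        \sum_(z <- l) z.1 * g k z.2 - (\sum_(z <- l) z.1 * la z.2) * g k x0).
      move=> /eqP; rewrite subr_eq => /eqP ->; ring.
    by rewrite mulr_suml -sumrB; apply: eq_bigr => z _; ring.
- have [J [sJ Js HJ]] := IH g; exists J; split => //; first exact: leqW.
  move=> x xs; have [l [lJ lS lE]] := HJ x xs; exists l; split => //.
    by rewrite (le_trans lS)// exprS ler_peMl ?ler1n// exprn_ge0.
  move=> k; rewrite ltnS leq_eqVlt => /predU1P[->|]; last exact: lE.
  rewrite g0// big_seq big1// => z /lJ/Js zs; by rewrite g0 ?mulr0.
Qed.

(* With [m] vanishing moments, only the terms of degree at least [m] of the
   power series remain. *)
Lemma powerform_tail_le (R : realType) (p : R) (s : seq (R * R)) (y A : R) (m : nat) : 0 < p ->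
  0 <= y < 1 -> (forall x, x \in s -> 0 <= x.2 <= y) -> \sum_(x <- s) `|x.1| <= A ->
  (forall k, (k < m)%N -> moment k s = 0) ->
  powerform p s <= A ^+ 2 * y ^+ m * (1 - y) `^ (- p).
Proof.
move=> p0 /andP[y0 y1] hs hA hm.
have sd : in_disc s.
  by apply/allP => x /hs /andP[-> h]/=; exact: le_lt_trans y1.
apply: (ler_cvg_to (powerform_cvg p0 sd) (cvg_cst _)); apply: nearW => N /=.
have A0 : 0 <= A by apply: le_trans hA; apply: sumr_ge0.
apply: (@le_trans _ _ (A ^+ 2 * y ^+ m * binsum p N y)); last first.
  by rewrite ler_wpM2l ?mulr_ge0 ?exprn_ge0//; apply: binsum_le; rewrite ?y0.
rewrite /binsum mulr_sumr; apply: ler_sum => l _.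
have [lm|ml] := ltnP l m.
  by rewrite hm// expr0n mulr0 !mulr_ge0 ?exprn_ge0 ?bincoef_ge0.
have ml2 : `|moment l s| <= A * y ^+ l.
  apply: (le_trans (ler_norm_sum _ _ _)); apply: le_trans (ler_wpM2r _ hA); last exact: exprn_ge0.
  rewrite mulr_suml big_seq [leRHS]big_seq; apply: ler_sum => x /hs /andP[x0 xy].
  by rewrite normrM ler_wpM2l// ger0_norm ?exprn_ge0// lerXn2r ?nnegrE.
have : moment l s ^+ 2 <= A ^+ 2 * y ^+ m * y ^+ l.
  rewrite -[leLHS]real_normK ?num_real//; apply: (@le_trans _ _ ((A * y ^+ l) ^+ 2)).
    by rewrite lerXn2r ?nnegrE ?mulr_ge0 ?exprn_ge0.
  rewrite exprMn -mulrA ler_wpM2l ?sqr_ge0// [leLHS]expr2 ler_wpM2r ?exprn_ge0//.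
  by apply: ler_wiXn2l => //; exact: ltW.
by move=> /(ler_wpM2l (bincoef_ge0 l p0)) h; apply: (le_trans h); rewrite mulrCA.
Qed.

Section control.
Context d (T : measurableType d) (R : realType) (P : probability T R).
Variables (alpha beta : R) (X : R -> {RV P >-> R}) (mu : R).
Hypothesis adm : admissible alpha beta.
Hypothesis isX : is_X alpha beta X.
Hypothesis mu_ge0 : 0 <= mu.

Let q (e : seq (R * R)) := covform alpha beta e e.
Let q_ge0 e : 0 <= q e. Proof. by have [_ _ h] := covform_like adm isX; exact: h. Qed.

(* If [A] is implied by [`|Z e| <= 1] for all [e] of a finite family, then
   [P A >= E (exp (- mu * \sum_e (Z e) ^ 2)) - exp (- mu)]; the cost [c] bounds
   minus the logarithm of that expectation. *)
Definition controlled (c : R) (A : set T) : Prop :=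
  exists2 es : seq (seq (R * R)), \sum_(e <- es) ln (1 + 2 * mu * q e) / 2 <= c &
    forall w, (forall e, e \in es -> `|lincomb X e w| <= 1) -> A w.

Lemma controlled_weaken c c' (A A' : set T) : c <= c' -> A `<=` A' ->
  controlled c A -> controlled c' A'.
Proof.
by move=> cc AA [es h1 h2]; exists es => [|w /h2 /AA//]; exact: le_trans cc.
Qed.

Lemma controlled_and c c' A A' : controlled c A -> controlled c' A' ->
  controlled (c + c') (A `&` A').
Proof.
move=> [es h1 h2] [es' h1' h2']; exists (es ++ es').
  by rewrite big_cat lerD.
by move=> w h; split; [apply: h2|apply: h2'] => e he; apply: h; rewrite mem_cat he ?orbT.
Qed.

Lemma controlled_seq (I : eqType) (s : seq I) (c : I -> R) (A : I -> set T) :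
  (forall i, i \in s -> controlled (c i) (A i)) ->
  controlled (\sum_(i <- s) c i) [set w | forall i, i \in s -> A i w].
Proof.
elim: s => [_|i s IH h]; first by exists [::] => //; rewrite !big_nil.
have /(controlled_and (h _ (mem_head _ _))) := IH (fun j js => h j (mem_behead (s := i :: s) js)).
rewrite big_cons; apply: controlled_weaken => // w [/= Ai As] j.
by rewrite inE => /predU1P[->//|]; exact: As.
Qed.

Lemma lincomb_scale a e w : lincomb X [seq (a * x.1, x.2) | x <- e] w = a * lincomb X e w.
Proof. by rewrite /lincomb big_map mulr_sumr; apply: eq_bigr => x _; rewrite mulrA. Qed.

Lemma covform_scale a e : q [seq (a * x.1, x.2) | x <- e] = a ^+ 2 * q e.
Proof.
rewrite /q /covform big_map mulr_sumr; apply: eq_bigr => x _.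
by rewrite big_map mulr_sumr; apply: eq_bigr => y _ /=; ring.
Qed.

Lemma controlled_abs (e : seq (R * R)) (v th : R) : 0 < th -> q e <= v ->
  controlled (ln (1 + 2 * mu * (v / th ^+ 2)) / 2) [set w | `|lincomb X e w| <= th].
Proof.
move=> th0 qv; exists [:: [seq (th^-1 * x.1, x.2) | x <- e]].
  rewrite big_seq1 covform_scale ler_wpM2r ?invr_ge0//.
  have h x : 0 <= x -> 0 < 1 + 2 * mu * x.
    by move=> x0; rewrite ltr_pwDl// mulr_ge0// mulr_ge0.
  have t2 : 0 <= (th^-1) ^+ 2 by exact: sqr_ge0.
  have qv' : th^-1 ^+ 2 * q e <= v / th ^+ 2 by rewrite exprVn mulrC ler_wpM2r// -exprVn.
  have q0 := mulr_ge0 t2 (q_ge0 e).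
  by rewrite ler_ln ?posrE ?h// ?(le_trans q0)// lerD2l ler_wpM2l// mulr_ge0.
move=> w /(_ _ (mem_head _ _)); rewrite lincomb_scale normrM gtr0_norm ?invr_gt0//.
by rewrite ler_pdivrMl// mulr1.
Qed.

(** From [ln (1 + x) <= x]. This linear cost is meant for numerous functionals of tiny variance,
    whose costs have a small sum. *)
Lemma controlled_abs_small (e : seq (R * R)) (v th : R) : 0 < th -> q e <= v ->
  controlled (mu * (v / th ^+ 2)) [set w | `|lincomb X e w| <= th].
Proof.
move=> th0 qv; have v0 : 0 <= v := le_trans (q_ge0 e) qv.
apply: controlled_weaken (controlled_abs th0 qv) => //.
rewrite ler_pdivrMr// (le_trans (le_ln1Dx _))//.
  by rewrite (lt_le_trans (ltrN10 _))// !mulr_ge0// invr_ge0 sqr_ge0.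
by rewrite -mulrA mulrC.
Qed.

Lemma controlled_prob c A : measurable A -> controlled c A ->
  ((expR (- c) - expR (- mu))%:E <= P A)%E.
Proof.
move=> mA [es hc hA].
(* The scaling turns the weights [expR (- z ^ 2 / 2)] of the elimination into
   [expR (- mu * z ^ 2)]. *)
pose es' := [seq [seq (Num.sqrt (2 * mu) * x.1, x.2) | x <- e] | e <- es].
pose W w := \prod_(e <- es') expR (- (lincomb X e w) ^+ 2 / 2).
have WE w : W w = expR (- (mu * \sum_(e <- es) (lincomb X e w) ^+ 2)).
  rewrite /W big_map prod_expR; congr expR; rewrite mulr_sumr -sumrN.
  apply: eq_bigr => e _; rewrite lincomb_scale exprMn sqr_sqrtr ?mulr_ge0//.
  by field.
have mW : measurable_fun setT W.
  apply: measurable_prod => e _; apply: measurableT_comp => //.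
  apply: measurable_funM => //; apply: measurableT_comp => //; apply: measurable_funX.
  exact: measurable_lincomb.
have W0 w : 0 <= W w by rewrite WE expR_ge0.
have S0 w : 0 <= \sum_(e <- es) (lincomb X e w) ^+ 2 by apply: sumr_ge0 => e _; exact: sqr_ge0.
have W1 w : W w <= 1 by rewrite WE expR_le1 oppr_le0 mulr_ge0.
have iW : P.-integrable setT (EFin \o W).
  by apply: (@bounded_integrable _ _ _ _ _ 1) => // w; rewrite ger0_norm.
apply: (@le_trans _ _ (\int[P]_w W w - expR (- mu))%:E).
  rewrite lee_fin lerD2r.
  have := @weighted_gaussian_ge _ _ _ P _ (@lincomb_add R) (lincomb X) (measurable_lincomb X) (lincombE X)
    [::] es' (cst 1) 1 (covform alpha beta)
    (covform_like adm isX) (lincomb_charfun adm isX) ler01.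
  rewrite mul1r => h; have {}h : \prod_(e <- es') (Num.sqrt (1 + covform alpha beta e e))^-1 <= \int[P]_w W w.
    apply: (le_trans h); rewrite le_eqVlt; apply/orP; left; apply/eqP.
    by apply: eq_Rintegral => w _; rewrite mul1r.
  apply: le_trans h; rewrite big_map.
  have -> : \prod_(e <- es) (Num.sqrt (1 + q [seq (Num.sqrt (2 * mu) * x.1, x.2) | x <- e]))^-1 =
     expR (- \sum_(e <- es) ln (1 + 2 * mu * q e) / 2).
    rewrite -sumrN -prod_expR; apply: eq_bigr => e _.
    rewrite covform_scale sqr_sqrtr ?mulr_ge0//.
    have h0 : 0 < 1 + 2 * mu * q e by rewrite ltr_pwDl// mulr_ge0 ?mulr_ge0.
    by rewrite -[in LHS](lnK h0) sqrt_expR expRN.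
  by rewrite ler_expR lerN2.
apply: Rintegral_prob_ge => //.
move=> w nA; rewrite WE ler_expR lerN2 ler_peMr//.
have [//|S1] := leP 1 (\sum_(e <- es) (lincomb X e w) ^+ 2).
exfalso; apply: nA; apply: hA => e he.
rewrite -(@ler_pXn2r _ 2)// ?nnegrE// expr1n real_normK ?num_real//.
apply: le_trans (ltW S1); rewrite (big_rem e)//= lerDl.
by apply: sumr_ge0 => e' _; exact: sqr_ge0.
Qed.

End control.

(** * Interpolation in a geometric block of times *)

Section blocks.
Variables (R : realType) (alpha beta : R).
Hypothesis adm : admissible alpha beta.
Let p := 2 * beta + 1.
Let p_gt0 : 0 < p. Proof. by case: adm => h1 h2; rewrite /p; lra. Qed.
Let f := covfactor alpha beta.

Lemma covfactor_gt0 b t : 0 < b -> 0 < t -> 0 < f b t.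
Proof. by move=> b0 t0; rewrite !mulr_gt0 ?powR_gt0 ?addr_gt0 ?mulr_gt0. Qed.

Lemma cov_diag t : 0 < t -> cov alpha beta t t = t `^ (2 * alpha - p).
Proof.
move=> t0; rewrite (@cov_cayley _ alpha beta t 1 t t)// ?mulr1// subrr mul0r !mulr0 subr0.
by rewrite powR1 mulr1 -expr2 covfactor_diag.
Qed.

Lemma cov_diag_le1 t : 0 < t <= 1 -> cov alpha beta t t <= 1.
Proof.
move=> /andP[t0 t1]; rewrite cov_diag// powR_le1 ?t1 ?(ltW t0)//.
by case: adm => h1 h2; rewrite /p; lra.
Qed.

(** The square of the factor times [(1 - y ^ 2) ^ - p >= 1] is the variance of [X t], at most [1].
    Hence bounds on [X t / f b t] pass to [X t]. *)
Lemma covfactor_le1 b t : 0 < b <= t -> t <= 1 -> f b t <= 1.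
Proof.
move=> /andP[b0 bt] t1; have t0 : 0 < t := lt_le_trans b0 bt.
have f0 := covfactor_gt0 b0 t0.
rewrite -(@ler_pXn2r _ 2)// ?nnegrE ?(ltW f0)// expr1n.
have t01 : 0 < t <= 1 by rewrite t0.
apply: le_trans (cov_diag_le1 t01).
rewrite (@cov_cayley _ alpha beta b 1 t t)// ?mulr1// !mul1r -expr2 -expr2.
rewrite ler_peMr ?sqr_ge0// -/p.
set y := (t - b) / (t + b).
have y0 : 0 <= y by rewrite divr_ge0 ?subr_ge0 ?addr_ge0 ?(ltW b0) ?(ltW t0).
have y1 : y < 1 by rewrite ltr_pdivrMr ?addr_gt0//; lra.
have h : 0 < 1 - y ^+ 2 <= 1 by rewrite subr_gt0 expr_lt1//= lerBlDr lerDl sqr_ge0 y1.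
case/andP: h => h0 h1.
by rewrite powRN -[leLHS]invr1 lef_pV2 ?posrE ?powR_gt0// powR_le1 ?(ltW h0)// ltW.
Qed.

(** Dividing [X t] by its factor leaves the pure kernel [(1 - y z) ^ - p], to which moment bounds
    apply. *)
Definition normalized b (s : seq (R * R)) := [seq (x.1 / f b x.2, x.2) | x <- s].

Lemma covform_normalized (b : R) (s : seq (R * R)) : 0 < b -> (forall x, x \in s -> 0 < x.2) ->
  covform alpha beta (normalized b s) (normalized b s) =
  powerform p [seq (x.1, (x.2 - b) / (x.2 + b)) | x <- s].
Proof.
move=> b0 hs; rewrite (@covform_powerform _ _ _ b 1)// ?mulr1//; last first.
  by move=> x /mapP[z zs ->] /=; exact: hs.
rewrite -map_comp; congr powerform; apply/eq_in_map => x xs /=.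
by rewrite mul1r divfK// gt_eqF// covfactor_gt0// hs.
Qed.

Context d (T : measurableType d) (P : probability T R).
Variables (X : R -> {RV P >-> R}) (mu : R).
Hypothesis isX : is_X alpha beta X.
Hypothesis mu_ge0 : 0 <= mu.

(** Interpolating the powers [y ^ k], [k < m], cancels the first [m] moments, so an interpolation
    error has variance at most [4 ^ m * y0 ^ m * D]. The coefficients add up to less than [2 ^ m]:
    nodes held below [eps / 2 ^ m] contribute at most [eps], and the error another [eps]. *)
Lemma controlled_block b (y0 eps : R) (m : nat) (pts : seq R) :
  let D := (1 - y0) `^ (- p) in
  0 < b -> 0 <= y0 < 1 -> 0 < eps ->
  (forall t, t \in pts -> [/\ b <= t, t <= 1 & (t - b) / (t + b) <= y0]) ->
  controlled alpha beta X mu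
    (m%:R * (ln (1 + 2 * mu * (D / (eps / 2 ^+ m) ^+ 2)) / 2) +
     (size pts)%:R * (mu * ((2 ^+ m) ^+ 2 * y0 ^+ m * D / eps ^+ 2)))
    [set w | forall t, t \in pts -> `|X t w| <= 2 * eps].
Proof.
move=> D b0 /andP[y00 y01] eps0 hp; pose y t := (t - b) / (t + b).
have ht t : t \in pts -> 0 < t by move=> /hp[bt _ _]; exact: lt_le_trans bt.
have yt t : t \in pts -> 0 <= y t <= y0.
  move=> tp; have [bt _ ->] := hp t tp; rewrite andbT.
  by rewrite divr_ge0 ?subr_ge0// addr_ge0 ?(ltW b0) ?(ltW (ht t tp)).
have [J [sJ Js HJ]] := bounded_interpolation pts m (fun k t => y t ^+ k).
have D0 : 0 < D by rewrite powR_gt0// subr_gt0.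
have th0 : 0 < eps / 2 ^+ m by rewrite divr_gt0 ?exprn_gt0.
pose e1 t := normalized b [:: (1, t)].
have c1 t : t \in J -> controlled alpha beta X mu
    (ln (1 + 2 * mu * (D / (eps / 2 ^+ m) ^+ 2)) / 2)
    [set w | `|lincomb X (e1 t) w| <= eps / 2 ^+ m].
  move=> /Js tp; apply: (controlled_abs adm isX mu_ge0) => //.
  rewrite covform_normalized//; last by move=> x; rewrite inE => /eqP ->; exact: ht.
  apply: (le_trans (@powerform_tail_le _ _ _ y0 1 0 p_gt0 _ _ _ _)) => //.
  - by rewrite y00.
  - by move=> x; rewrite inE => /eqP -> /=; exact: yt.
  - by rewrite big_seq1 normr1.
  - by rewrite expr1n expr0 !mul1r.
have c2 t : t \in pts -> controlled alpha beta X mu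
    (mu * ((2 ^+ m) ^+ 2 * y0 ^+ m * D / eps ^+ 2))
    [set w | (forall u, u \in J -> `|lincomb X (e1 u) w| <= eps / 2 ^+ m) -> `|X t w| <= 2 * eps].
  move=> tp; have [l [lJ lS lE]] := HJ t tp.
  pose s : seq (R * R) := (1, t) :: [seq (- z.1, z.2) | z <- l].
  have sp x : x \in s -> x.2 \in pts.
    by rewrite {1}/s in_cons => /predU1P[->|/mapP[z /lJ/Js zp ->]].
  have qs : covform alpha beta (normalized b s) (normalized b s) <= (2 ^+ m) ^+ 2 * y0 ^+ m * D.
    rewrite covform_normalized//; last by move=> x /sp/ht.
    apply: powerform_tail_le => //.
    - by rewrite y00.
    - by move=> x /mapP[z /sp zp ->]; exact: yt.
    - rewrite /= big_cons big_map big_map /= normr1.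
      by under eq_bigr do rewrite normrN; rewrite addrC.
    - move=> k km; rewrite /moment /= big_cons big_map big_map /= mul1r.
      by under eq_bigr do rewrite mulNr; rewrite sumrN lE// subrr.
  apply: controlled_weaken (controlled_abs_small adm isX mu_ge0 eps0 qs) => // w /= hw hJ.
  have f0 := covfactor_gt0 b0 (ht t tp).
  have [bt t1 _] := hp t tp.
  have f1 : f b t <= 1 by apply: covfactor_le1; rewrite ?b0.
  have lincomb1 u : u \in pts -> lincomb X (e1 u) w = X u w / f b u.
    by move=> /ht u0; rewrite /lincomb big_seq1/= gtr0_norm// mul1r mulrC.
  have E : lincomb X (normalized b s) w = X t w / f b t - \sum_(z <- l) z.1 * lincomb X (e1 z.2) w.
    rewrite /lincomb /s /= big_cons big_map big_map /= gtr0_norm ?ht// mul1r mulrC; congr (_ + _).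
    rewrite -sumrN; apply: eq_big_seq => z zl; rewrite /lincomb big_seq1/= mul1r; ring.
  have : `|X t w / f b t| <= 2 * eps.
    rewrite -[X in `|X|](subrK (\sum_(z <- l) z.1 * lincomb X (e1 z.2) w)) -E.
    rewrite (le_trans (ler_normD _ _))// (_ : 2 * eps = eps + eps); last by ring.
    apply: lerD => //; apply: (le_trans (ler_norm_sum _ _ _)).
    apply: (@le_trans _ _ ((\sum_(z <- l) `|z.1|) * (eps / 2 ^+ m))).
      rewrite mulr_suml big_seq [leRHS]big_seq; apply: ler_sum => z zl.
      by rewrite normrM ler_wpM2l// hJ// lJ.
    rewrite mulrA ler_pdivrMr ?exprn_gt0// mulrC ler_pM2l//; lra.
  rewrite normf_div (gtr0_norm f0) ler_pdivrMr// => /le_trans; apply.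
  by rewrite ler_piMr// mulr_ge0// ltW.
have := controlled_and (controlled_seq c1) (controlled_seq c2).
rewrite !sum_const_seq; apply: controlled_weaken.
  rewrite lerD2r ler_wpM2r ?ler_nat//.
  rewrite divr_ge0// ln_ge0// lerDl !mulr_ge0//; first exact: ltW.
  by rewrite invr_ge0 sqr_ge0.
by move=> w [/= h1 h2] t tp; exact: h2.
Qed.

End blocks.

(** * Variance of dyadic increments *)

Lemma expr_1Dx_le (R : realType) (n : nat) (x : R) : 0 <= x <= 1 ->
  (1 + x) ^+ n <= 1 + (2 ^+ n - 1) * x.
Proof.
move=> /andP[x0 x1]; elim: n => [|n IH]; first by rewrite !expr0 subrr mul0r addr0.
have h : 1 <= (2 : R) ^+ n by apply: exprn_ege1; rewrite ler1n.
rewrite exprSr; apply: (le_trans (ler_wpM2r (addr_ge0 ler01 x0) IH)).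
rewrite [2 ^+ n.+1]exprS; move: (2 ^+ n) h => a h.
have : 0 <= (a - 1) * x * (1 - x) by rewrite !mulr_ge0// subr_ge0.
lra.
Qed.

Lemma one_sub_expr_le (R : realType) (n : nat) (g : R) : 0 <= g <= 1 ->
  1 - g ^+ n <= n%:R * (1 - g).
Proof.
move=> /andP[g0 g1]; elim: n => [|n IH]; first by rewrite expr0 subrr mul0r.
rewrite exprS -natr1.
have h : g ^+ n <= 1 by exact: exprn_ile1.
have h2 : 0 <= g ^+ n by exact: exprn_ge0.
have n0 : (0 : R) <= n%:R by [].
move: (g ^+ n) (n%:R : R) IH h h2 n0 => a N IH h h2 n0; nra.
Qed.

Lemma sum_inv_sqrt3_le (R : realType) (n : nat) :
  \sum_(i < n) (Num.sqrt i.+1%:R ^+ 3)^-1 <= 3 :> R.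
Proof.
case: n => [|n]; first by rewrite big_ord0.
(* Comparison with the integral of [x ^ (- 3 / 2)], in a form that goes through by induction. *)
apply: (@le_trans _ _ (3 - 2 / Num.sqrt n.+1%:R)); last by rewrite gerBl divr_ge0 ?sqrtr_ge0.
elim: n => [|n IH].
  by rewrite big_ord1 sqrtr1 expr1n !divr1; lra.
rewrite big_ord_recr /=; apply: (le_trans (lerD IH (lexx _))).
have a2 : (Num.sqrt n.+2%:R : R) ^+ 2 = Num.sqrt n.+1%:R ^+ 2 + 1 by rewrite !sqr_sqrtr ?natr1.
have a0 : 0 < Num.sqrt n.+1%:R :> R by rewrite sqrtr_gt0 ltr0n.
have b0 : 0 < Num.sqrt n.+2%:R :> R by rewrite sqrtr_gt0 ltr0n.
move: (Num.sqrt n.+1%:R) (Num.sqrt n.+2%:R) a0 b0 a2 => a b a0 b0 ab.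
rewrite -addrA lerD2l -lerBrDl opprK addrC -subr_ge0.
have -> : 2 / a - 2 / b - (b ^+ 3)^-1 = (2 * b ^+ 2 * (b - a) - a) / (a * b ^+ 3).
  by field; rewrite !gt_eqF.
rewrite divr_ge0 ?mulr_ge0 ?exprn_ge0 ?(ltW a0) ?(ltW b0)//.
have h : a <= b by nra.
have : (b - a) * (b + a) = 1 by rewrite -subr_sqr ab; ring.
nra.
Qed.

Section increments.
Variables (R : realType) (alpha beta : R).
Hypothesis adm : admissible alpha beta.
Let p := 2 * beta + 1.
Let p_gt0 : 0 < p. Proof. by case: adm => h1 h2; rewrite /p; lra. Qed.
Let gam := alpha - beta - 2^-1.
Let gam_gt0 : 0 < gam. Proof. by case: adm => h1 h2; rewrite /gam; lra. Qed.

(** The base of the last power is the squared ratio of the geometric to the arithmetic mean of the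
    two times, [1 - (x / (2 + x)) ^ 2], hence flat to second order at [x = 0]. *)
Lemma cov_relative (s x : R) : 0 < s -> 0 <= x ->
  cov alpha beta (s * (1 + x)) s = s `^ (2 * gam) *
    ((1 + x) `^ gam * (4 * (1 + x) / (2 + x) ^+ 2) `^ (p / 2)).
Proof.
move=> s0 x0; have x1 : 0 < 1 + x by lra.
have x2 : 0 < 2 + x by lra.
have -> : cov alpha beta (s * (1 + x)) s =
    2 `^ p * ((s * s) * (1 + x)) `^ alpha * (s * (2 + x)) `^ (- p).
  by rewrite /cov -powRN -/p; congr (_ * _ `^ _ * _ `^ _); ring.
rewrite !gt0_powRE ?mulr_gt0 ?invr_gt0 ?exprn_gt0//.
rewrite !lnM ?posrE ?mulr_gt0 ?invr_gt0 ?exprn_gt0//.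
rewrite lnV ?posrE ?exprn_gt0// lnXn// -[ln (2 + x) *+ 2]mulr_natl.
have -> : ln 4 = 2 * ln 2 :> R.
  by rewrite (_ : 4 = 2 * 2) ?lnM ?posrE//; ring.
by rewrite -!expRD; congr expR; rewrite /gam /p; field.
Qed.

Definition increment (t s : R) : seq (R * R) := [:: (1, t); (- 1, s)].

Lemma covform_increment t s : 0 < t -> 0 < s ->
  covform alpha beta (increment t s) (increment t s) =
  cov alpha beta t t + cov alpha beta s s - 2 * cov alpha beta t s.
Proof.
move=> t0 s0; rewrite /covform /increment !big_cons !big_nil /= !gtr0_norm//.
have -> : cov alpha beta s t = cov alpha beta t s by rewrite /cov [s * t]mulrC [s + t]addrC.
by ring.
Qed.

(** By [cov_relative] the variance is [s ^ (2 * gam)] times [(U - 1) ^ 2 + 2 * U * (1 - G)], where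
    [U - 1] is of order [x] and [1 - G] of order [x ^ 2]. *)
Lemma covform_increment_le : exists2 C : R, 0 < C & forall s x, 0 < s -> 0 <= x <= 1 ->
  covform alpha beta (increment (s * (1 + x)) s) (increment (s * (1 + x)) s) <=
  C * s `^ (2 * gam) * x ^+ 2.
Proof.
(* An integer above [gam] and [p / 2], so that real powers can be compared with integer ones. *)
pose n := (Num.truncn (gam + p)).+1.
have [gn pn] : gam <= n%:R /\ p / 2 <= n%:R.
  have h : gam + p < n%:R.
    by have /andP[_] := truncn_itv (ltW (addr_gt0 gam_gt0 p_gt0)).
  split; apply: le_trans _ (ltW h); first by rewrite lerDl ltW.
  rewrite (le_trans (_ : p / 2 <= p))//; last by rewrite lerDr ltW.
  by rewrite ler_pdivrMr// ler_peMr ?ler1n// ltW.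
exists ((2 ^+ n) ^+ 2 + 2 * (1 + 2 ^+ n) * n%:R).
  rewrite ltr_pwDl ?exprn_gt0// !mulr_ge0// addr_ge0// exprn_ge0//.
move=> s x s0 /andP[x0 x1].
have x1' : 0 < 1 + x by lra.
have x2 : 0 < 2 + x by lra.
rewrite covform_increment ?mulr_gt0// cov_relative//.
have -> : cov alpha beta (s * (1 + x)) (s * (1 + x)) = s `^ (2 * gam) * ((1 + x) `^ gam) ^+ 2.
  rewrite cov_diag ?mulr_gt0// -/p (_ : 2 * alpha - p = 2 * gam); last by rewrite /p /gam; field.
  by rewrite !gt0_powRE ?mulr_gt0// lnM ?posrE// expr2 -!expRD; congr expR; ring.
have -> : cov alpha beta s s = s `^ (2 * gam).
  by rewrite cov_diag// -/p; congr (_ `^ _); rewrite /p /gam; field.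
set S := s `^ _; set U := (1 + x) `^ gam; set g := 4 * _ / _; set G := g `^ _.
have S0 : 0 <= S by exact: powR_ge0.
have gE : 1 - g = (x / (2 + x)) ^+ 2 by rewrite /g; field; rewrite gt_eqF.
have g0 : 0 < g by rewrite divr_gt0 ?mulr_gt0 ?exprn_gt0.
have g1 : g <= 1 by rewrite -subr_ge0 gE sqr_ge0.
have gx : 1 - g <= x ^+ 2.
  rewrite gE exprMn ler_piMr ?sqr_ge0// exprVn invf_le1 ?exprn_gt0//.
  by apply: exprn_ege1; lra.
have G1 : 1 - G <= n%:R * x ^+ 2.
  apply: (@le_trans _ _ (1 - g ^+ n)).
    rewrite lerD2l lerN2 -powR_mulrn ?(ltW g0)// /G !gt0_powRE// ler_expR.
    by rewrite ler_wnM2r// ln_le0.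
  apply: (le_trans (one_sub_expr_le _ _)); first by rewrite g1 ltW.
  by rewrite ler_wpM2l.
have U1 : 1 <= U by rewrite -(powRr0 (1 + x)) ler_powR ?(ltW gam_gt0)//; lra.
have U2 : U <= 1 + 2 ^+ n * x.
  apply: (@le_trans _ _ ((1 + x) ^+ n)).
    by rewrite -powR_mulrn ?(ltW x1')// ler_powR//; lra.
  apply: (le_trans (expr_1Dx_le _ _)); first by rewrite x0.
  by rewrite lerD2l ler_wpM2r// gerBl.
have -> : S * U ^+ 2 + S - 2 * (S * (U * G)) = S * ((U - 1) ^+ 2 + 2 * U * (1 - G)) by ring.
rewrite [leRHS](_ : _ = S * (((2 ^+ n) ^+ 2 + 2 * (1 + 2 ^+ n) * n%:R) * x ^+ 2)); last by ring.
rewrite ler_wpM2l// (mulrDl ((2 ^+ n) ^+ 2)); apply: lerD.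
  rewrite -exprMn ler_pXn2r// ?nnegrE ?subr_ge0 ?mulr_ge0 ?exprn_ge0//; lra.
have n0 : (0 : R) <= n%:R * x ^+ 2 by rewrite mulr_ge0 ?sqr_ge0.
apply: (@le_trans _ _ (2 * U * (n%:R * x ^+ 2))).
  by rewrite ler_wpM2l//; lra.
rewrite -[leRHS]mulrA ler_wpM2r// ler_wpM2l//.
apply: (le_trans U2); rewrite lerD2l ler_piMr// exprn_ge0//.
Qed.

End increments.

Section dyadic_increments.
Variables (R : realType) (alpha beta : R).
Hypothesis adm : admissible alpha beta.
Let p := 2 * beta + 1.
Let p_gt0 : 0 < p. Proof. by case: adm => h1 h2; rewrite /p; lra. Qed.
Let gam := alpha - beta - 2^-1.
Let gam_gt0 : 0 < gam. Proof. by case: adm => h1 h2; rewrite /gam; lra. Qed.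

(** The step from an even point of mesh [2 ^ - l.+1] to the next odd point. It starts at time [0]
    when [i = 0], where [X] vanishes and relative increments make no sense. *)
Definition dyadic_increment (l i : nat) : seq (R * R) :=
  if i is 0 then [:: (1, 1 / (2 ^ l.+1)%:R)]
  else increment ((2 * i).+1%:R / (2 ^ l.+1)%:R) ((2 * i)%:R / (2 ^ l.+1)%:R).

Lemma covform_single t : 0 < t -> covform alpha beta [:: (1, t)] [:: (1, t)] = cov alpha beta t t.
Proof. by move=> t0; rewrite /covform !big_seq1/= !mul1r gtr0_norm. Qed.

(** From [k * h] to [(k + 1) * h] the relative increment is [1 / k], so the variance is at most
    [C * (k * h) ^ (2 * gam) / k ^ 2]. As [k * h <= 1], the exponent [2 * gam] may be lowered to
    [kap <= 1 / 2], leaving [h ^ kap] times the summable [k ^ (- 3 / 2)]. *)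
Lemma sum_dyadic_increment : exists C r : R, [/\ 0 < C, 0 < r, r < 1 & forall l,
  \sum_(i < 2 ^ l) covform alpha beta (dyadic_increment l i) (dyadic_increment l i)
   <= C * r ^+ (4 * l.+1)].
Proof.
have [C C0 hC] := covform_increment_le adm.
pose kap := Num.min (2 * gam) (2^-1 : R).
have kap0 : 0 < kap by rewrite lt_min mulr_gt0//= invr_gt0.
have kapg : kap <= 2 * gam by rewrite ge_min lexx.
have kaph : kap <= 2^-1 by rewrite ge_min lexx orbT.
(* Chosen so that [h ^ kap = r ^ (4 * l.+1)]; the fourth root leaves room for thresholds decreasing
   like [r ^ n]. *)
pose r : R := 2 `^ (- (kap / 4)).
have r0 : 0 < r by exact: powR_gt0.
have ln2 : 0 < ln 2 :> R by rewrite ln_gt0// ltr1n.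
have r1 : r < 1.
  by rewrite /r gt0_powRE// expR_lt1 mulNr oppr_lt0 mulr_gt0// divr_gt0.
exists (1 + C * 3), r; split => //; first by rewrite addr_gt0// mulr_gt0.
move=> l; pose h : R := (2 ^ l.+1)%:R^-1.
have h0 : 0 < h by rewrite invr_gt0 ltr0n expn_gt0.
have h1 : h <= 1 by rewrite invf_le1 ?ltr0n ?expn_gt0// ler1n expn_gt0.
have hr : h `^ kap = r ^+ (4 * l.+1).
  rewrite /r -powR_mulrn ?powR_ge0// !gt0_powRE ?powR_gt0 ?expR_gt0//; congr expR.
  rewrite /h natrX lnV ?posrE ?exprn_gt0// lnXn// expRK natrM.
  by rewrite -mulr_natl; field.
rewrite -hr; have -> : (2 ^ l = (2 ^ l).-1.+1)%N by rewrite prednK// expn_gt0.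
rewrite big_ord_recl mulrDl mul1r; apply: lerD.
  rewrite /= div1r covform_single// cov_diag//.
  rewrite (_ : 2 * alpha - _ = 2 * gam); last by rewrite /gam; field.
  by rewrite !gt0_powRE// ler_expR ler_wnM2r// ln_le0.
apply: (@le_trans _ _ (\sum_(i < (2 ^ l).-1) C * h `^ kap * (Num.sqrt i.+1%:R ^+ 3)^-1)); last first.
  by rewrite (mulrAC C 3) -mulr_sumr ler_wpM2l ?sum_inv_sqrt3_le// mulr_ge0 ?powR_ge0// ltW.
apply: ler_sum => i _; rewrite lift0 /dyadic_increment.
set k : R := (2 * i.+1)%:R.
have k0 : 0 < k by rewrite ltr0n.
have k1 : 1 <= k by rewrite ler1n.
have -> : (2 * i.+1).+1%:R / (2 ^ l.+1)%:R = (k * h) * (1 + k^-1).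
  by rewrite -natr1 -/k mulrDr mulr1 mulrAC mulfV ?gt_eqF// mul1r mulrDl mul1r.
have -> : k / (2 ^ l.+1)%:R = k * h by [].
have kh0 : 0 < k * h by rewrite mulr_gt0.
have kh1 : k * h <= 1.
  rewrite ler_pdivrMr ?ltr0n ?expn_gt0// mul1r ler_nat expnS leq_mul2l//=.
  by rewrite (leq_trans (ltn_ord i)) ?leq_pred.
have ki : 0 <= k^-1 <= 1 by rewrite invr_ge0 (ltW k0) invf_le1.
apply: (le_trans (hC _ _ kh0 ki)); rewrite -!mulrA ler_wpM2l ?(ltW C0)//.
apply: (@le_trans _ _ ((k * h) `^ kap * k^-1 ^+ 2)).
  by rewrite ler_wpM2r ?sqr_ge0// !gt0_powRE// ler_expR ler_wnM2r// ln_le0.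
rewrite powRM ?(ltW k0) ?(ltW h0)// (mulrC (k `^ _)) -mulrA ler_wpM2l ?powR_ge0//.
apply: (@le_trans _ _ (Num.sqrt k * k^-1 ^+ 2)).
  rewrite ler_wpM2r ?sqr_ge0//.
  rewrite (_ : Num.sqrt k = k `^ 2^-1); last by rewrite powR12_sqrt// ltW.
  by rewrite ler_powR.
have s0 : 0 < Num.sqrt i.+1%:R :> R by rewrite sqrtr_gt0 ltr0n.
have sk : Num.sqrt i.+1%:R <= Num.sqrt k.
  by rewrite ler_wsqrtr// ler_nat leq_pmull.
have kk : k = Num.sqrt k ^+ 2 by rewrite sqr_sqrtr// ltW.
rewrite [X in _ * X^-1 ^+ 2]kk exprVn -exprM -[_ / _]invrK invf_div.
rewrite lef_pV2 ?posrE ?divr_gt0 ?exprn_gt0 ?(lt_le_trans s0 sk)//.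
rewrite (_ : _ / _ = Num.sqrt k ^+ 3); last first.
  by rewrite (exprSr _ 3) mulfK// gt_eqF// (lt_le_trans s0 sk).
by rewrite ler_pXn2r// nnegrE ?ltW// (lt_le_trans s0 sk).
Qed.

Context d (T : measurableType d) (P : probability T R).
Variables (X : R -> {RV P >-> R}) (mu : R).
Hypothesis isX : is_X alpha beta X.
Hypothesis mu_ge0 : 0 <= mu.

Lemma lincomb_dyadic_increment l i w : lincomb X (dyadic_increment l i) w =
  X ((2 * i).+1%:R / (2 ^ l.+1)%:R) w - X ((2 * i)%:R / (2 ^ l.+1)%:R) w.
Proof.
case: i => [|i]; rewrite /lincomb /= ?big_cons big_nil/= addr0 ?mul1r ?mulN1r.
  by rewrite muln0 mul0r (X_zero isX) subr0 ger0_norm// divr_ge0.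
by rewrite !ger0_norm// ?divr_ge0// addr0 mulN1r.
Qed.

(* Level [l0 + n + 1] gets the threshold [eps * (1 - r) * r ^ n]: the thresholds sum
   up to at most [eps], and the costs are still summable since the variances decay
   like [r ^ (4 l)]. *)
Lemma controlled_chain (C r eps c0 A : R) (l0 n : nat) : 0 < eps -> 0 < C -> 0 < r < 1 ->
  (forall l, \sum_(i < 2 ^ l) covform alpha beta (dyadic_increment l i) (dyadic_increment l i)
   <= C * r ^+ (4 * l.+1)) ->
  controlled alpha beta X mu c0 (dyadic_ball X A l0) ->
  controlled alpha beta X mu
    (c0 + mu * C * r ^+ (4 * l0) / eps ^+ 2 / (1 - r) ^+ 3 * (1 - r ^+ n))
    (dyadic_ball X (A + eps * (1 - r ^+ n)) (l0 + n)).
Proof.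
move=> eps0 C0 /andP[r0 r1] hC h0.
have r1' : 0 < 1 - r by rewrite subr_gt0.
elim: n => [|n IH].
  by rewrite addn0 expr0 subrr !mulr0 !addr0.
pose l := (l0 + n)%N; pose th := eps * (1 - r) * r ^+ n.
have th0 : 0 < th by rewrite !mulr_gt0 ?exprn_gt0.
pose q i := covform alpha beta (dyadic_increment l i) (dyadic_increment l i).
have hi i : i \in iota 0 (2 ^ l) -> controlled alpha beta X mu (mu * (q i / th ^+ 2))
    [set w | `|lincomb X (dyadic_increment l i) w| <= th].
  by move=> _; apply: (controlled_abs_small adm isX mu_ge0).
apply: controlled_weaken (controlled_and IH (controlled_seq hi)).
  rewrite -addrA lerD2l -lerBrDl -mulrBr (_ : 1 - r ^+ n.+1 - (1 - r ^+ n) = r ^+ n * (1 - r)); last first.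
    by rewrite exprSr; ring.
  have -> : \sum_(i <- iota 0 (2 ^ l)) mu * (q i / th ^+ 2) = mu / th ^+ 2 * \sum_(i < 2 ^ l) q i.
    rewrite -(big_mkord xpredT) /index_iota subn0 mulr_sumr.
    by apply: eq_bigr => i _; rewrite mulrCA mulrC -mulrA mulrC.
  apply: (le_trans (ler_wpM2l _ (hC l))); first by rewrite divr_ge0// sqr_ge0.
  rewrite (_ : _ * (r ^+ n * (1 - r)) = mu / th ^+ 2 * (C * (r ^+ (4 * l0) * r ^+ (3 * n)))); last first.
    rewrite /th !exprMn -exprM mulnC (mulnC 3) !exprM.
    by field; rewrite !gt_eqF// ?exprn_gt0.
  rewrite ler_wpM2l ?divr_ge0 ?sqr_ge0// ler_wpM2l ?(ltW C0)// -exprD.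
  apply: ler_wiXn2l; rewrite ?(ltW r0) ?(ltW r1)//.
  by rewrite mulnS mulnDr addnCA leq_add2l (leq_trans _ (leq_addl _ _))// leq_mul2r orbT.
move=> w [/= hb hw] k; rewrite addnS => kN.
(* An even [k] gives a point of the coarser grid; an odd one is reached from the even point below it
   by one increment. *)
have odd_even := odd_double_half k.
have A1 : eps * (1 - r ^+ n) + th = eps * (1 - r ^+ n.+1) by rewrite /th exprSr; ring.
have Xhalf : (k./2 <= 2 ^ l)%N -> `|X ((2 * k./2)%:R / (2 ^ l.+1)%:R) w| <= A + eps * (1 - r ^+ n).
  move=> kl; have := hb _ kl; rewrite expnS !natrM invfM mulrACA mulfV ?gt_eqF// mul1r.
  exact.
have kl : (k./2 <= 2 ^ l)%N.
  by rewrite leq_half_double -mul2n -expnS leqW.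
case: (boolP (odd k)) odd_even => ok; rewrite -mul2n => <- /=; last first.
  by apply: (le_trans (Xhalf kl)); rewrite -A1 lerD2l lerDl ltW.
have kl' : k./2 \in iota 0 (2 ^ l).
  rewrite mem_iota add0n /= ltn_half_double -mul2n -expnS ltn_neqAle kN andbT.
  by apply: contraTneq ok => ->; rewrite oddX.
have := hw _ kl'; rewrite lincomb_dyadic_increment add1n => hinc.
rewrite -[X in `|X|](subrK (X ((2 * k./2)%:R / (2 ^ l.+1)%:R) w)).
rewrite (le_trans (ler_normD _ _))// -A1 addrC addrA.
by apply: lerD => //; exact: Xhalf.
Qed.

End dyadic_increments.

(** * The lower bound on the probability *)

Lemma geometric_block (R : realType) (M t : R) (J : nat) : 1 < M -> t <= 1 -> M ^- J.+1 <= t ->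
  exists2 j, (j <= J)%N & M ^- j.+1 <= t <= M * M ^- j.+1.
Proof.
move=> M1 t1; have M0 : 0 < M by lra.
elim: J => [h|J IH h].
  by exists 0%N => //; rewrite h expr1 mulfV ?gt_eqF.
have [h'|h'] := leP (M ^- J.+1) t.
  by have [j jJ jt] := IH h'; exists j => //; exact: leqW.
exists J.+1 => //; rewrite h exprS invfM mulrA mulfV ?gt_eqF// mul1r; exact: ltW.
Qed.

Section base.
Variables (R : realType) (alpha beta : R).
Hypothesis adm : admissible alpha beta.
Let p := 2 * beta + 1.
Context d (T : measurableType d) (P : probability T R).
Variables (X : R -> {RV P >-> R}) (mu : R).
Hypothesis isX : is_X alpha beta X.
Hypothesis mu_ge0 : 0 <= mu.

(** [M] is the ratio [t / b] at which [(t - b) / (t + b)] equals [y0], so each block [[b, M * b]]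
    meets the hypothesis of [controlled_block]. Since [M ^ - J.+1 <= 2 ^ - l0], the [J.+1] blocks
    cover all positive grid points. *)
Lemma controlled_base (y0 eps : R) (m l0 J : nat) :
  let D := (1 - y0) `^ (- p) in
  let M := (1 + y0) / (1 - y0) in
  0 < y0 < 1 -> 0 < eps -> 2 ^+ l0 <= M ^+ J.+1 ->
  controlled alpha beta X mu
    (J.+1%:R * (m%:R * (ln (1 + 2 * mu * (D / (eps / 2 ^+ m) ^+ 2)) / 2) +
     (2 ^+ l0) * (mu * ((2 ^+ m) ^+ 2 * y0 ^+ m * D / eps ^+ 2))))
    (dyadic_ball X (2 * eps) l0).
Proof.
move=> D M /andP[y00 y01] eps0 MJ.
have y1 : 0 < 1 - y0 by lra.
have M1 : 1 < M by rewrite ltr_pdivlMr//; lra.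
have M0 : 0 < M by lra.
pose b j := M ^- j.+1.
have b0 j : 0 < b j by rewrite invr_gt0 exprn_gt0.
pose pts j := [seq t <- [seq i%:R / (2 ^ l0)%:R | i <- iota 1 (2 ^ l0)] | b j <= t <= M * b j].
have sp j : (size (pts j) <= 2 ^ l0)%N.
  by rewrite size_filter (leq_trans (count_size _ _))// size_map size_iota.
have p2 : (0 : R) < (2 ^ l0)%:R by rewrite ltr0n expn_gt0.
have hp j t : t \in pts j -> [/\ b j <= t, t <= 1 & (t - b j) / (t + b j) <= y0].
  rewrite mem_filter => /andP[/andP[bt tb] /mapP[i]]; rewrite mem_iota add1n ltnS => /andP[_ i2] tE.
  split => //; first by rewrite tE ler_pdivrMr// mul1r ler_nat.
  have tb0 : 0 < t + b j by rewrite addr_gt0// (lt_le_trans (b0 j)).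
  rewrite ler_pdivrMr//.
  have : t * (1 - y0) <= (1 + y0) * b j.
    by rewrite -ler_pdivlMr// mulrAC.
  lra.
have D0 : 0 < D by rewrite powR_gt0.
have y0' : 0 <= y0 < 1 by rewrite (ltW y00).
have h j : j \in iota 0 J.+1 -> controlled alpha beta X mu
   (m%:R * (ln (1 + 2 * mu * (D / (eps / 2 ^+ m) ^+ 2)) / 2) +
     (2 ^+ l0) * (mu * ((2 ^+ m) ^+ 2 * y0 ^+ m * D / eps ^+ 2)))
   [set w | forall t, t \in pts j -> `|X t w| <= 2 * eps].
  move=> _; apply: controlled_weaken (controlled_block adm isX mu_ge0 m (b0 j) y0' eps0 (@hp j)) => //.
  rewrite lerD2l ler_wpM2r ?mulr_ge0 ?invr_ge0 ?sqr_ge0 ?exprn_ge0 ?(ltW D0) ?(ltW y00)//.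
  by rewrite -natrX ler_nat.
have := controlled_seq h; rewrite sum_const_seq size_iota; apply: controlled_weaken => //.
move=> w /= hw i i2.
case: i i2 => [|i] i2.
  by rewrite mul0r (X_zero isX) normr0 mulr_ge0// ltW.
pose t : R := i.+1%:R / (2 ^ l0)%:R.
have t1 : t <= 1 by rewrite ler_pdivrMr// mul1r ler_nat.
have tJ : M ^- J.+1 <= t.
  apply: (@le_trans _ _ ((2 ^ l0)%:R^-1)).
    by rewrite lef_pV2 ?posrE ?exprn_gt0// natrX.
  by rewrite ler_peMl ?invr_ge0// ler1n.
have [j jJ jt] := geometric_block M1 t1 tJ.
have jI : j \in iota 0 J.+1 by rewrite mem_iota.
apply: (hw j jI).
rewrite mem_filter jt; apply: map_f.
by rewrite mem_iota add1n ltnS.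
Qed.

End base.

(** * Elementary estimates of the costs *)

Section elementary_bounds.
Variable R : realType.

Lemma two_expn_le (n : nat) : 2 ^+ n <= expR n%:R :> R.
Proof.
rewrite -[n%:R]mulr1 expRM_natl lerXn2r ?nnegrE ?expR_ge0//.
by apply: le_trans (expR_ge1Dx 1).
Qed.

Lemma pow4_le_expR (L : R) : 0 <= L -> L ^+ 4 <= expR (4 * L).
Proof.
move=> L0; rewrite expRM_natl lerXn2r ?nnegrE ?expR_ge0//.
by apply: le_trans (expR_ge1Dx L); rewrite lerDr.
Qed.

(** With [mu = L ^ 4] and [eps = expR (- L)] the argument is at most exponential in [L] and [m], so
    that one interpolation node has a cost linear in them. *)
Lemma ln_cost_le (D L : R) (m : nat) : 0 <= D -> 0 <= L ->
  ln (1 + 2 * L ^+ 4 * (D / (expR (- L) / 3 / 2 ^+ m) ^+ 2)) <= 18 * D + 6 * L + 2 * m%:R.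
Proof.
move=> D0 L0.
have -> : 2 * L ^+ 4 * (D / (expR (- L) / 3 / 2 ^+ m) ^+ 2) =
    18 * D * (L ^+ 4 * (2 ^+ m) ^+ 2 * expR L ^+ 2).
  have : (2 : R) ^+ m != 0 by rewrite expf_neq0.
  move: (2 ^+ m) => a a0; rewrite expRN.
  by field; rewrite a0 gt_eqF ?expR_gt0.
have h : L ^+ 4 * (2 ^+ m) ^+ 2 * expR L ^+ 2 <= expR (6 * L + 2 * m%:R).
  rewrite (_ : 6 * L + _ = 4 * L + 2 * m%:R + 2 * L); last by ring.
  rewrite !expRD (expRM_natl 2 L) (expRM_natl 2 m%:R).
  rewrite ler_wpM2r ?sqr_ge0//; apply: ler_pM; rewrite ?exprn_ge0//.
    exact: pow4_le_expR.
  by rewrite ler_pXn2r ?nnegrE ?exprn_ge0 ?expR_ge0// two_expn_le.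
rewrite -ler_expR lnK; last first.
  by rewrite posrE ltr_pwDl// !mulr_ge0// ?exprn_ge0 ?expR_ge0.
rewrite -addrA expRD.
have h1 : 1 <= expR (6 * L + 2 * m%:R) :> R.
  by rewrite -expR0 ler_expR addr_ge0// mulr_ge0.
have D1 : 0 <= 18 * D by rewrite mulr_ge0.
apply: (@le_trans _ _ ((1 + 18 * D) * expR (6 * L + 2 * m%:R))).
  by rewrite (mulrDl 1 (18 * D)) mul1r lerD// ler_wpM2l.
by rewrite ler_wpM2r ?expR_ge0// expR_ge1Dx.
Qed.

(** The value [expR (- 2) / 4] of [y0] reduces [4 ^ m * y0 ^ m] to [expR (- 2 * m)]. This beats the
    number [2 ^ l0] of points, [mu = L ^ 4 <= expR (4 * L)] and [eps ^ - 2 = expR (2 * L)]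
    together. *)
Lemma small_cost_le (D L : R) (l0 m : nat) : 0 <= D -> 0 <= L -> l0%:R + 4 * L <= m%:R ->
  2 ^+ l0 * (L ^+ 4 * ((2 ^+ m) ^+ 2 * (expR (- 2) / 4) ^+ m * D / (expR (- L) / 3) ^+ 2)) <= 9 * D.
Proof.
move=> D0 L0 hm.
have -> : (2 ^+ m) ^+ 2 * (expR (- 2) / 4) ^+ m = expR (- (2 * m%:R)) :> R.
  rewrite exprMn exprVn -exprM mulnC exprM (_ : 2 ^+ 2 = 4); last by ring.
  by rewrite mulrCA mulfV ?mulr1 ?expf_neq0// -expRM_natr mulNr.
have -> : 2 ^+ l0 * (L ^+ 4 * (expR (- (2 * m%:R)) * D / (expR (- L) / 3) ^+ 2)) =
   9 * D * (2 ^+ l0 * L ^+ 4 * expR (- (2 * m%:R)) * expR L ^+ 2).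
  by rewrite (expRN L); field; rewrite gt_eqF ?expR_gt0.
rewrite ler_piMr ?mulr_ge0//.
apply: (@le_trans _ _ (expR l0%:R * expR (4 * L) * expR (- (2 * m%:R)) * expR L ^+ 2)).
  rewrite ler_wpM2r ?sqr_ge0// ler_wpM2r ?expR_ge0//; apply: ler_pM; rewrite ?exprn_ge0//.
    exact: two_expn_le.
  exact: pow4_le_expR.
rewrite -expRM_natl -!expRD expR_le1.
have l0' : (0 : R) <= l0%:R by [].
lra.
Qed.

(** The last hypothesis says [r ^ (4 * l0) <= expR (- 8 * L)], more than enough against
    [L ^ 4 * eps ^ - 2 <= expR (6 * L)]. *)
Lemma chain_cost_le (C L r x : R) (l0 : nat) : 0 <= C -> 0 <= L -> 0 < r < 1 -> 0 <= x <= 1 ->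
  8 * L <= (4 * l0)%:R * - ln r ->
  L ^+ 4 * C * r ^+ (4 * l0) / (expR (- L) / 3) ^+ 2 / (1 - r) ^+ 3 * x <= 9 * C / (1 - r) ^+ 3.
Proof.
move=> C0 L0 /andP[r0 r1] /andP[x0 x1] hl.
have d0 : 0 < (1 - r) ^+ 3 by rewrite exprn_gt0 ?subr_gt0.
have h : L ^+ 4 * r ^+ (4 * l0) * expR L ^+ 2 <= 1.
  rewrite -[X in X ^+ (4 * l0)]lnK ?posrE// -expRM_natl -expRM_natl.
  apply: (@le_trans _ _ (expR (4 * L) * expR ((4 * l0)%:R * ln r) * expR (2 * L))).
    by rewrite ler_wpM2r ?expR_ge0// ler_wpM2r ?expR_ge0// pow4_le_expR.
  by rewrite -!expRD expR_le1; lra.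
have -> : L ^+ 4 * C * r ^+ (4 * l0) / (expR (- L) / 3) ^+ 2 / (1 - r) ^+ 3 * x =
   9 * C / (1 - r) ^+ 3 * (L ^+ 4 * r ^+ (4 * l0) * expR L ^+ 2 * x).
  move: (r ^+ (4 * l0)) ((1 - r) ^+ 3) d0 => a b b0.
  by rewrite expRN; field; rewrite !gt_eqF ?expR_gt0.
have K0 : 0 <= 9 * C / (1 - r) ^+ 3 by rewrite divr_ge0 ?(ltW d0)// mulr_ge0.
by rewrite ler_piMr// mulr_ile1// !mulr_ge0 ?exprn_ge0 ?expR_ge0// ltW.
Qed.

Lemma exists_nat_itv (L a : R) : 0 <= a -> 1 <= L ->
  exists n : nat, a * L <= n.+1%:R <= (a + 1) * L.
Proof.
move=> a0 L1; exists (Num.truncn (a * L)).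
have /andP[h1 h2] : (Num.truncn (a * L))%:R <= a * L < (Num.truncn (a * L)).+1%:R.
  by apply: truncn_itv; rewrite mulr_ge0//; lra.
rewrite ltW//= -natr1 mulrDl mul1r; lra.
Qed.

(** Here [u] counts blocks and [v] nodes per block; with the linear cost of a node, the three
    factors of order [L] make [L ^ 3]. *)
Lemma cube_cost_le (a1 a2 E D L u v : R) : 0 <= a1 -> 0 <= a2 -> 0 <= D -> 1 <= L ->
  0 <= u <= a1 * L -> 0 <= v <= a2 * L -> 0 <= E ->
  u * (v * ((18 * D + 6 * L + 2 * v) / 2) + 9 * D) + E <=
  (a1 * (a2 * (9 * D + 3 + a2) + 9 * D) + E) * L ^+ 3.
Proof.
move=> a10 a20 D0 L1 /andP[u0 ua] /andP[v0 va] E0.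
have L0 : 0 <= L by lra.
have L2 : 1 <= L ^+ 2 by exact: exprn_ege1.
have L3 : 1 <= L ^+ 3 by exact: exprn_ege1.
rewrite [leRHS]mulrDl; apply: lerD; last by rewrite ler_peMr.
have h1 : (18 * D + 6 * L + 2 * v) / 2 <= (9 * D + 3 + a2) * L.
  have : D <= D * L by rewrite ler_peMr.
  lra.
have h2 : v * ((18 * D + 6 * L + 2 * v) / 2) <= a2 * L * ((9 * D + 3 + a2) * L).
  apply: ler_pM => //; lra.
have h3 : 9 * D <= 9 * D * L ^+ 2 by rewrite ler_peMr ?mulr_ge0.
apply: (@le_trans _ _ (a1 * L * ((a2 * (9 * D + 3 + a2) + 9 * D) * L ^+ 2))); last by lra.
apply: ler_pM => //.
  by rewrite addr_ge0 ?mulr_ge0 ?divr_ge0//; lra.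
lra.
Qed.

Lemma expR_sub_ge (a b : R) : a + 1 <= b -> expR (- (a + 1)) <= expR (- a) - expR (- b).
Proof.
move=> ab; have h : expR (- b) <= expR (- (a + 1)) by rewrite ler_expR lerN2.
have -> : - a = 1 + - (a + 1) by ring.
rewrite expRD; have h2 : 2 <= expR 1 :> R by apply: le_trans (expR_ge1Dx 1).
have h0 := expR_gt0 (- (a + 1)); nra.
Qed.

End elementary_bounds.

Lemma dyadic_ball_subset d (T : measurableType d) (R : realType) (P : probability T R)
    (X : R -> {RV P >-> R}) (e e' : R) (N : nat) :
  e <= e' -> dyadic_ball X e N `<=` dyadic_ball X e' N.
Proof. by move=> ee w h i /h /le_trans; apply. Qed.

(** [K] is fixed before the probability space and the process, so that it can define a function of
    [alpha] and [beta] alone. It serves both as the constant and as the threshold for [- ln eps]. *)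
Lemma small_ball_prob_lower (R : realType) (alpha beta : R) : admissible alpha beta ->
  exists2 K : R, 0 < K &
    forall d (T : measurableType d) (P : probability T R) (X : R -> {RV P >-> R}),
    is_X alpha beta X -> forall eps, 0 < eps -> K <= - ln eps ->
    ((expR (- (K * (- ln eps) ^+ 3)))%:E <= P (small_ball X eps))%E.
Proof.
move=> adm; have [C [r [C0 r0 r1 hC]]] := sum_dyadic_increment adm.
pose y0 : R := expR (- 2) / 4.
have y00 : 0 < y0 by rewrite divr_gt0 ?expR_gt0.
have y01 : y0 < 1.
  rewrite ltr_pdivrMr// mul1r; apply: (@lt_trans _ _ 1); last by rewrite ltr1n.
  by rewrite expR_lt1 oppr_lt0.
pose D := (1 - y0) `^ (- (2 * beta + 1)); pose M := (1 + y0) / (1 - y0).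
have D0 : 0 < D by rewrite powR_gt0// subr_gt0.
have M1 : 1 < M by rewrite ltr_pdivlMr ?subr_gt0//; lra.
have M0 : 0 < M by lra.
have lM : 0 < ln M by exact: ln_gt0.
have lr : 0 < - ln r by rewrite oppr_gt0 ln_lt0// r0.
(* [a1], [a2] and [a3] bound, in units of [L], the starting level [l0], the number [m] of nodes per
   block and the number [J.+1] of blocks. The added [1] absorbs rounding; [m] is [l0] plus an
   integer between [4 * L] and [5 * L]. *)
pose a1 := 2 / - ln r + 1.
have a10 : 0 <= a1 by rewrite addr_ge0// divr_ge0// ltW.
pose a2 := a1 + 5; pose a3 := a1 / ln M + 1.
have a20 : 0 <= a2 by rewrite addr_ge0.
have a30 : 0 <= a3 by rewrite addr_ge0// divr_ge0// ltW.
pose E := 9 * C / (1 - r) ^+ 3.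
have E0 : 0 <= E.
  have h := subr_gt0 r 1; rewrite r1 in h.
  by rewrite divr_ge0 ?exprn_ge0 ?mulr_ge0 ?(ltW h)// ltW.
pose K0 := a3 * (a2 * (9 * D + 3 + a2) + 9 * D) + E.
have K00 : 0 <= K0.
  rewrite addr_ge0// mulr_ge0// addr_ge0 ?mulr_ge0 ?(ltW D0)//.
  by rewrite (addr_ge0 _ a20)// addr_ge0// mulr_ge0// ltW.
exists (K0 + 1); first by rewrite ltr_wpDl.
move=> d T P X isX eps eps0 KL; set L := - ln eps in KL *.
have L1 : 1 <= L by lra.
have L0 : 0 <= L by lra.
have epsE : eps = expR (- L) by rewrite /L opprK lnK.
have [l0' /andP[l0a l0b]] : exists n : nat, 2 / - ln r * L <= n.+1%:R <= a1 * L.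
  by apply: exists_nat_itv => //; rewrite divr_ge0// ltW.
move: {l0'}l0'.+1 l0a l0b => l0 l0a l0b.
have [k /andP[ka kb]] := @exists_nat_itv R L 4 (ler0n _ 4) L1.
move: {k}k.+1 ka kb => k ka kb.
have [m mE] : exists m : nat, m%:R = l0%:R + k%:R :> R by exists (l0 + k)%N; rewrite natrD.
have [J /andP[Ja Jb]] : exists J : nat, a1 / ln M * L <= J.+1%:R <= a3 * L.
  by apply: exists_nat_itv => //; rewrite divr_ge0// ltW.
have MJ : 2 ^+ l0 <= M ^+ J.+1.
  apply: (le_trans (two_expn_le _ _)); rewrite -[X in X ^+ J.+1]lnK ?posrE// -expRM_natl ler_expR.
  apply: (le_trans l0b); rewrite -ler_pdivrMr//.
  by apply: le_trans Ja; rewrite mulrAC.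
have y0' : 0 < y0 < 1 by rewrite y00.
have r01 : 0 < r < 1 by rewrite r0.
have mu0 : 0 <= L ^+ 4 by exact: exprn_ge0.
(* The coarse grid is controlled up to [2 * (eps / 3)] and the finer increments add at most
   [eps / 3]. *)
have e30 : 0 < eps / 3 by rewrite divr_gt0.
have base := controlled_base adm isX mu0 m y0' e30 MJ.
apply: (small_ball_prob_ge isX); exists l0 => // N /= lN.
have := controlled_chain adm isX mu0 (N - l0) e30 C0 r01 hC base.
rewrite subnKC//; set A := dyadic_ball _ _ _; set c := (Z in @controlled _ _ _ _ _ _ _ _ Z _) => hA.
have rn : 0 <= 1 - r ^+ (N - l0) <= 1.
  by rewrite subr_ge0 exprn_ile1 ?(ltW r0) ?(ltW r1)//= gerBl exprn_ge0// ltW.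
have AA : A `<=` dyadic_ball X eps N.
  apply: dyadic_ball_subset; case/andP: rn => _ rn; have := ler_wpM2l (ltW e30) rn; lra.
have cK : c <= K0 * L ^+ 3.
  apply: (le_trans _ (@cube_cost_le _ a3 a2 E D L J.+1%:R m%:R a30 a20 (ltW D0) L1 _ _ E0)).
  - rewrite /c epsE; apply: lerD; last first.
      apply: chain_cost_le => //; first exact: ltW.
      rewrite natrM -mulrA -ler_pdivrMl// -ler_pdivrMr//.
      rewrite (_ : 4^-1 * (8 * L) = 2 * L); last by field.
      by rewrite mulrAC.
    rewrite ler_wpM2l//; apply: lerD.
      by rewrite ler_wpM2l// ler_wpM2r// ln_cost_le// ltW.
    apply: small_cost_le => //; first exact: ltW.
    by rewrite mE lerD2l.
  - by rewrite Jb andbT.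
  - by rewrite ler0n /= mE /a2; lra.
have := controlled_prob adm isX mu0 (measurable_dyadic_ball X eps N)
  (controlled_weaken cK AA hA).
apply: le_trans; rewrite lee_fin.
have L3 : 1 <= L ^+ 3 by exact: exprn_ege1.
have KE : K0 * L ^+ 3 + L ^+ 3 = (K0 + 1) * L ^+ 3 by rewrite (mulrDl K0 1) mul1r.
have h3 : K0 * L ^+ 3 + 1 <= K0 * L ^+ 3 + L ^+ 3 by rewrite lerD2l.
(* Here [K0 + 1 <= L] is used: it makes the subtracted [expR (- mu)] at most half of the main
   term. *)
have h4 : K0 * L ^+ 3 + 1 <= L ^+ 4.
  by apply: (le_trans h3); rewrite KE (exprS L 3) ler_wpM2r// exprn_ge0.
apply: le_trans (expR_sub_ge h4).
by rewrite ler_expR lerN2 -KE.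
Qed.

(** Allowing any [k >= K] leaves the freedom to choose a constant that diverges as required. *)
Lemma small_ball_second_bound (R : realType) (alpha beta K k : R)
    d (T : measurableType d) (P : probability T R) (X : R -> {RV P >-> R}) :
  is_X alpha beta X -> 0 < K <= k ->
  (forall eps, 0 < eps -> K <= - ln eps ->
    ((expR (- (K * (- ln eps) ^+ 3)))%:E <= P (small_ball X eps))%E) ->
  lesssim0 (neg_log_small_ball X) (fun eps => (k * `|ln eps| ^+ 3)%:E).
Proof.
move=> isX /andP[K0 Kk] h; apply: lesssim0_le => e e0.
apply: filterS (near_lnN_ge K) => x [x0 xL].
have L0 : 0 < - ln x by exact: lt_le_trans xL.
have := h x x0 xL; have := probability_le1 P (measurable_small_ball isX x).
have := measure_ge0 P (small_ball X x).
rewrite /neg_log_small_ball -normrN gtr0_norm//.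
case: (P (small_ball X x)) => [q||]//; rewrite !lee_fin => q0 q1 hq.
have {}q0 : 0 < q := lt_le_trans (expR_gt0 _) hq.
have d0 : 0 < k * (- ln x) ^+ 3 by rewrite mulr_gt0 ?exprn_gt0// (lt_le_trans K0).
rewrite lne_EFin// -EFinN inver gt_eqF// -EFinM lee_fin ler_pdivrMr//.
apply: (@le_trans _ _ (K * (- ln x) ^+ 3)).
  by rewrite lerNl -ler_expR lnK.
apply: (@le_trans _ _ (k * (- ln x) ^+ 3)).
  by rewrite ler_wpM2r// exprn_ge0// ltW.
by rewrite ler_peMl ?(ltW d0)// lerDl ltW.
Qed.

Theorem theorem2 (R : realType) :
  exists kt : R -> R -> R,
    [/\ forall alpha beta : R, admissible alpha beta -> 0 < kt alpha beta,
        forall alpha beta : R, admissible alpha beta ->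
          forall (d : measure_display) (T : measurableType d)
            (P : probability T R) (X : R -> {RV P >-> R}),
          is_X alpha beta X ->
          lesssim0
            (fun eps => (kappa (alpha - 2^-1) beta * `|ln eps| ^+ 3)%:E)
            (neg_log_small_ball X) /\
          lesssim0
            (neg_log_small_ball X)
            (fun eps => (kt alpha beta * `|ln eps| ^+ 3)%:E)
      & forall M : R, exists2 delta : R, 0 < delta &
          forall alpha beta : R, admissible alpha beta ->
            alpha - beta < 2^-1 + delta -> M < kt alpha beta].
Proof.
(* The added [(alpha - beta - 1 / 2)^-1] only weakens the upper bound, and forces the divergence.
   Outside the admissible range the value [0] is a default. *)
pose kt (alpha beta : R) : R := match pselect (admissible alpha beta) with
  | left adm => sval (cid2 (small_ball_prob_lower adm)) + (alpha - beta - 2^-1)^-1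
  | right _ => 0
  end.
have gam_gt0 (alpha beta : R) : admissible alpha beta -> 0 < alpha - beta - 2^-1.
  by case=> h1 h2; lra.
exists kt; split.
- move=> alpha beta adm; rewrite /kt; case: pselect => // a.
  by case: cid2 => K K0 _ /=; rewrite addr_gt0// invr_gt0 gam_gt0.
- move=> alpha beta adm d T P X isX; split; first exact: small_ball_first_bound.
  rewrite /kt; case: pselect => // a; case: cid2 => K K0 hK /=.
  apply: (small_ball_second_bound isX (K := K)); last exact: hK.
  by rewrite K0 lerDl invr_ge0 ltW// gam_gt0.
(* If [alpha - beta - 1 / 2] is below this [delta], its inverse alone exceeds [M]. *)
- move=> M; exists (`|M| + 1)^-1; first by rewrite invr_gt0 ltr_wpDl.
  move=> alpha beta adm h; rewrite /kt; case: pselect => // a.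
  case: cid2 => K K0 _ /=; rewrite (le_lt_trans (ler_norm M))//.
  rewrite (lt_trans (ltr_pwDr ltr01 (lexx _)))// -[ltLHS]add0r.
  apply: ltrD => //; rewrite -[ltLHS]invrK ltf_pV2 ?posrE ?gam_gt0 ?invr_gt0 ?ltr_wpDl//.
  by lra.
Qed.
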